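(* Let $(b,c)$ be a connected transient graph over $X$. Then the following assertions are equivalent. (i) Every bounded harmonic function is zero. (ii) $Gc=1$ (identically on $X$), i.e., the constant function $1$ is a potential. (iii) The graph $(b,c)$ is stochastically complete at infinity and $e^{-tL}1\to 0$ pointwise on $X$ as $t\to\infty$. (iv) For all superharmonic $u\in\mathcal{P}$ one has $$\sum_{x\in X}\mathcal{L}u(x)=\sum_{x\in X}c(x)u(x),$$ where both sums are over non-negative terms (and may take the value $\infty$). (v) For any non-thick set $A\subseteq X$ and some (equivalently, all) $x\in X$, $$\sum_{y\in X\setminus A}G^b(x,y)c(y)=\infty.$$
   Context: Let $X$ be a countable set. A graph $(b,c)$ over $X$ consists of a symmetric function $b:X\times X\to[0,\infty)$ with $b(x,x)=0$ and $\sum_{y\in X}b(x,y)<\infty$ for all $x\in X$, and a function $c:X\to[0,\infty)$ (the killing term); if $c=0$ one writes $b$ for $(b,0)$. The graph is connected if for all $x,y\in X$ there are $x=y_1,\dots,y_{n+1}=y$ with $b(y_i,y_{i+1})>0$ for $1\le i\le n$. ''Positive'' means $\ge 0$. Let $\mathcal{F}=\{f:X\to\mathbb{R}\mid \sum_y b(x,y)|f(y)|<\infty \text{ for all }x\}$ and, for $f\in\mathcal{F}$, $\mathcal{L}f(x)=\mathcal{L}_{b,c}f(x)=\sum_y b(x,y)(f(x)-f(y))+c(x)f(x)$. A function $u\in\mathcal{F}$ is harmonic (superharmonic, subharmonic) if $\mathcal{L}u=0$ ($\ge0$, $\le0$) on $X$. Let $\mathcal{Q}(f)=\frac12\sum_{x,y}b(x,y)(f(x)-f(y))^2+\sum_x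 c(x)f(x)^2$, $\mathcal{D}=\{f:X\to\mathbb{R}\mid\mathcal{Q}(f)<\infty\}$, and let $\mathcal{D}_0$ be the closure of the finitely supported functions $C_c(X)$ in $\mathcal{D}$ with respect to $\|f\|_o=\sqrt{\mathcal{Q}(f)+|f(o)|^2}$ for a fixed $o\in X$. Let $L$ be the positive self-adjoint operator on $\ell^2(X)$ (counting measure) associated with the closed form obtained by restricting $\mathcal{Q}$ to $\mathcal{D}_0\cap\ell^2(X)$. Its semigroup is extended to bounded or positive functions $f$ by $e^{-tL}f(x)=\sum_y (e^{-tL}1_y)(x)f(y)$, where $1_y=1_{\{y\}}$ (for positive $f$ with values in $[0,\infty]$). The connected graph $(b,c)$ is transient if for every $y\in X$ there is a unique $G_y\in\mathcal{D}_0$ with $\mathcal{L}G_y=1_y$. Then $G(x,y)=G_y(x)=\int_0^\infty (e^{-tL}1_y)(x)\,dt$ is the Green function, and $Gk(x)=\sum_y G(x,y)k(y)$ for $k\ge0$ (with values in $[0,\infty]$) or for $k\in\mathcal{G}=\{k:X\to\mathbb{R}\mid\sum_yG(x,y)|k(y)|<\infty\text{ for all }x\}$. The set of potentials is $\mathcal{P}=\{u\in\mathcal{F}\mid u=Gk\text{ for some }k\in\mathcal{G}\}$. $G^b$ denotes the Green function of $(b,0)$, given by $G^b(x,y)=\int_0^\infty(e^{-tL_{b,0}}1_y)(x)\,dt$; if $(b,0)$ is not transient, $G^b(x,y)=\infty$, and $\infty\cdot0=0$. The graph $(b,c)$ is stochastically complete at infinity if for some (equivalently all) $t>0$ and some (equivalently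 all) $x\in X$, $M_t(x)=e^{-tL}1(x)+\int_0^t(e^{-sL}c)(x)\,ds=1$. A set $A\subseteq X$ is thick (with respect to $b$) if for any $(b,0)$-superharmonic function $s\ge0$ (that is, $s\in\mathcal{F}$ with $\mathcal{L}_{b,0}s\ge 0$) the inequality $s\ge1$ on $A$ implies $s\ge1$ on $X$; otherwise it is non-thick. *)

(* Defs.v *)
From mathcomp Require Import all_boot all_order all_algebra.
From mathcomp Require Import all_classical all_reals all_analysis.

Set Implicit Arguments.
Unset Strict Implicit.
Unset Printing Implicit Defensive.
Import Order.TTheory GRing.Theory Num.Theory.
Import numFieldNormedType.Exports.

Local Open Scope classical_set_scope.
Local Open Scope ring_scope.

(* [\esum] only computes sums of non-negative terms.  [rsum f] is the sum of
   an absolutely summable real family; it is meaningless for other families,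
   so absolute summability is required explicitly wherever it matters. *)
Definition rsum (R : realType) (I : choiceType) (f : I -> R) : R :=
  fine (\esum_(i in [set: I]) (Num.max (f i) 0)%:E)
  - fine (\esum_(i in [set: I]) (Num.max (- f i) 0)%:E).

Section l2.
Context {R : realType} {X : choiceType}.
Implicit Types f g : X -> R.

Definition l2 f : Prop := (\esum_(x in [set: X]) (f x ^+ 2)%:E < +oo)%E.

Definition l2norm f : R :=
  Num.sqrt (fine (\esum_(x in [set: X]) (f x ^+ 2)%:E)).

Definition l2dot f g : R := rsum (fun x => f x * g x).

(* [T] restricted to [0 <= t] and to l2 is a strongly continuous semigroup of
   bounded linear operators whose generator is exactly [- L], where the
   (possibly unbounded) operator [L] is given by its graph. *)
Record semigroup_of (L : (X -> R) -> (X -> R) -> Prop)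
    (T : R -> (X -> R) -> X -> R) : Prop := SemigroupOf {
  semigroup_l2 : forall (t : R) f, 0 <= t -> l2 f -> l2 (T t f) ;
  semigroup_linear : forall (t a : R) f g, 0 <= t -> l2 f -> l2 g ->
    T t (fun x => a * f x + g x) = (fun x => a * T t f x + T t g x) ;
  semigroup_bounded : forall t : R, 0 <= t ->
    exists M : R, forall f, l2 f -> l2norm (T t f) <= M * l2norm f ;
  semigroup0 : forall f, l2 f -> T 0 f = f ;
  semigroupD : forall (s t : R) f, 0 <= s -> 0 <= t -> l2 f ->
    T (s + t) f = T s (T t f) ;
  semigroup_continuous : forall f, l2 f ->
    l2norm (fun x => T t f x - f x) @[t --> (0 : R)^'+] --> (0 : R) ;
  semigroup_generator : forall f g, l2 f -> l2 g ->
    (l2norm (fun x => (T t f x - f x) / t - g x) @[t --> (0 : R)^'+]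
       --> (0 : R))
    <-> L f (fun x => - g x) }.

End l2.

Definition ind1 {R : realType} {X : eqType} (y : X) : X -> R :=
  fun x => (x == y)%:R.

Section graph.
Context {R : realType} {X : countType}.
Implicit Types (b : X -> X -> R) (c f g u k : X -> R) (o x y : X).

Record is_graph b c : Prop := Graph {
  graph_b_ge0 : forall x y, 0 <= b x y ;
  graph_b_sym : forall x y, b x y = b y x ;
  graph_b_diag : forall x, b x x = 0 ;
  graph_b_sum : forall x, (\esum_(y in [set: X]) (b x y)%:E < +oo)%E ;
  graph_c_ge0 : forall x, 0 <= c x }.

Definition connected_graph b : Prop :=
  forall x y, exists p : seq X, path (fun v w => 0 < b v w) x p /\ last x p = y.

Definition inF b f : Prop :=
  forall x, (\esum_(y in [set: X]) (b x y * `|f y|)%:E < +oo)%E.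

Definition Lap b c f x : R := rsum (fun y => b x y * (f x - f y)) + c x * f x.

Definition harmonic_fun b c u : Prop := inF b u /\ forall x, Lap b c u x = 0.

Definition superharmonic_fun b c u : Prop :=
  inF b u /\ forall x, 0 <= Lap b c u x.

Definition energy b c f : \bar R :=
  ((2^-1)%:E * (\esum_(p in [set: X * X]) (b p.1 p.2 * (f p.1 - f p.2) ^+ 2)%:E)
   + \esum_(x in [set: X]) (c x * f x ^+ 2)%:E)%E.

Definition finite_energy b c f : Prop := (energy b c f < +oo)%E.

Definition onorm b c o f : R := Num.sqrt (fine (energy b c f) + `|f o| ^+ 2).

Definition finitely_supported f : Prop := finite_set [set x | f x != 0].

Definition D0 b c o f : Prop :=
  finite_energy b c f /\
  forall e : R, 0 < e -> exists phi : X -> R,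
    finitely_supported phi /\ onorm b c o (fun x => f x - phi x) < e.

Definition form_dom b c o f : Prop := D0 b c o f /\ l2 f.

(* The polarization of [energy]. *)
Definition dirichlet_form b c f g : R :=
  2^-1 * rsum (fun p : X * X => b p.1 p.2 * (f p.1 - f p.2) * (g p.1 - g p.2))
  + rsum (fun x => c x * f x * g x).

(* Graph of the self-adjoint operator associated with the closed form
   [dirichlet_form] on [form_dom]: [opL b c o f g] reads "f is in the domain
   and L f = g". *)
Definition opL b c o f g : Prop :=
  [/\ form_dom b c o f, l2 g &
      forall h, form_dom b c o h ->
        dirichlet_form b c f h = l2dot g h].

(* [heat b c o t f] is [e^{-tL} f] for [t >= 0] and [f] in l2. The semigroup
   generated by [- L] exists and is unique there, so the choice is harmless. *)
Definition heat b c o : R -> (X -> R) -> X -> R :=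
  xget (fun _ f => f) [set T | semigroup_of (opL b c o) T].

(* The extension of the semigroup to positive functions. *)
Definition heat_ext b c o (t : R) (f : X -> \bar R) x : \bar R :=
  (\esum_(y in [set: X]) ((heat b c o t (ind1 y) x)%:E * f y))%E.

(* Finite-energy functions lie in F, so the [inF] clause is redundant; it makes
   explicit that the total operator [Lap] is applied where it is meaningful. *)
Definition is_green b c o y f : Prop :=
  [/\ D0 b c o f, inF b f & forall x, Lap b c f x = ind1 y x].

Definition transient b c o : Prop := forall y, exists! f, is_green b c o y f.

(* [green b c o x y] is [G(x,y) = G_y(x)]; meaningful for transient graphs. *)
Definition green b c o x y : R := xget (fun=> 0) [set f | is_green b c o y f] x.

Definition Gpos b c o k x : \bar R :=
  (\esum_(y in [set: X]) (green b c o x y * k y)%:E)%E.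

Definition in_calG b c o k : Prop := forall x,
  (\esum_(y in [set: X]) (green b c o x y * `|k y|)%:E < +oo)%E.

Definition potential b c o u : Prop :=
  inF b u /\ exists k, in_calG b c o k /\
    forall x, u x = rsum (fun y => green b c o x y * k y).

(* Green function of the graph without killing, [+oo] if it is not transient *)
Definition Gb b o x y : \bar R :=
  if `[< transient b (fun=> 0) o >] then
    (\int[lebesgue_measure]_(t in `[0%R, +oo[)
       (heat b (fun=> 0%R) o t (ind1 y) x)%:E)%E
  else +oo%E.

Definition Mt b c o (t : R) x : \bar R :=
  (heat_ext b c o t (fun=> 1%E) x +
   \int[lebesgue_measure]_(s in `[0%R, t])
     heat_ext b c o s (fun y => (c y)%:E) x)%E.

Definition stochastically_complete_at_infinity b c o : Prop :=
  exists t : R, 0 < t /\ exists x, Mt b c o t x = 1%E.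

Definition thick b (A : set X) : Prop :=
  forall s : X -> R, superharmonic_fun b (fun=> 0) s -> (forall x, 0 <= s x) ->
    (forall x, A x -> 1 <= s x) -> forall x, 1 <= s x.

End graph.

(* Main.v *)
(** The Green function is built as the minimal non-negative solution of
    [L u = 1_y], obtained by monotone iteration; it is finite as soon as point
    evaluations are bounded for [Q] on finitely supported functions, which
    follows from transience.  By minimality every [s >= 0] with [L s >= k >= 0]
    dominates [G k].  Hence [G c <= 1], [h := 1 - G c] is harmonic with
    [0 <= h <= 1], and all assertions amount to [h = 0]:
    - (i): if [u] is harmonic and [|u| <= M] then [L (M + u) = M c], so
      [M + u >= M G c];
    - (iii): Duhamel's formula [\int_0^t e^{-sL} c ds + e^{-tL} G c = G c] shows
      that stochastic completeness at infinity is [e^{-tL} h = h] at one point,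
      thus everywhere by positivity of the heat kernel;
    - (iv): by symmetry of [G], [\sum_x c x * u x = \sum_y L u y * G c y] for
      [u = G (L u)], and [u = G_y] gives the converse;
    - (v): with [v := G^b (c 1_{X \ A})] finite and [s >= 1] on [A] superharmonic
      for [b], one has [L (s + v) >= c], so [s + v >= G c = 1] and then [s >= 1]
      by minimality of [v]; conversely [A := {h <= d}] is not thick and
      [G^b (c h) <= 1 - h].
    The semigroup is the limit of the backward Euler products
    [(1 + t / 2^k L)^{- 2^k}], whose resolvents are Green operators of the graph
    with a larger killing term; positivity, symmetry and domination by
    superharmonic functions pass to the limit. *)

Require Import Defs.
From mathcomp Require Import all_boot all_order all_algebra.
From mathcomp Require Import all_classical all_reals all_analysis.
From mathcomp Require Import measurable_realfun.
From mathcomp Require Import ring lra.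

Set Implicit Arguments.
Unset Strict Implicit.
Unset Printing Implicit Defensive.
Import Order.TTheory GRing.Theory Num.Theory.
Import numFieldNormedType.Exports.

Local Open Scope classical_set_scope.
Local Open Scope ring_scope.

(** * Real and extended-real sums *)

(** [heat] is selected by choice among all maps satisfying [semigroup_of], and that record only asks
    each single operator to be bounded. Constructing one semigroup therefore says nothing about
    [heat] until uniqueness is known, and uniqueness needs a bound that is uniform for small times.
    Hence the gliding-hump argument and the comparison with an arbitrary semigroup of the same
    generator.

    The second obstacle is the closure [D0]. The limits of the iterations are only known as
    pointwise limits with bounded energy, so membership in [D0] rests on [D0_bounded_limit], which
    replaces weak compactness by energy minimisation. The same criterion, applied to truncated
    approximations, identifies the form domain with [D0] of the graph with killing term c + a; there
    the operator defined by the form meets the pointwise Laplacian.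

    Dropping the killing term can make the graph recurrent. Then [Gb] is infinite, and (v) is
    settled by the fact that non-negative superharmonic functions of a recurrent graph are
    constant. *)

Section sums.
Context {R : realType} {I : choiceType}.
Implicit Types f g u v : I -> R.

Definition summ f : Prop := (\esum_(i in [set: I]) `|f i|%:E < +oo)%E.

Lemma esum_le_seq (f : I -> \bar R) (M : \bar R) :
  (forall s : seq I, uniq s -> \sum_(i <- s) f i <= M)%E ->
  (\esum_(i in [set: I]) f i <= M)%E.
Proof.
move=> H; apply: ge_ereal_sup => _ [A [finA _]] <-.
by rewrite fsbig_finite//; apply: H; exact: finmap.fset_uniq.
Qed.

Lemma seq_le_esum (f : I -> \bar R) (s : seq I) : uniq s ->
  (forall i, 0 <= f i)%E ->
  (\sum_(i <- s) f i <= \esum_(i in [set: I]) f i)%E.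
Proof.
move=> us f0; apply: esum_ge; exists [set` s]; first by split.
rewrite fsbig_finite//=.
have P : perm_eq (finmap.enum_fset (fset_set [set` s])) s.
  by apply: uniq_perm => // i; rewrite in_fset_set// mem_setE.
by rewrite (perm_big _ P).
Qed.

Lemma esum_ge1 (f : I -> \bar R) i : (forall i, 0 <= f i)%E ->
  (f i <= \esum_(i in [set: I]) f i)%E.
Proof.
by move=> f0; have := @seq_le_esum f [:: i] isT f0; rewrite big_seq1.
Qed.

Lemma esum_neqNy (f : I -> \bar R) (A : set I) :
  (forall i, 0 <= f i)%E -> (0 <= \esum_(i in A) f i)%E.
Proof. by move=> f0; apply: esum_ge0. Qed.

Lemma esumZ (a : R) (A : set I) (f : I -> \bar R) : 0 <= a ->
  (forall i, A i -> 0 <= f i)%E ->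
  (\esum_(i in A) (a%:E * f i) = a%:E * \esum_(i in A) f i)%E.
Proof.
move=> a0 f0.
have H B : finite_set B -> B `<=` A ->
    (\sum_(i \in B) (a%:E * f i) = a%:E * \sum_(i \in B) f i)%E.
  move=> finB BA; rewrite !fsbig_finite//= big_seq [in RHS]big_seq.
  rewrite ge0_sume_distrr// => i.
  by rewrite in_fset_set// inE => /BA /f0.
rewrite /esum -ereal_supZl//; last first.
  apply/set0P; exists (\sum_(x \in set0) f x)%E.
  by exists set0 => //; exact: fsets_set0.
congr ereal_sup; apply/seteqP; split => x /=.
  move=> [B [finB BA] <-]; exists (\sum_(x \in B) f x)%E; first by exists B.
  by rewrite H.
by move=> [_ [B [finB BA] <-] <-]; exists B => //; rewrite H.
Qed.

Lemma summ_fin f : summ f ->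
  (\esum_(i in [set: I]) (Num.max (f i) 0)%:E \is a fin_num) /\
  (\esum_(i in [set: I]) (Num.max (- f i) 0)%:E \is a fin_num).
Proof.
move=> sf.
have H g : (forall i, g i <= `|f i|) ->
    (\esum_(i in [set: I]) (Num.max (g i) 0)%:E \is a fin_num).
  move=> gf; rewrite ge0_fin_numE; last first.
    by rewrite esum_neqNy// => i; rewrite lee_fin le_max lexx orbT.
  apply: le_lt_trans sf; apply: le_esum => i _.
  by rewrite lee_fin ge_max normr_ge0 andbT.
by split; apply: H => i; rewrite ?ler_norm// -normrN ler_norm.
Qed.

Lemma esum_fineK f : (forall i, 0 <= f i) ->
  (\esum_(i in [set: I]) (f i)%:E < +oo)%E ->
  (fine (\esum_(i in [set: I]) (f i)%:E))%:E
    = (\esum_(i in [set: I]) (f i)%:E)%E.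
Proof.
by move=> f0 fy; rewrite fineK// ge0_fin_numE// esum_neqNy.
Qed.

(** Two splittings of [f] into summable non-negative parts agree after adding them crosswise, which
    avoids differences of infinite sums. Additivity and homogeneity of [rsum] are read off from
    this. *)
Lemma rsum_diff (p q f : I -> R) : (forall i, 0 <= p i) -> (forall i, 0 <= q i) ->
  (\esum_(i in [set: I]) (p i)%:E < +oo)%E ->
  (\esum_(i in [set: I]) (q i)%:E < +oo)%E ->
  (forall i, f i = p i - q i) ->
  rsum f = fine (\esum_(i in [set: I]) (p i)%:E)
           - fine (\esum_(i in [set: I]) (q i)%:E).
Proof.
move=> p0 q0 sp sq fE; rewrite /rsum.
have sf : summ f.
  rewrite /summ; apply: (@le_lt_trans _ _
      (\esum_(i in [set: I]) ((p i)%:E + (q i)%:E))%E).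
    apply: le_esum => i _; rewrite -EFinD lee_fin fE.
    by rewrite (le_trans (ler_normB _ _))// !ger0_norm.
  by rewrite esumD ?lte_add_pinfty// => i _; rewrite lee_fin.
have [fp fn] := summ_fin sf.
set a := fine _; set a' := fine _; set d := fine _; set d' := fine _.
suff : a + d' = d + a' by move=> H; rewrite -(addrK d' a) H; ring.
apply: EFin_inj; rewrite !EFinD !fineK//; first last.
- by rewrite ge0_fin_numE ?esum_neqNy// => i; rewrite lee_fin.
- by rewrite ge0_fin_numE ?esum_neqNy// => i; rewrite lee_fin.
rewrite -!esumD//; do ?by move=> i _; rewrite lee_fin ?le_max ?lexx ?orbT.
apply: eq_esum => i _; rewrite -!EFinD; congr EFin; rewrite fE.
by rewrite /Num.max; case: ifPn; case: ifPn; rewrite -?leNgt; lra.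
Qed.

Lemma rsum_ge0E f : (forall i, 0 <= f i) ->
  rsum f = fine (\esum_(i in [set: I]) (f i)%:E).
Proof.
move=> f0; rewrite /rsum (eq_esum (b := fun i => (f i)%:E)); last first.
  by move=> i _; rewrite max_l.
by rewrite [X in _ - fine X]esum1 ?subr0// => i _; rewrite max_r// oppr_le0.
Qed.

Lemma eq_rsum f g : f =1 g -> rsum f = rsum g.
Proof. by move=> /funext ->. Qed.

Lemma ge0_rsum f : (forall i, 0 <= f i) -> 0 <= rsum f.
Proof.
by move=> f0; rewrite rsum_ge0E// fine_ge0// esum_neqNy.
Qed.

Lemma summ_le f g : (forall i, `|f i| <= g i) ->
  (\esum_(i in [set: I]) (g i)%:E < +oo)%E -> summ f.
Proof.
by move=> fg; apply: le_lt_trans; apply: le_esum => i _; rewrite lee_fin.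
Qed.

Lemma summ_ge0 f : (forall i, 0 <= f i) ->
  summ f <-> (\esum_(i in [set: I]) (f i)%:E < +oo)%E.
Proof.
by move=> f0; rewrite /summ (eq_esum (b := fun i => (f i)%:E))// => i _; rewrite ger0_norm.
Qed.

Lemma summD f g : summ f -> summ g -> summ (fun i => f i + g i).
Proof.
move=> sf sg; apply: (@summ_le _ (fun i => `|f i| + `|g i|)).
  by move=> i; exact: ler_normD.
under eq_esum do rewrite EFinD.
by rewrite esumD ?lte_add_pinfty// => i _; rewrite lee_fin.
Qed.

Lemma summZ (a : R) f : summ f -> summ (fun i => a * f i).
Proof.
move=> sf; apply: (@summ_le _ (fun i => `|a| * `|f i|)).
  by move=> i; rewrite normrM.
under eq_esum do rewrite EFinM.
by rewrite esumZ// ?lte_mul_pinfty ?lee_fin.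
Qed.

Lemma summN f : summ f -> summ (fun i => - f i).
Proof. by rewrite /summ; under eq_esum do rewrite -normrN. Qed.

Lemma summ0 : summ (fun=> 0).
Proof. by rewrite /summ esum1// => i _; rewrite normr0. Qed.

Lemma summ_pos f : summ f ->
  (\esum_(i in [set: I]) (Num.max (f i) 0)%:E < +oo)%E.
Proof. by move=> /summ_fin[+ _]; rewrite ge0_fin_numE// esum_neqNy// => i; rewrite lee_fin le_max lexx orbT. Qed.

Lemma rsumN f : rsum (fun i => - f i) = - rsum f.
Proof.
by rewrite /rsum opprB; under [X in _ - fine X = _]eq_esum do rewrite opprK.
Qed.

Lemma rsumD f g : summ f -> summ g ->
  rsum (fun i => f i + g i) = rsum f + rsum g.
Proof.
move=> sf sg; pose p (h : I -> R) (i : I) : R := Num.max (h i) 0.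
have p0 h i : 0 <= p h i by rewrite le_max lexx orbT.
have sp h : summ h -> (\esum_(i in [set: I]) (p h i)%:E < +oo)%E by move/summ_pos.
pose n (h : I -> R) : I -> R := fun i => - h i.
have e (h h' : I -> R) : (forall i, 0 <= h i) -> (forall i, 0 <= h' i) ->
    (\esum_(i in [set: I]) (h i + h' i)%:E = (\esum_(i in [set: I]) (h i)%:E)
      + \esum_(i in [set: I]) (h' i)%:E)%E.
  move=> h0 h'0; under eq_esum do rewrite EFinD.
  by rewrite esumD// => i _; rewrite lee_fin.
rewrite (@rsum_diff (fun i => p f i + p g i) (fun i => p (n f) i + p (n g) i)).
- rewrite !e//.
  have [f1 f2] := summ_fin sf; have [g1 g2] := summ_fin sg.
  by rewrite !fineD// /rsum /p /n; ring.
- by move=> i; rewrite addr_ge0.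
- by move=> i; rewrite addr_ge0.
- by rewrite e// lte_add_pinfty ?sp.
- by rewrite e// lte_add_pinfty ?sp//; exact: summN.
- by move=> i; rewrite /p /n /Num.max; do ![case: ifPn]; rewrite -?leNgt; lra.
Qed.

Lemma rsumZ (a : R) f : summ f -> rsum (fun i => a * f i) = a * rsum f.
Proof.
wlog a0 : a f / 0 <= a.
  move=> H sf; have [/H->//|/ltW a0] := leP 0 a.
  have := H (- a) (fun i => - f i); rewrite oppr_ge0 a0 => /(_ isT (summN sf)).
  by rewrite rsumN mulrNN => <-; apply: eq_rsum => i; rewrite mulrNN.
move=> sf; have [fp fn] := summ_fin sf.
have m0 (h : I -> R) i : 0 <= Num.max (h i) 0 by rewrite le_max lexx orbT.
have e (h : I -> R) : (forall i, 0 <= h i) -> (\esum_(i in [set: I]) (a * h i)%:E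
    = a%:E * \esum_(i in [set: I]) (h i)%:E)%E.
  by move=> h0; under eq_esum do rewrite EFinM; rewrite esumZ// => i _; rewrite lee_fin.
rewrite (@rsum_diff (fun i => a * Num.max (f i) 0) (fun i => a * Num.max (- f i) 0)).
- by rewrite (e _ (m0 f)) (e _ (m0 (fun i => - f i))) !fineM//= mulrBr.
- by move=> i; rewrite mulr_ge0// le_max lexx orbT.
- by move=> i; rewrite mulr_ge0// le_max lexx orbT.
- rewrite (e _ (m0 f)) lte_mul_pinfty ?lee_fin//; exact: summ_pos.
- rewrite (e _ (m0 (fun i => - f i))) lte_mul_pinfty ?lee_fin//.
  exact/summ_pos/summN.
- move=> i; rewrite -mulrBr; congr (_ * _).
  by rewrite /Num.max; do ![case: ifPn]; rewrite -?leNgt; lra.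
Qed.

Lemma rsumB f g : summ f -> summ g ->
  rsum (fun i => f i - g i) = rsum f - rsum g.
Proof. by move=> sf sg; rewrite rsumD ?rsumN//; exact: summN. Qed.

Lemma rsum0 : rsum (fun _ : I => 0 : R) = 0.
Proof. by rewrite rsum_ge0E// esum1. Qed.

Lemma ler_rsum f g : summ f -> summ g -> (forall i, f i <= g i) ->
  rsum f <= rsum g.
Proof.
move=> sf sg fg; rewrite -subr_ge0 -rsumB//.
by apply: ge0_rsum => i; rewrite subr_ge0.
Qed.

Lemma rsum_single (f : I -> R) z : (forall i, i != z -> f i = 0) ->
  summ f /\ rsum f = f z.
Proof.
move=> f0.
have e (h : I -> R) : (forall i, i != z -> h i = 0) -> 0 <= h z ->
    (\esum_(i in [set: I]) (h i)%:E = (h z)%:E)%E.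
  move=> h0 hz; rewrite -(@esum_set1 _ _ z (fun i => (h i)%:E)) ?lee_fin//.
  rewrite [RHS]esum_mkcond; apply: eq_esum => i _.
  by case: ifPn => //; rewrite notin_setE /= => /eqP/h0 ->.
split.
  rewrite /summ (e (fun i => `|f i|)) ?ltry// => i /f0 ->; exact: normr0.
rewrite /rsum !(e (fun i => Num.max _ 0)) ?le_max ?lexx ?orbT//.
- by rewrite /Num.max /=; do ![case: ifPn]; rewrite -?leNgt; lra.
- by move=> i /f0 ->; rewrite oppr0 maxxx.
- by move=> i /f0 ->; rewrite maxxx.
Qed.

Lemma rsum_fin (T : choiceType) (s : seq T) (F : T -> I -> R) :
  (forall j, summ (F j)) ->
  summ (fun i => \sum_(j <- s) F j i) /\
  rsum (fun i => \sum_(j <- s) F j i) = \sum_(j <- s) rsum (F j).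
Proof.
move=> sF; elim: s => [|j s [IH1 IH2]].
  have -> : (fun i => \sum_(j <- [::]) F j i) = (fun=> 0).
    by apply/funext => i; rewrite big_nil.
  by rewrite big_nil rsum0; split => //; exact: summ0.
have -> : (fun i => \sum_(k <- j :: s) F k i) =
    (fun i => F j i + \sum_(k <- s) F k i).
  by apply/funext => i; rewrite big_cons.
by rewrite big_cons rsumD// IH2; split => //; exact: summD.
Qed.

Lemma le_summ_seq f (s : seq I) : (forall i, 0 <= f i) -> summ f -> uniq s ->
  \sum_(i <- s) f i <= rsum f.
Proof.
move=> f0 sf us; rewrite rsum_ge0E// -lee_fin esum_fineK//; last exact: ((summ_ge0 f0).1 sf).
by rewrite -sumEFin seq_le_esum// => i; rewrite lee_fin.
Qed.

Lemma rsum_EFin f : (forall i, 0 <= f i) -> summ f ->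
  ((rsum f)%:E = \esum_(i in [set: I]) (f i)%:E)%E.
Proof. by move=> f0 sf; rewrite rsum_ge0E// esum_fineK//; exact: ((summ_ge0 f0).1 sf). Qed.

End sums.

Lemma cvg_sum_seq {R : realType} {I : choiceType} (s : seq I) (f : nat -> I -> R)
    (l : I -> R) : (forall i, f n i @[n --> \oo] --> l i) ->
  \sum_(i <- s) f n i @[n --> \oo] --> \sum_(i <- s) l i.
Proof.
move=> fl; elim: s => [|i s IH].
  under eq_fun do rewrite big_nil.
  by rewrite big_nil; exact: cvg_cst.
under eq_fun do rewrite big_cons.
by rewrite big_cons; apply: cvgD.
Qed.

(** Finite partial sums pass to the limit; then suprema are taken over one index set and over the
    other. Two families share one bound because an energy is a sum over edges plus a sum over
    vertices. *)
Lemma fatou_esum2 {R : realType} {I J : choiceType}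
    (f : nat -> I -> R) (f' : I -> R) (g : nat -> J -> R) (g' : J -> R)
    (M : R) (N : nat) :
  (forall n i, 0 <= f n i) -> (forall n i, 0 <= g n i) ->
  (forall i, f n i @[n --> \oo] --> f' i) ->
  (forall i, g n i @[n --> \oo] --> g' i) ->
  (forall n, (N <= n)%N -> (\esum_(i in [set: I]) (f n i)%:E
    + \esum_(i in [set: J]) (g n i)%:E <= M%:E)%E) ->
  (\esum_(i in [set: I]) (f' i)%:E + \esum_(i in [set: J]) (g' i)%:E
    <= M%:E)%E.
Proof.
move=> f0 g0 ff gg H.
have f'0 i : 0 <= f' i by apply: (cvgr_to_ge (ff i)); exact: nearW.
have g'0 i : 0 <= g' i by apply: (cvgr_to_ge (gg i)); exact: nearW.
have K s t : uniq s -> uniq t -> \sum_(i <- s) f' i + \sum_(i <- t) g' i <= M.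
  move=> us ut.
  apply: (cvgr_to_le (cvgD (cvg_sum_seq (s := s) ff) (cvg_sum_seq (s := t) gg))).
  exists N => // n /= Nn; rewrite -lee_fin EFinD -!sumEFin.
  apply: le_trans (H n Nn); apply: leeD; apply: seq_le_esum => // i;
    by rewrite lee_fin.
have K1 t : uniq t -> (\esum_(i in [set: I]) (f' i)%:E
    <= (M - \sum_(i <- t) g' i)%:E)%E.
  by move=> ut; apply: esum_le_seq => s us; rewrite sumEFin lee_fin lerBrDr K.
have fy : (\esum_(i in [set: I]) (f' i)%:E < +oo)%E.
  by apply: le_lt_trans (K1 [::] isT) _; rewrite ltry.
rewrite -(esum_fineK f'0 fy) addeC -leeBrDr// -EFinB.
apply: esum_le_seq => t ut; rewrite sumEFin lee_fin lerBrDr.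
rewrite addrC -lerBrDr -lee_fin esum_fineK//; exact: K1.
Qed.

Lemma fatou_esum {R : realType} {I : choiceType}
    (f : nat -> I -> R) (f' : I -> R) (M : R) (N : nat) :
  (forall n i, 0 <= f n i) -> (forall i, f n i @[n --> \oo] --> f' i) ->
  (forall n, (N <= n)%N -> (\esum_(i in [set: I]) (f n i)%:E <= M%:E)%E) ->
  (\esum_(i in [set: I]) (f' i)%:E <= M%:E)%E.
Proof.
move=> f0 ff H; pose z (i : I) : R := 0.
have z0 : (\esum_(i in [set: I]) (z i)%:E = 0)%E by rewrite esum1.
have := @fatou_esum2 R I I f f' (fun=> z) z M N f0.
rewrite z0 adde0; apply => //; first by move=> i; exact: cvg_cst.
by move=> n Nn; rewrite adde0 H.
Qed.

(** * The space l2 and the energy form *)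

Section semi_inner.
Context {R : realType} {V : lmodType R} (P : V -> Prop) (B : V -> V -> R).
Hypothesis PL : forall a u v, P u -> P v -> P (a *: u + v).
Hypothesis Bsym : forall u v, B u v = B v u.
Hypothesis BL : forall a u v w, P u -> P v -> P w ->
  B (a *: u + v) w = a * B u w + B v w.
Hypothesis B0 : forall u, P u -> 0 <= B u u.

Lemma semi_expand a u v : P u -> P v ->
  B (a *: u + v) (a *: u + v) = a ^+ 2 * B u u + a *+ 2 * B u v + B v v.
Proof.
move=> Pu Pv; have Pw := PL a Pu Pv.
rewrite BL// (Bsym u) (Bsym v) !BL// (Bsym v u); ring.
Qed.

(** The quadratic in [a] of [semi_expand] is non-negative, so its discriminant is not positive. The
    predicate [P] delimits where [B] is bilinear, since forms built on [rsum] are not bilinear on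
    all functions. *)
Lemma semi_CS u v : P u -> P v -> B u v ^+ 2 <= B u u * B v v.
Proof.
move=> Pu Pv.
have H a : 0 <= a ^+ 2 * B u u + a *+ 2 * B u v + B v v.
  by rewrite -semi_expand// B0//; exact: PL.
have A0 := B0 Pu; have C0 := B0 Pv.
set A := B u u in H A0 *; set b := B u v in H *; set C := B v v in H C0 *.
have [A1|A1] := eqVneq A 0.
  have [->|b0] := eqVneq b 0; first by rewrite expr0n/= mulr_ge0.
  (* With [A] = 0 the expression is affine in [a], and this value of [a] makes it equal to -1. *)
  have := H (- (C + 1) / (b *+ 2)).
  have -> : (- (C + 1) / (b *+ 2)) *+ 2 * b = - (C + 1) by field.
  by rewrite A1 mulr0; lra.
have Ap : 0 < A by rewrite lt_def A1.
(* The minimiser of the quadratic. *)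
have := H (- b / A).
have -> : (- b / A) ^+ 2 * A + (- b / A) *+ 2 * b + C = C - b ^+ 2 / A by field.
by rewrite subr_ge0 ler_pdivrMr// mulrC.
Qed.

Lemma semi_CS_sqrt u v : P u -> P v ->
  `|B u v| <= Num.sqrt (B u u) * Num.sqrt (B v v).
Proof.
move=> Pu Pv; rewrite -sqrtrM ?B0// -sqrtr_sqr.
by rewrite ler_wsqrtr// semi_CS.
Qed.

Lemma semi_triangle u v : P u -> P v ->
  Num.sqrt (B (u + v) (u + v)) <= Num.sqrt (B u u) + Num.sqrt (B v v).
Proof.
move=> Pu Pv; have := semi_expand 1 Pu Pv; rewrite scale1r => ->.
rewrite -(@ler_pXn2r _ 2) ?nnegrE ?addr_ge0 ?sqrtr_ge0//.
have := le_trans (ler_norm _) (semi_CS_sqrt Pu Pv).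
have H := semi_expand 1 Pu Pv; rewrite scale1r in H.
have := B0 (PL 1 Pu Pv); rewrite scale1r H => H0.
rewrite sqr_sqrtr// sqrrD !sqr_sqrtr ?B0//; nra.
Qed.

Lemma semi_sqrtZ a u : P u -> P 0 ->
  Num.sqrt (B (a *: u) (a *: u)) = `|a| * Num.sqrt (B u u).
Proof.
move=> Pu P00; have := semi_expand a Pu P00; rewrite addr0 => ->.
have B00 w : P w -> B w 0 = 0.
  move=> Pw; have := BL (-1) P00 P00 Pw; rewrite scaler0 addr0 Bsym; lra.
rewrite (B00 u)// (B00 0)// mulr0 !addr0 sqrtrM ?sqr_ge0//.
by rewrite sqrtr_sqr.
Qed.

Lemma semi_parallelogram u v : P u -> P v ->
  B (u - v) (u - v) + B (u + v) (u + v) = B u u *+ 2 + B v v *+ 2.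
Proof.
move=> Pu Pv.
have := semi_expand (-1) Pv Pu; have := semi_expand 1 Pv Pu.
have -> : 1 *: v + u = u + v by rewrite scale1r addrC.
have -> : -1 *: v + u = u - v by rewrite scaleN1r addrC.
by move=> -> ->; ring.
Qed.

End semi_inner.

(** * Weighted square-summable families *)

Section weighted.
Context {R : realType} {I : choiceType} (W : I -> R).
Hypothesis W0 : forall i, 0 <= W i.
Implicit Types u v : I -> R.

Definition wfin u : Prop :=
  (\esum_(i in [set: I]) (W i * u i ^+ 2)%:E < +oo)%E.

Definition wdot u v : R := rsum (fun i => W i * u i * v i).

Lemma wfin_summ u v : wfin u -> wfin v -> summ (fun i => W i * u i * v i).
Proof.
move=> fu fv.
apply: (@summ_le _ _ _ (fun i => W i * u i ^+ 2 + W i * v i ^+ 2)).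
  move=> i; rewrite -mulrA normrM (ger0_norm (W0 i)) -mulrDr ler_wpM2l//.
  have := sqr_ge0 (u i - v i); have := sqr_ge0 (u i + v i).
  by rewrite ler_norml => *; apply/andP; split; nra.
under eq_esum do rewrite EFinD.
rewrite esumD ?lte_add_pinfty// => i _;
  by rewrite lee_fin mulr_ge0// sqr_ge0.
Qed.

Lemma wfinL (a : R) u v : wfin u -> wfin v -> wfin (a *: u + v).
Proof.
move=> fu fv; apply: (@le_lt_trans _ _
  (\esum_(i in [set: I]) ((2 * a ^+ 2)%:E * (W i * u i ^+ 2)%:E
      + 2%:E * (W i * v i ^+ 2)%:E))%E).
  apply: le_esum => i _; rewrite -!EFinM -EFinD lee_fin.
  have -> : (a *: u + v) i = a * u i + v i by [].
  have -> : 2 * a ^+ 2 * (W i * u i ^+ 2) + 2 * (W i * v i ^+ 2) =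
    W i * (2 * (a * u i) ^+ 2 + 2 * v i ^+ 2) by ring.
  rewrite ler_wpM2l//; have := sqr_ge0 (a * u i - v i); nra.
have pu i : (0 <= (W i * u i ^+ 2)%:E)%E by rewrite lee_fin mulr_ge0// sqr_ge0.
have pv i : (0 <= (W i * v i ^+ 2)%:E)%E by rewrite lee_fin mulr_ge0// sqr_ge0.
have a0 : 0 <= 2 * a ^+ 2 by rewrite mulr_ge0// sqr_ge0.
rewrite esumD; first last.
- by move=> i _; rewrite mule_ge0// lee_fin.
- by move=> i _; rewrite mule_ge0// lee_fin.
by rewrite !esumZ// lte_add_pinfty// lte_mul_pinfty// ?lee_fin.
Qed.

Lemma wfin0 : wfin 0.
Proof. by rewrite /wfin esum1// => i _; rewrite expr0n/= mulr0. Qed.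

Lemma wdot_sym u v : wdot u v = wdot v u.
Proof. by apply: eq_rsum => i; rewrite mulrAC. Qed.

Lemma wdotL (a : R) u v w : wfin u -> wfin v -> wfin w ->
  wdot (a *: u + v) w = a * wdot u w + wdot v w.
Proof.
move=> fu fv fw; rewrite /wdot -rsumZ; last exact: wfin_summ.
rewrite -rsumD; [|exact/summZ/wfin_summ|exact: wfin_summ].
by apply: eq_rsum => i; rewrite -[(a *: u + v) i]/(a * u i + v i); ring.
Qed.

Lemma wdot_ge0 u : 0 <= wdot u u.
Proof. by apply: ge0_rsum => i; rewrite -mulrA mulr_ge0// -expr2 sqr_ge0. Qed.

Lemma wdotE u : wdot u u = fine (\esum_(i in [set: I]) (W i * u i ^+ 2)%:E).
Proof.
rewrite -rsum_ge0E; first by apply: eq_rsum => i; rewrite -mulrA expr2.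
by move=> i; rewrite mulr_ge0// sqr_ge0.
Qed.

Lemma wdot_EFin u : wfin u ->
  ((wdot u u)%:E = \esum_(i in [set: I]) (W i * u i ^+ 2)%:E)%E.
Proof.
by move=> fu; rewrite wdotE esum_fineK// => i; rewrite mulr_ge0// sqr_ge0.
Qed.

Lemma wfin_le u v : (forall i, `|u i| <= `|v i|) -> wfin v -> wfin u.
Proof.
move=> uv; apply: le_lt_trans; apply: le_esum => i _; rewrite lee_fin.
rewrite ler_wpM2l// -real_normK ?num_real// -[leRHS]real_normK ?num_real//.
by rewrite lerXn2r ?nnegrE.
Qed.

End weighted.

(** * The Hilbert space of square-summable functions *)

Section l2_theory.
Context {R : realType} {X : choiceType}.
Implicit Types f g : X -> R.
Local Notation one := (fun _ : X => 1 : R).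

Lemma l2_wfin f : l2 f <-> wfin one f.
Proof. by rewrite /l2 /wfin; under [in X in _ <-> X]eq_esum do rewrite mul1r. Qed.

Lemma l2dotE f g : l2dot f g = wdot one f g.
Proof. by apply: eq_rsum => x; rewrite mul1r. Qed.

Lemma one_ge0 (x : X) : 0 <= one x. Proof. by []. Qed.

Lemma l2L (a : R) f g : l2 f -> l2 g -> l2 (a *: f + g).
Proof. by rewrite !l2_wfin; exact/wfinL/one_ge0. Qed.

Lemma l20 : l2 (0 : X -> R).
Proof. exact/l2_wfin/wfin0. Qed.

Lemma l2D f g : l2 f -> l2 g -> l2 (f + g).
Proof. by move=> ? ?; rewrite -[f]scale1r; exact: l2L. Qed.

Lemma l2Z (a : R) f : l2 f -> l2 (a *: f).
Proof. by move=> ?; rewrite -[_ *: _]addr0; apply: l2L => //; exact: l20. Qed.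

Lemma l2B f g : l2 f -> l2 g -> l2 (f - g).
Proof. by move=> ? ?; rewrite -scaleN1r addrC; exact: l2L. Qed.

Lemma l2dotC f g : l2dot f g = l2dot g f.
Proof. by rewrite !l2dotE wdot_sym. Qed.

Lemma l2dotL (a : R) f g h : l2 f -> l2 g -> l2 h ->
  l2dot (a *: f + g) h = a * l2dot f h + l2dot g h.
Proof. by rewrite !l2_wfin !l2dotE => *; exact: (wdotL one_ge0). Qed.

Lemma l2dot_ge0 f : 0 <= l2dot f f.
Proof. rewrite l2dotE; exact: (wdot_ge0 one_ge0). Qed.

Lemma l2dotZ (a : R) f h : l2 f -> l2 h -> l2dot (a *: f) h = a * l2dot f h.
Proof.
move=> lf lh; have := l2dotL a lf l20 lh; rewrite addr0 => ->.
suff -> : l2dot (0 : X -> R) h = 0 by rewrite addr0.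
by rewrite -(@rsum0 R X); apply: eq_rsum => i; rewrite mul0r.
Qed.

Lemma l2dotB f g h : l2 f -> l2 g -> l2 h -> l2dot (f - g) h = l2dot f h - l2dot g h.
Proof.
by move=> *; rewrite -scaleN1r addrC l2dotL// mulN1r addrC.
Qed.

Lemma l2normE f : l2norm f = Num.sqrt (l2dot f f).
Proof.
rewrite /l2norm l2dotE (wdotE one_ge0); congr (Num.sqrt (fine _)).
by apply: eq_esum => x _; rewrite mul1r.
Qed.

Lemma l2norm_ge0 f : 0 <= l2norm f.
Proof. by rewrite l2normE sqrtr_ge0. Qed.

Lemma l2norm_sqr f : l2norm f ^+ 2 = l2dot f f.
Proof. by rewrite l2normE sqr_sqrtr// l2dot_ge0. Qed.

Lemma l2_CS f g : l2 f -> l2 g -> `|l2dot f g| <= l2norm f * l2norm g.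
Proof.
move=> lf lg; rewrite !l2normE.
by apply: (semi_CS_sqrt l2L l2dotC l2dotL) => // u _; exact: l2dot_ge0.
Qed.

Lemma l2_triangle f g : l2 f -> l2 g -> l2norm (f + g) <= l2norm f + l2norm g.
Proof.
move=> lf lg; rewrite !l2normE.
by apply: (semi_triangle l2L l2dotC l2dotL) => // u _; exact: l2dot_ge0.
Qed.

Lemma l2normZ (a : R) f : l2 f -> l2norm (a *: f) = `|a| * l2norm f.
Proof.
move=> lf; rewrite !l2normE.
by apply: (semi_sqrtZ l2L l2dotC l2dotL) => //; exact: l20.
Qed.

Lemma l2_pt f x : l2 f -> `|f x| <= l2norm f.
Proof.
move=> lf; rewrite -(@ler_pXn2r _ 2) ?nnegrE ?l2norm_ge0// l2norm_sqr l2dotE.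
rewrite -lee_fin (wdot_EFin one_ge0); last exact: ((l2_wfin f).1 lf).
rewrite real_normK ?num_real//.
have := @esum_ge1 R X (fun x => (1 * f x ^+ 2)%:E) x; rewrite mul1r; apply => i.
by rewrite mul1r lee_fin sqr_ge0.
Qed.

Lemma l2norm0_eq0 f : l2 f -> l2norm f = 0 -> f = 0.
Proof.
move=> lf f0; apply/funext => x; apply/eqP; rewrite -normr_le0 -f0.
exact: l2_pt.
Qed.

Lemma l2_le f g : (forall x, `|f x| <= `|g x|) -> l2 g -> l2 f.
Proof. by move=> fg; rewrite !l2_wfin; exact: (wfin_le one_ge0 fg). Qed.

Lemma l2norm_le_esum f (M : R) : 0 <= M ->
  (\esum_(x in [set: X]) (f x ^+ 2)%:E <= (M ^+ 2)%:E)%E -> l2 f /\ l2norm f <= M.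
Proof.
move=> M0 H.
have lf : l2 f by apply: le_lt_trans H _; rewrite ltry.
split => //; rewrite -(@ler_pXn2r _ 2) ?nnegrE ?l2norm_ge0// l2norm_sqr.
rewrite l2dotE -lee_fin (wdot_EFin one_ge0); last exact: ((l2_wfin f).1 lf).
by under eq_esum do rewrite mul1r.
Qed.

Lemma l2norm_EFin f : l2 f ->
  ((l2norm f ^+ 2)%:E = \esum_(x in [set: X]) (f x ^+ 2)%:E)%E.
Proof.
move=> lf; rewrite l2norm_sqr l2dotE (wdot_EFin one_ge0); last exact: ((l2_wfin f).1 lf).
by under eq_esum do rewrite mul1r.
Qed.

(** By Fatou for the squares, closed balls of l2 are closed under mere pointwise convergence. *)
Lemma l2_fatou (u : nat -> X -> R) v (M : R) N : 0 <= M ->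
  (forall x, u n x @[n --> \oo] --> v x) ->
  (forall n, (N <= n)%N -> l2 (u n) /\ l2norm (u n) <= M) ->
  l2 v /\ l2norm v <= M.
Proof.
move=> M0 uv H; apply: l2norm_le_esum => //.
apply: (@fatou_esum _ _ (fun n x => u n x ^+ 2) _ _ N).
- by move=> *; exact: sqr_ge0.
- by move=> x; rewrite expr2; under eq_fun do rewrite expr2; exact: cvgM.
- move=> n /H[ln un]; rewrite -l2norm_EFin// lee_fin.
  by rewrite lerXn2r ?nnegrE ?l2norm_ge0.
Qed.

Lemma real_cauchy_cvg (u : nat -> R) :
  (forall e, 0 < e -> exists N, forall m n, (N <= m)%N -> (N <= n)%N ->
     `|u m - u n| <= e) -> exists l : R, u n @[n --> \oo] --> l.
Proof.
move=> H; apply/cvg_ex; apply: R_complete; apply: cauchy_exP => e e0.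
have [N HN] := H (e / 2) (divr_gt0 e0 (ltr0n _ 2)).
exists (u N); exists N => // n /= Nn.
rewrite /ball/=; apply: le_lt_trans (HN _ _ (leqnn N) Nn) _.
by rewrite ltr_pdivrMr// ltr_pMr// ltr1n.
Qed.

(** Point evaluations are dominated by the norm, so a Cauchy sequence has a pointwise limit;
    [l2_fatou] applied to u n - u m, with m tending to infinity, makes it a norm limit. *)
Lemma l2_complete (u : nat -> X -> R) : (forall n, l2 (u n)) ->
  (forall e, 0 < e -> exists N, forall m n, (N <= m)%N -> (N <= n)%N ->
     l2norm (u m - u n) <= e) ->
  exists v, [/\ l2 v, (forall x, u n x @[n --> \oo] --> v x) &
    forall e, 0 < e -> exists N, forall n, (N <= n)%N -> l2norm (u n - v) <= e].
Proof.
move=> lu H.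
have Hx x : exists l : R, u n x @[n --> \oo] --> l.
  apply: real_cauchy_cvg => e /H[N HN]; exists N => m n Nm Nn.
  by apply: le_trans (HN m n Nm Nn); exact: l2_pt x (l2B (lu m) (lu n)).
pose v x := sval (cid (Hx x)).
have uv x : u n x @[n --> \oo] --> v x := svalP (cid (Hx x)).
have K e : 0 < e -> exists N, forall n, (N <= n)%N ->
    l2 (u n - v) /\ l2norm (u n - v) <= e.
  move=> e0; have [N HN] := H _ e0; exists N => n Nn.
  apply: (@l2_fatou (fun m => u n - u m) _ e N); first exact: ltW.
    by move=> x; apply: cvgB (uv x); exact: cvg_cst.
  by move=> m Nm; split; [exact: l2B|exact: HN].
exists v; split => //.
  have [N /(_ N (leqnn N))[lN _]] := K 1 ltr01.
  have -> : v = u N - (u N - v) by rewrite opprB addrCA subrr addr0.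
  exact: l2B.
by move=> e /K[N HN]; exists N => n /HN[].
Qed.

Lemma ind1_ne (y x : X) : x != y -> ind1 y x = 0 :> R.
Proof. by rewrite /ind1 => /negPf ->. Qed.

Lemma ind1_eq (y : X) : ind1 y y = 1 :> R.
Proof. by rewrite /ind1 eqxx. Qed.

Lemma ind1_ge0 (y x : X) : 0 <= ind1 y x :> R.
Proof. by rewrite /ind1. Qed.

Lemma l2_ind1 (y : X) : l2 (ind1 y : X -> R).
Proof.
have h x : x != y -> (ind1 y x : R) ^+ 2 = 0 by move=> /ind1_ne ->; rewrite expr0n.
by have [/summ_ge0 + _] := rsum_single h; apply => x; exact: sqr_ge0.
Qed.

Lemma l2dot_ind1 f (y : X) : l2dot f (ind1 y) = f y.
Proof.
have h x : x != y -> f x * ind1 y x = 0 by move=> /ind1_ne ->; rewrite mulr0.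
by rewrite /l2dot (rsum_single h).2 ind1_eq mulr1.
Qed.

Definition restr (s : seq X) f : X -> R := fun x => if x \in s then f x else 0.

Lemma restrE (s : seq X) f : uniq s ->
  restr s f = \sum_(y <- s) f y *: (ind1 y : X -> R).
Proof.
move=> us; apply/funext => x; rewrite fct_sumE /restr.
case: ifPn => xs.
  rewrite (bigD1_seq x)//= big1 ?addr0 -?[(_ *: _) x]/(_ * _) ?ind1_eq ?mulr1//.
  by move=> y yx; rewrite -[(_ *: _) x]/(_ * _) ind1_ne ?mulr0// eq_sym.
rewrite big_seq big1// => y ys; rewrite -[(_ *: _) x]/(_ * _) ind1_ne ?mulr0//.
by apply: contraNneq xs => ->.
Qed.

Lemma rsum_restr (s : seq X) f : uniq s ->
  summ (restr s f) /\ rsum (restr s f) = \sum_(y <- s) f y.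
Proof.
move=> us.
have h y x : x != y -> f y * ind1 y x = 0 by move=> /ind1_ne ->; rewrite mulr0.
have K y := rsum_single (h y).
have [K1 K2] := rsum_fin (I := X) s (fun y => (K y).1).
have -> : restr s f = (fun x => \sum_(y <- s) f y * ind1 y x).
  by rewrite restrE//; apply/funext => x; rewrite fct_sumE.
by rewrite K2; split=> //; apply: eq_bigr => y _; rewrite (K y).2 ind1_eq mulr1.
Qed.

Lemma l2_restr_dense f (e : R) : l2 f -> 0 < e ->
  exists2 s : seq X, uniq s & l2norm (f - restr s f) <= e.
Proof.
move=> lf e0.
have sf : summ (fun x => f x ^+ 2) by apply/summ_ge0 => // x; exact: sqr_ge0.
(* A finite set whose sum comes within e^2 of the full sum leaves a tail of norm at most [e]. *)
have : ((rsum (fun x => f x ^+ 2) - e ^+ 2)%:E <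
    \esum_(x in [set: X]) (f x ^+ 2)%:E)%E.
  rewrite -rsum_EFin//; last by move=> x; exact: sqr_ge0.
  by rewrite lte_fin ltrBlDr ltrDl exprn_gt0.
move=> /ereal_sup_gt[_ [A [finA _] <-]].
rewrite fsbig_finite//= sumEFin lte_fin => H.
exists (finmap.enum_fset (fset_set A)); first exact: finmap.fset_uniq.
set s := finmap.enum_fset _ in H *.
have us : uniq s by exact: finmap.fset_uniq.
rewrite -(@ler_pXn2r _ 2) ?nnegrE ?l2norm_ge0 ?(ltW e0)// l2norm_sqr.
have [S1 S2] := rsum_restr (fun x => f x ^+ 2) us.
have -> : l2dot (f - restr s f) (f - restr s f) =
    rsum (fun x => f x ^+ 2 - restr s (fun x => f x ^+ 2) x).
  apply: eq_rsum => x; rewrite -[(f - _) x]/(f x - restr s f x) /restr.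
  by case: ifP => _; ring.
by rewrite rsumB// S2; lra.
Qed.

End l2_theory.

(** * The energy as a non-negative quadratic form *)

Section energy_theory.
Context {R : realType} {X : countType}.
Variables (b : X -> X -> R) (c : X -> R).
Hypothesis hg : is_graph b c.
Implicit Types f g u v : X -> R.

Definition grad f (p : X * X) : R := f p.1 - f p.2.
Definition edgew (p : X * X) : R := b p.1 p.2.
Local Notation Q := (dirichlet_form b c).
Local Notation fe := (finite_energy b c).

Let b0 := graph_b_ge0 hg.
Let c0 := graph_c_ge0 hg.

Lemma edgew_ge0 p : 0 <= edgew p. Proof. exact: b0. Qed.

Lemma edgeE_ge0 f p : (0 <= (edgew p * grad f p ^+ 2)%:E)%E.
Proof. by rewrite lee_fin mulr_ge0// ?edgew_ge0// sqr_ge0. Qed.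

Lemma killE_ge0 f x : (0 <= (c x * f x ^+ 2)%:E)%E.
Proof. by rewrite lee_fin mulr_ge0// sqr_ge0. Qed.

Lemma feP f : fe f <-> wfin edgew (grad f) /\ wfin c f.
Proof.
rewrite /finite_energy /energy /wfin.
split.
  move=> h; split.
    rewrite ltNge leye_eq; apply/eqP => e; move: h; rewrite /grad /edgew in e.
    rewrite e gt0_muley ?lte_fin ?invr_gt0// addye ?ltxx//.
    by rewrite gt_eqF// (@lt_le_trans _ _ 0%E)// esum_neqNy// => x; exact: killE_ge0.
  apply: le_lt_trans h; rewrite leeDr// mule_ge0 ?lee_fin ?invr_ge0//.
  by rewrite esum_neqNy// => p; exact: edgeE_ge0.
by move=> [h1 h2]; rewrite lte_add_pinfty// lte_mul_pinfty ?lee_fin ?invr_ge0.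
Qed.

Lemma QE f g : Q f g = 2^-1 * wdot edgew (grad f) (grad g) + wdot c f g.
Proof. by []. Qed.

Lemma gradL (a : R) f g : grad (a *: f + g) = a *: grad f + grad g.
Proof.
apply/funext => p.
rewrite -[RHS]/(a * grad f p + grad g p) /grad.
rewrite -[(a *: f + g) p.1]/(a * f p.1 + g p.1) -[(a *: f + g) p.2]/(a * f p.2 + g p.2).
ring.
Qed.

Lemma feL (a : R) f g : fe f -> fe g -> fe (a *: f + g).
Proof.
move=> /feP[f1 f2] /feP[g1 g2]; apply/feP; rewrite gradL.
by split; apply: wfinL => //; exact: edgew_ge0.
Qed.

Lemma fe0 : fe 0.
Proof.
apply/feP; split; last exact: wfin0.
by rewrite /wfin esum1// => p _; rewrite /grad subrr expr0n/= mulr0.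
Qed.

Lemma feZ (a : R) f : fe f -> fe (a *: f).
Proof. by move=> ?; rewrite -[_ *: _]addr0; apply: feL => //; exact: fe0. Qed.

Lemma feD f g : fe f -> fe g -> fe (f + g).
Proof. by move=> ? ?; rewrite -[f]scale1r; exact: feL. Qed.

Lemma feB f g : fe f -> fe g -> fe (f - g).
Proof. by move=> ? ?; rewrite -scaleN1r addrC; exact: feL. Qed.

Lemma Qsym f g : Q f g = Q g f.
Proof. by rewrite !QE !(wdot_sym _ f) (wdot_sym _ (grad f)). Qed.

Lemma QL (a : R) f g h : fe f -> fe g -> fe h ->
  Q (a *: f + g) h = a * Q f h + Q g h.
Proof.
move=> /feP[f1 f2] /feP[g1 g2] /feP[h1 h2]; rewrite !QE gradL.
by rewrite (wdotL edgew_ge0)// (wdotL c0)//; ring.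
Qed.

Lemma Q_ge0 f : 0 <= Q f f.
Proof. by rewrite QE addr_ge0 ?mulr_ge0 ?invr_ge0 ?(wdot_ge0 edgew_ge0) ?(wdot_ge0 c0). Qed.

Lemma Q0l h : fe h -> Q 0 h = 0.
Proof.
by move=> hh; have := QL (-1) fe0 fe0 hh; rewrite scaler0 addr0; lra.
Qed.

Lemma QZl (a : R) f h : fe f -> fe h -> Q (a *: f) h = a * Q f h.
Proof.
by move=> hf hh; have := QL a hf fe0 hh; rewrite addr0 => ->; rewrite Q0l// addr0.
Qed.

Lemma QBl f g h : fe f -> fe g -> fe h -> Q (f - g) h = Q f h - Q g h.
Proof. by move=> *; rewrite -scaleN1r addrC QL// mulN1r addrC. Qed.

Lemma energyE f : fe f -> energy b c f = (Q f f)%:E.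
Proof.
move=> /feP[f1 f2]; rewrite /energy QE EFinD EFinM.
by rewrite (wdot_EFin edgew_ge0)// (wdot_EFin c0).
Qed.

Lemma fe_le f (M : R) : (energy b c f <= M%:E)%E -> fe f /\ Q f f <= M.
Proof.
move=> h; have hf : fe f by apply: le_lt_trans h _; rewrite ltry.
by split => //; rewrite -lee_fin -energyE.
Qed.

Lemma Q_CS2 f g : fe f -> fe g -> Q f g ^+ 2 <= Q f f * Q g g.
Proof.
move=> lf lg.
by apply: (semi_CS feL Qsym QL) => // u _; exact: Q_ge0.
Qed.

Lemma Q_parallelogram f g : fe f -> fe g ->
  Q (f - g) (f - g) + Q (f + g) (f + g) = Q f f *+ 2 + Q g g *+ 2.
Proof.
move=> lf lg.
exact: (semi_parallelogram feL Qsym QL).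
Qed.

Lemma QZ2 (a : R) f : fe f -> Q (a *: f) (a *: f) = a ^+ 2 * Q f f.
Proof.
move=> hf; rewrite QZl//; last exact: feZ.
by rewrite Qsym QZl//; ring.
Qed.

Lemma Q_fatou (u : nat -> X -> R) v (M : R) N :
  (forall x, u n x @[n --> \oo] --> v x) ->
  (forall n, (N <= n)%N -> fe (u n) /\ Q (u n) (u n) <= M) ->
  fe v /\ Q v v <= M.
Proof.
move=> uv H; apply: fe_le; rewrite /energy.
have E f : ((2^-1)%:E *
   (\esum_(p in [set: X * X]) (b p.1 p.2 * (f p.1 - f p.2) ^+ 2)%:E) =
   \esum_(p in [set: X * X]) (2^-1 * (edgew p * grad f p ^+ 2))%:E)%E.
  by rewrite -esumZ// => p _; exact: edgeE_ge0.
rewrite E.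
apply: (@fatou_esum2 _ _ _ (fun n p => 2^-1 * (edgew p * grad (u n) p ^+ 2)) _
   (fun n x => c x * u n x ^+ 2) _ _ N).
- by move=> n p; rewrite mulr_ge0 ?invr_ge0// -lee_fin edgeE_ge0.
- by move=> n x; rewrite -lee_fin killE_ge0.
- move=> p; apply: cvgMr; apply: cvgMr.
  rewrite expr2; under eq_fun do rewrite expr2.
  by apply: cvgM; apply: cvgB.
- move=> x; apply: cvgMr.
  by rewrite expr2; under eq_fun do rewrite expr2; apply: cvgM.
- by move=> n /H[fn Qn]; rewrite -E -[leLHS]/(energy b c (u n)) energyE// lee_fin.
Qed.

(** The energy halves a sum over ordered pairs and only one ordered pair is kept, whence the factor
    2. *)
Lemma edge_bound f x y : fe f -> b x y * (f x - f y) ^+ 2 <= Q f f *+ 2.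
Proof.
move=> hf; have [h1 h2] := (feP f).1 hf.
have := @esum_ge1 R _ (fun p => (edgew p * grad f p ^+ 2)%:E) (x, y).
rewrite -(wdot_EFin edgew_ge0)// lee_fin => /(_ (edgeE_ge0 f)).
rewrite /edgew /grad/= QE; have := wdot_ge0 c0 f; lra.
Qed.

Lemma kill_bound f x : fe f -> c x * f x ^+ 2 <= Q f f.
Proof.
move=> hf; have [h1 h2] := (feP f).1 hf.
have := @esum_ge1 R _ (fun x => (c x * f x ^+ 2)%:E) x.
rewrite -(wdot_EFin c0)// lee_fin => /(_ (killE_ge0 f)).
rewrite QE; have := wdot_ge0 edgew_ge0 (grad f); lra.
Qed.

(** From |p| <= |q| + |r| follows p^2 <= 2 q^2 + 2 r^2, edge by edge and vertex by vertex. It serves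
    to bound the energy of one function truncated by another. *)
Lemma fe_contraction f g u : fe f -> fe g ->
  (forall x y, `|u x - u y| <= `|f x - f y| + `|g x - g y|) ->
  (forall x, `|u x| <= `|f x| + `|g x|) ->
  fe u /\ Q u u <= Q f f *+ 2 + Q g g *+ 2.
Proof.
move=> hf hgg H1 H2.
have [f1 f2] := (feP f).1 hf; have [g1 g2] := (feP g).1 hgg.
have S (p q r : R) : `|p| <= `|q| + `|r| -> p ^+ 2 <= 2 * q ^+ 2 + 2 * r ^+ 2.
  move=> h; rewrite -(real_normK (num_real p)) -(real_normK (num_real q)).
  rewrite -(real_normK (num_real r)); have := normr_ge0 p.
  by have := sqr_ge0 (`|q| - `|r|); nra.
have A : (\esum_(p in [set: X * X]) (edgew p * grad u p ^+ 2)%:E <=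
    (2 * wdot edgew (grad f) (grad f) + 2 * wdot edgew (grad g) (grad g))%:E)%E.
  rewrite EFinD !EFinM !(wdot_EFin edgew_ge0)// -!esumZ// => [|p _|p _];
    try exact: edgeE_ge0.
  rewrite -esumD; [|by move=> p _; apply: mule_ge0; [rewrite lee_fin|exact: edgeE_ge0] ..].
  apply: le_esum => p _; rewrite -!EFinM -EFinD lee_fin.
  have -> : 2 * (edgew p * grad f p ^+ 2) + 2 * (edgew p * grad g p ^+ 2) =
    edgew p * (2 * grad f p ^+ 2 + 2 * grad g p ^+ 2) by ring.
  rewrite ler_wpM2l ?edgew_ge0//.
  by apply: S; exact: H1.
have B : (\esum_(x in [set: X]) (c x * u x ^+ 2)%:E <=
    (2 * wdot c f f + 2 * wdot c g g)%:E)%E.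
  rewrite EFinD !EFinM !(wdot_EFin c0)// -!esumZ// => [|p _|p _];
    try exact: killE_ge0.
  rewrite -esumD; [|by move=> p _; apply: mule_ge0; [rewrite lee_fin|exact: killE_ge0] ..].
  apply: le_esum => p _; rewrite -!EFinM -EFinD lee_fin.
  have -> : 2 * (c p * f p ^+ 2) + 2 * (c p * g p ^+ 2) =
    c p * (2 * f p ^+ 2 + 2 * g p ^+ 2) by ring.
  by rewrite ler_wpM2l//; apply: S; exact: H2.
apply: fe_le; rewrite /energy.
apply: (le_trans (leeD (lee_wpmul2l _ A) B)); first by rewrite lee_fin invr_ge0.
rewrite -EFinM -EFinD lee_fin !QE; lra.
Qed.

End energy_theory.

(** * Tonelli for unordered sums *)

Section esum_prod.
Context {R : realType} {X Y : choiceType}.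
Implicit Types F : X * Y -> \bar R.

Lemma esum_prod F : (forall p, 0 <= F p)%E ->
  (\esum_(p in [set: X * Y]) F p
   = \esum_(x in [set: X]) \esum_(y in [set: Y]) F (x, y))%E.
Proof.
move=> F0; rewrite (@esum_esum _ _ _ setT (fun=> setT) (fun x y => F (x, y)))//.
rewrite (_ : setT `*`` _ = setT); last by apply/seteqP; split.
by apply: eq_esum => -[].
Qed.

Lemma esum_prodC F : (forall p, 0 <= F p)%E ->
  (\esum_(p in [set: X * Y]) F p
   = \esum_(y in [set: Y]) \esum_(x in [set: X]) F (x, y))%E.
Proof.
move=> F0; rewrite (@esum_esum _ _ _ setT (fun=> setT) (fun y x => F (x, y)))//.
rewrite (_ : setT `*`` _ = setT); last by apply/seteqP; split.
rewrite (reindex_esum [set: X * Y] [set: Y * X] (fun p => (p.2, p.1))).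
  by apply: eq_esum => -[].
split => //; first by move=> [a a'] [d d'] _ _ [-> ->].
by move=> [y x] _; exists (x, y).
Qed.

Lemma esum_interchange F : (forall p, 0 <= F p)%E ->
  (\esum_(x in [set: X]) \esum_(y in [set: Y]) F (x, y)
   = \esum_(y in [set: Y]) \esum_(x in [set: X]) F (x, y))%E.
Proof. by move=> F0; rewrite -esum_prod// esum_prodC. Qed.

Lemma esum_single (g : X -> \bar R) z : (forall x, x != z -> g x = 0)%E ->
  (0 <= g z)%E -> (\esum_(x in [set: X]) g x = g z)%E.
Proof.
move=> g0 gz; rewrite -(@esum_set1 _ _ z g)// [RHS]esum_mkcond.
apply: eq_esum => i _.
by case: ifPn => //; rewrite notin_setE /= => /eqP/g0 ->.
Qed.

End esum_prod.

Section slices.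
Context {R : realType} {X : choiceType}.

Lemma esum_slice1 (z : X) (g : X -> \bar R) : (forall x, 0 <= g x)%E ->
  (\esum_(p in [set: X * X]) (if p.1 == z then g p.2 else 0)
   = \esum_(y in [set: X]) g y)%E.
Proof.
move=> g0; rewrite esum_prod => [|p]; last by case: ifP.
rewrite (@esum_single _ _ _ z)/= ?eqxx ?esum_neqNy//.
by move=> x /negPf xz; rewrite esum1// => y _; rewrite xz.
Qed.

Lemma esum_slice2 (z : X) (g : X -> \bar R) : (forall x, 0 <= g x)%E ->
  (\esum_(p in [set: X * X]) (if p.2 == z then g p.1 else 0)
   = \esum_(y in [set: X]) g y)%E.
Proof.
move=> g0; rewrite esum_prodC => [|p]; last by case: ifP.
rewrite (@esum_single _ _ _ z)/= ?eqxx ?esum_neqNy//.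
by move=> x /negPf xz; rewrite esum1// => y _; rewrite xz.
Qed.

(** These are the edges at [z] in their two orientations, as families on ordered pairs; testing the
    energy against a point mass produces exactly these two. *)
Lemma rsum_slices (z : X) (h : X -> R) : summ h ->
  [/\ summ (fun p : X * X => if p.1 == z then h p.2 else 0),
      summ (fun p : X * X => if p.2 == z then h p.1 else 0),
      rsum (fun p : X * X => if p.1 == z then h p.2 else 0) = rsum h &
      rsum (fun p : X * X => if p.2 == z then h p.1 else 0) = rsum h].
Proof.
have m0 (k : X -> R) x : (0 <= (Num.max (k x) 0)%:E)%E.
  by rewrite lee_fin le_max lexx orbT.
move=> sh; split.
- rewrite /summ -(@esum_slice1 z (fun x => `|h x|%:E)) in sh *.
    by apply: le_lt_trans sh; apply: le_esum => p _; case: ifP; rewrite ?normr0.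
  by move=> x; rewrite lee_fin.
- rewrite /summ -(@esum_slice2 z (fun x => `|h x|%:E)) in sh *.
    by apply: le_lt_trans sh; apply: le_esum => p _; case: ifP; rewrite ?normr0.
  by move=> x; rewrite lee_fin.
- rewrite /rsum -(@esum_slice1 z _ (m0 h)) -(@esum_slice1 z _ (m0 (fun x => - h x))).
  by congr (fine _ - fine _); apply: eq_esum => p _; case: ifP;
    rewrite ?oppr0 ?maxxx.
- rewrite /rsum -(@esum_slice2 z _ (m0 h)) -(@esum_slice2 z _ (m0 (fun x => - h x))).
  by congr (fine _ - fine _); apply: eq_esum => p _; case: ifP;
    rewrite ?oppr0 ?maxxx.
Qed.

End slices.

(** * Green's formula and pointwise control by the energy *)

Section green_formula.
Context {R : realType} {X : countType}.
Variables (b : X -> X -> R) (c : X -> R).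
Hypothesis hg : is_graph b c.
Implicit Types f g u v phi : X -> R.
Local Notation Q := (dirichlet_form b c).
Local Notation fe := (finite_energy b c).
Local Notation fs := (@finitely_supported R X).

Let b0 := graph_b_ge0 hg.
Let bs := graph_b_sum hg.

Lemma fe_slice f x : fe f ->
  (\esum_(y in [set: X]) (b x y * (f x - f y) ^+ 2)%:E < +oo)%E.
Proof.
move=> /(feP hg)[h _]; apply: le_lt_trans h.
rewrite [leRHS]esum_prod; last by move=> p; exact: (edgeE_ge0 hg f p).
apply: (@esum_ge1 _ _ (fun x => \esum_(y in [set: X]) _)%E x) => z.
by apply: esum_neqNy => y; exact: (edgeE_ge0 hg f (z, y)).
Qed.

Lemma summ_bconst x (a : R) : summ (fun y => b x y * a).
Proof.
have : summ (b x) by apply/summ_ge0.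
move=> /(summZ a); rewrite /summ.
by under eq_esum do rewrite mulrC.
Qed.

(** By |r| <= 1 + r^2 it is enough that the total weight at [x] and the energy are finite. *)
Lemma summ_bgrad f x : fe f -> summ (fun y => b x y * (f x - f y)).
Proof.
move=> hf; apply: (@summ_le _ _ _ (fun y => b x y + b x y * (f x - f y) ^+ 2)).
  move=> y; rewrite normrM (ger0_norm (b0 x y)).
  rewrite -[X in _ <= X + _]mulr1 -mulrDr ler_wpM2l//.
  rewrite -[X in _ <= _ + X]real_normK ?num_real//.
  by have := sqr_ge0 (`|f x - f y| - 1); have := normr_ge0 (f x - f y); nra.
under eq_esum do rewrite EFinD.
rewrite esumD ?lte_add_pinfty ?fe_slice// => y _; rewrite lee_fin//.
by rewrite mulr_ge0// sqr_ge0.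
Qed.

Lemma inFP f : inF b f <-> forall x, summ (fun y => b x y * f y).
Proof.
split=> h x; move: (h x); rewrite /summ.
  by under eq_esum do [rewrite -(ger0_norm (b0 _ _)) -normrM].
by under [X in _ -> (X < _)%E]eq_esum do [rewrite -(ger0_norm (b0 _ _)) -normrM].
Qed.

Lemma fe_inF f : fe f -> inF b f.
Proof.
move=> hf; apply/inFP => x.
have -> : (fun y => b x y * f y) =
    (fun y => b x y * f x + - (b x y * (f x - f y))).
  by apply/funext => y; ring.
by apply: summD; [exact: summ_bconst|exact/summN/summ_bgrad].
Qed.

Lemma inF_summ f x : inF b f -> summ (fun y => b x y * (f x - f y)).
Proof.
move=> /inFP/(_ x) h.
have -> : (fun y => b x y * (f x - f y)) =
    (fun y => b x y * f x + - (b x y * f y)).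
  by apply/funext => y; ring.
by apply: summD; [exact: summ_bconst|exact/summN].
Qed.

Lemma fe_ind1 z : fe (ind1 z).
Proof.
apply/(feP hg); split; last first.
  have h x : x != z -> c x * (ind1 z x : R) ^+ 2 = 0.
    by move=> /ind1_ne ->; rewrite expr0n/= mulr0.
  have [/summ_ge0 + _] := rsum_single h; apply => x.
  by rewrite mulr_ge0 ?(graph_c_ge0 hg)// sqr_ge0.
rewrite /wfin; apply: (@le_lt_trans _ _ (\esum_(p in [set: X * X])
   ((if p.1 == z then (b z p.2)%:E else 0) + (if p.2 == z then (b z p.1)%:E else 0)))%E).
  apply: le_esum => -[x y] _; rewrite /edgew /grad /ind1/=.
  have [->|_] := eqVneq x z; have [->|_] := eqVneq y z;
    rewrite /= -?EFinD ?lee_fin.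
  + by rewrite subrr expr0n/= mulr0 addr_ge0.
  + by rewrite subr0 expr1n mulr1 addr0.
  + by rewrite sub0r sqrrN expr1n mulr1 add0r (graph_b_sym hg).
  + by rewrite subrr expr0n/= mulr0 addr0.
have p0 (w : X) : (0 <= (b z w)%:E)%E by rewrite lee_fin.
rewrite esumD => [|p _|p _]; try by case: ifP.
by rewrite (@esum_slice1 R X z _ p0) (@esum_slice2 R X z _ p0) lte_add_pinfty.
Qed.

(** Only edges touching [z] contribute, each in both orientations, which cancels the factor 1/2 of
    the energy. *)
Lemma Q_ind1 f z : fe f -> Q f (ind1 z) = Lap b c f z.
Proof.
move=> hf; rewrite QE /Lap; congr (_ + _); last first.
  have h x : x != z -> c x * f x * (ind1 z x : R) = 0.
    by move=> /ind1_ne ->; rewrite mulr0.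
  by rewrite /wdot (rsum_single h).2 ind1_eq mulr1.
pose h y := b z y * (f z - f y).
have [s1 s2 r1 r2] := rsum_slices z (summ_bgrad z hf).
rewrite /wdot (@eq_rsum _ _ _ (fun p => (if p.1 == z then h p.2 else 0) +
   (if p.2 == z then h p.1 else 0))).
  by rewrite rsumD// r1 r2; lra.
move=> [x y]; rewrite /edgew /grad /ind1/= /h.
have [->|_] := eqVneq x z; have [->|_] := eqVneq y z => /=.
- by rewrite !subrr !mulr0 addr0.
- by rewrite subr0 mulr1 addr0.
- by rewrite (graph_b_sym hg z); ring.
- by rewrite subrr mulr0 addr0.
Qed.

Lemma fsP phi : fs phi -> exists2 s : seq X, uniq s & phi = restr s phi.
Proof.
move=> /finite_seqP[s sE]; exists (undup s); first exact: undup_uniq.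
apply/funext => x; rewrite /restr mem_undup; case: ifPn => // xs.
have [//|h] := eqVneq (phi x) 0.
have : [set x | phi x != 0] x := h.
by rewrite sE /= (negPf xs).
Qed.

Lemma fs_restr (s : seq X) f : fs (restr s f).
Proof.
apply: (@sub_finite_set _ _ [set` s]); last exact: finite_seq.
by move=> x /=; rewrite /restr; case: ifPn; rewrite ?eqxx.
Qed.

Lemma fs_ind1 z : fs (ind1 z).
Proof.
apply: (@sub_finite_set _ _ [set z]); last exact: finite_set1.
move=> x /= h; apply/eqP; apply: contraNT h => h.
by rewrite ind1_ne.
Qed.

Lemma fs_sum (P : (X -> R) -> Prop) phi :
  P 0 -> (forall a f g, P f -> P g -> P (a *: f + g)) ->
  (forall z, P (ind1 z)) -> fs phi -> P phi.
Proof.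
move=> P0 PL P1 /fsP[s us ->]; rewrite restrE//.
elim: s {us} => [|z s IH]; first by rewrite big_nil.
by rewrite big_cons; apply: PL.
Qed.

Lemma fs_fe phi : fs phi -> fe phi.
Proof.
apply: fs_sum; [exact: (fe0 hg)|exact: (feL hg)|exact: fe_ind1].
Qed.

Lemma fs_l2 phi : fs phi -> l2 phi.
Proof. apply: fs_sum; [exact: l20|exact: l2L|exact: l2_ind1]. Qed.

Lemma fsL (a : R) f g : fs f -> fs g -> fs (a *: f + g).
Proof.
move=> hf hg'; apply: (@sub_finite_set _ _ ([set x | f x != 0] `|` [set x | g x != 0])).
  move=> x /=; rewrite -[(a *: f + g) x]/(a * f x + g x) => h.
  have [fx|fx] := eqVneq (f x) 0; [right|by left].
  by rewrite fx mulr0 add0r in h.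
by rewrite finite_setU.
Qed.

Lemma fs0 : fs 0.
Proof.
rewrite /finitely_supported (_ : [set x | _] = set0) ?finite_set0//.
by apply/seteqP; split => x //=; rewrite eqxx.
Qed.

Lemma Q_restr f phi (s : seq X) : uniq s -> fe f ->
  Q f (restr s phi) = \sum_(y <- s) phi y * Lap b c f y.
Proof.
move=> us hf; rewrite (restrE _ us).
suff : fe (\sum_(y <- s) phi y *: (ind1 y : X -> R)) /\
   Q f (\sum_(y <- s) phi y *: (ind1 y : X -> R)) = \sum_(y <- s) phi y * Lap b c f y.
  by case.
elim: s {us} => [|z s [IH1 IH2]].
  by rewrite !big_nil; split; [exact: (fe0 hg)|rewrite (Qsym b c) (Q0l hg)].
rewrite !big_cons; split.
  by apply: (feL hg) => //; exact: fe_ind1.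
by rewrite (Qsym b c) (QL hg)// ?(Qsym b c _ f) ?IH2 ?Q_ind1//; exact: fe_ind1.
Qed.

(** [edge_bound] is chained along a path with (r + s)^2 <= 2 r^2 + 2 s^2. The constant depends on
    the path only, so the energy controls differences of values uniformly in [f]. *)
Lemma path_bound x y : connected_graph b ->
  exists2 C, 0 <= C & forall f, fe f -> (f x - f y) ^+ 2 <= C * Q f f.
Proof.
move=> /(_ x y)[p []]; elim: p x => [|z p IH] x /=.
  by move=> _ ->; exists 0 => // f _; rewrite subrr expr0n/= mul0r.
move=> /andP[bxz pz] lz; have [C C0 H] := IH z pz lz.
exists (2 * (2 / b x z) + 2 * C).
  by rewrite addr_ge0// !mulr_ge0// invr_ge0.
move=> f hf; have := H f hf; have := edge_bound hg x z hf.
have -> : (2 * (2 / b x z) + 2 * C) * Q f f =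
   2 * ((Q f f *+ 2) / b x z) + 2 * (C * Q f f) by ring.
rewrite mulrC -ler_pdivlMr// => h1 h2.
have := sqr_ge0 ((f x - f z) - (f z - f y)); nra.
Qed.

End green_formula.

Section cvg_helpers.
Context {R : realType}.
Implicit Types (u v : nat -> R) (l : R).

Lemma cvg_sqr_le (K : R) u v l : v n @[n --> \oo] --> (0 : R) ->
  (forall n, (l - u n) ^+ 2 <= K * v n) -> u n @[n --> \oo] --> l.
Proof.
move=> v0 H; apply/cvgrPdist_le => e e0.
have K1 : 0 < `|K| + 1 by rewrite ltr_wpDl.
have d0 : 0 < e ^+ 2 / (`|K| + 1) by rewrite divr_gt0// exprn_gt0.
move/cvgrPdist_le : v0 => /(_ _ d0)[N _ HN]; exists N => // n Nn.
have := HN n Nn; rewrite sub0r normrN ler_pdivlMr// => h.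
rewrite -(@ler_pXn2r _ 2) ?nnegrE ?(ltW e0)// real_normK ?num_real//.
apply: le_trans (H n) (le_trans _ h).
apply: le_trans (ler_norm _) _; rewrite normrM mulrC ler_wpM2l//.
by rewrite lerDl.
Qed.

Lemma cvg_harm_le (K : R) u l :
  (forall n, `|l - u n| <= K * (n.+1%:R)^-1) -> u n @[n --> \oo] --> l.
Proof.
move=> H; apply: (@cvg_sqr_le (K ^+ 2) _ (fun n => (n.+1%:R)^-1)).
  exact: cvg_harmonic.
move=> n; rewrite -real_normK ?num_real//.
have h0 : 0 <= (n.+1%:R : R)^-1 by rewrite invr_ge0.
have h1 : (n.+1%:R : R)^-1 <= 1 by rewrite invf_le1// ler1n.
apply: (@le_trans _ _ ((K * (n.+1%:R)^-1) ^+ 2)).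
  by rewrite lerXn2r// nnegrE// (le_trans _ (H n)).
by rewrite exprMn ler_wpM2l ?sqr_ge0// expr2 ler_piMr.
Qed.

Lemma harm_gt0 n : 0 < (n.+1%:R : R)^-1. Proof. by rewrite invr_gt0. Qed.

End cvg_helpers.

(** * The closure of the finitely supported functions *)

Section D0_theory.
Context {R : realType} {X : countType}.
Variables (b : X -> X -> R) (c : X -> R) (o : X).
Hypothesis hg : is_graph b c.
Hypothesis hc : connected_graph b.
Implicit Types f g u v phi : X -> R.
Local Notation Q := (dirichlet_form b c).
Local Notation fe := (finite_energy b c).
Local Notation fs := (@finitely_supported R X).

Lemma onormE f : fe f -> onorm b c o f = Num.sqrt (Q f f + `|f o| ^+ 2).
Proof. by move=> hf; rewrite /onorm (energyE hg hf). Qed.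

Lemma D0_intro f : fe f ->
  (forall e, 0 < e -> exists phi, [/\ fs phi, Q (f - phi) (f - phi) <= e &
     `|f o - phi o| <= e]) -> D0 b c o f.
Proof.
move=> hf H; split => // e e0.
(* With d <= 1 the squared value at [o] is also at most d, so the squared norm is at most 2 e^2 /
   3. *)
pose d := Num.min 1 (e ^+ 2 / 3).
have d0 : 0 < d by rewrite lt_min ltr01 divr_gt0// exprn_gt0.
have d1 : d <= 1 by rewrite ge_min lexx.
have d2 : d <= e ^+ 2 / 3 by rewrite ge_min lexx orbT.
have [phi [hp h1 h2]] := H d d0; exists phi; split => //.
rewrite -[X in onorm _ _ _ X]/(f - phi) onormE; last exact/(feB hg)/fs_fe.
rewrite -(@ltr_pXn2r _ 2) ?nnegrE ?sqrtr_ge0 ?(ltW e0)//.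
rewrite sqr_sqrtr; last by rewrite addr_ge0 ?(Q_ge0 hg) ?sqr_ge0.
rewrite -[(f - phi) o]/(f o - phi o).
have e2 : 0 < e ^+ 2 by rewrite exprn_gt0.
have := normr_ge0 (f o - phi o); nra.
Qed.

(** The norm sees a value at [o] only; [path_bound] transports the convergence there to every other
    point. *)
Lemma D0_approx f : D0 b c o f -> exists phi : nat -> X -> R,
  [/\ forall n, fs (phi n),
      Q (f - phi n) (f - phi n) @[n --> \oo] --> (0 : R) &
      forall x, phi n x @[n --> \oo] --> f x].
Proof.
move=> [hf H].
have K n : exists phi, fs phi /\ onorm b c o (f - phi) < (n.+1%:R)^-1.
  exact: H (harm_gt0 n).
pose phi n := sval (cid (K n)).
have phis n : fs (phi n) := (svalP (cid (K n))).1.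
have phin n : onorm b c o (f - phi n) < (n.+1%:R)^-1 := (svalP (cid (K n))).2.
have fd n : fe (f - phi n) by exact/(feB hg)/(fs_fe hg).
have Kn n : Q (f - phi n) (f - phi n) <= ((n.+1%:R)^-1) ^+ 2 /\
            `|f o - phi n o| <= (n.+1%:R)^-1.
  have := phin n; rewrite onormE//.
  rewrite -(@ltr_pXn2r _ 2) ?nnegrE ?sqrtr_ge0 ?(ltW (harm_gt0 n))//.
  have q0 := Q_ge0 hg (f - phi n).
  rewrite sqr_sqrtr; last by rewrite addr_ge0 ?sqr_ge0.
  rewrite -[(f - phi n) o]/(f o - phi n o) => h.
  have s0 := sqr_ge0 (`|f o - phi n o|).
  split; first by apply/ltW/(le_lt_trans _ h); rewrite lerDl.
  rewrite -(@ler_pXn2r _ 2) ?nnegrE ?(ltW (harm_gt0 n))//.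
  by apply/ltW/(le_lt_trans _ h); rewrite lerDr.
exists phi; split => //.
  apply: (@cvg_harm_le _ 1) => n; rewrite sub0r normrN ger0_norm ?(Q_ge0 hg)//.
  apply: (le_trans (Kn n).1); rewrite mul1r expr2 ger_pMr ?harm_gt0//.
  by rewrite invf_le1// ler1n.
move=> x; have [C C0 HC] := path_bound hg x o hc.
apply: (@cvg_harm_le _ (Num.sqrt C + 1)) => n.
rewrite mulrDl mul1r.
have -> : f x - phi n x = ((f - phi n) x - (f - phi n) o) + (f o - phi n o).
  rewrite -[(f - phi n) x]/(f x - phi n x) -[(f - phi n) o]/(f o - phi n o).
  ring.
apply: (le_trans (ler_normD _ _)); apply: lerD (Kn n).2.
rewrite -(@ler_pXn2r _ 2) ?nnegrE ?mulr_ge0 ?sqrtr_ge0 ?(ltW (harm_gt0 n))//.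
rewrite real_normK ?num_real// exprMn sqr_sqrtr//.
by apply: (le_trans (HC _ (fd n))); rewrite ler_wpM2l// (Kn n).1.
Qed.

Lemma Q_cvg (phi : nat -> X -> R) f g : (forall n, fe (phi n)) -> fe f -> fe g ->
  Q (f - phi n) (f - phi n) @[n --> \oo] --> (0 : R) ->
  Q g (phi n) @[n --> \oo] --> Q g f.
Proof.
move=> hp hf hgg H; apply: (@cvg_sqr_le _ (Q g g) _ _ _ H) => n.
have -> : Q g f - Q g (phi n) = Q g (f - phi n).
  by rewrite !(Qsym b c g) (QBl hg).
by apply: (Q_CS2 hg) => //; exact: (feB hg).
Qed.

(** A finite intersection of eventual conditions is eventual; the finite set is an initial segment
    of the enumeration of [X] by [pickle]. *)
Lemma near_finite (P : nat -> X -> Prop) k :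
  (forall x, \forall n \near \oo, P n x) ->
  \forall n \near \oo, forall x, (pickle x < k)%N -> P n x.
Proof.
move=> H; elim: k => [|k IH]; first by exists 0%N.
have [[x hx]|nx] := pselect (exists x : X, pickle x = k).
  apply: filterS2 IH (H x) => n h1 h2 y; rewrite ltnS leq_eqVlt => /orP[|/h1//].
  by move=> /eqP yk; rewrite (_ : y = x)//; apply: (pcan_inj pickleK); rewrite yk.
apply: filterS IH => n h y; rewrite ltnS leq_eqVlt => /orP[/eqP yk|/h//].
by case: nx; exists y.
Qed.

(** Substitute for weak compactness and Mazur's lemma. Among finitely supported functions close to
    [f] on the first [k] points, the infimum [d k] of the energy increases with [k] and stays below
    [M]. Almost minimisers are then Cauchy in energy by the parallelogram law, and they converge
    pointwise to [f]. *)
Lemma D0_bounded_limit (phi : nat -> X -> R) f (M : R) :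
  (forall n, fs (phi n)) -> (forall n, Q (phi n) (phi n) <= M) ->
  (forall x, phi n x @[n --> \oo] --> f x) -> D0 b c o f.
Proof.
move=> phis phiM phif.
(* [C k] is convex and shrinks as [k] grows, so for k <= m the midpoint of an element of [C k] and
   one of [C m] still competes for [d k]. *)
pose C k g := fs g /\ forall x, (pickle x < k)%N -> `|g x - f x| <= (k.+1%:R)^-1.
have Cmono k m g : (k <= m)%N -> C m g -> C k g.
  move=> km [gs gf]; split=> // x xk; apply: (le_trans (gf x (leq_trans xk km))).
  by rewrite lef_pV2 ?posrE// ler_nat.
have Cconv k u v : C k u -> C k v -> C k (2^-1 *: (u + v)).
  move=> [us uf] [vs vf]; split.
    rewrite scalerDr; apply: fsL => //.
    by rewrite -[_ *: v]addr0; apply: fsL => //; exact: fs0.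
  move=> x xk; have := uf x xk; have := vf x xk.
  rewrite -[(_ *: _) x]/(2^-1 * (u x + v x)) !ler_norml.
  move: (k.+1%:R^-1) => h.
  by move=> /andP[? ?] /andP[? ?]; apply/andP; split; lra.
have Cex k : exists2 g, C k g & Q g g <= M.
  have [|N _ HN] := @near_finite (fun n x => `|phi n x - f x| <= (k.+1%:R)^-1) k.
    move=> x; have /cvgrPdist_le/(_ _ (harm_gt0 k)) := phif x.
    by apply: filterS => n; rewrite distrC.
  by exists (phi N) => //; split => //; apply: HN => /=.
pose S k := [set Q g g | g in C k].
have Slb k : lbound (S k) 0 by move=> _ [g _ <-]; exact: Q_ge0.
have Shi k : has_inf (S k).
  split; last by exists 0.
  by have [g h _] := Cex k; exists (Q g g), g.
pose d k := inf (S k).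
have dle k g : C k g -> d k <= Q g g.
  by move=> h; apply: ge_inf; [exists 0|exists g].
have dM k : d k <= M by have [g h1 h2] := Cex k; exact: le_trans (dle _ _ h1) h2.
have dnd : {homo d : k m / (k <= m)%N >-> k <= m}.
  move=> k m km; apply: lb_le_inf; first by have [] := Shi m.
  by move=> _ [g h <-]; apply: dle; exact: Cmono h.
have dub : has_ubound (range d) by exists M => _ [k _ <-].
have dcv := nondecreasing_is_cvgn dnd dub.
pose D := lim (d n @[n --> \oo]).
have dD k : d k <= D by exact: nondecreasing_cvgn_le.
have G k : exists g, C k g /\ Q g g <= d k + (k.+1%:R)^-1.
  have [_ [g h <-] h2] := inf_adherent (harm_gt0 k) (Shi k).
  by exists g; split => //; exact: ltW.
pose g k := sval (cid (G k)).
have gC k : C k (g k) := (svalP (cid (G k))).1.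
have gQ k : Q (g k) (g k) <= d k + (k.+1%:R)^-1 := (svalP (cid (G k))).2.
have gf k : fe (g k) by apply: (fs_fe hg); have [] := gC k.
(* From Q(u - v) = 2 Q u + 2 Q v - 4 Q((u + v) / 2), with [d k] below the energy of the midpoint and
   [D] above every [d m]. *)
pose r k := 2 * (D - d k) + 4 * (k.+1%:R)^-1.
have gr k m : (k <= m)%N -> fe (g k - g m) /\ Q (g k - g m) (g k - g m) <= r k.
  move=> km; split; first exact: (feB hg).
  have := Q_parallelogram hg (gf k) (gf m).
  have := dle k _ (Cconv k _ _ (gC k) (Cmono _ _ _ km (gC m))).
  rewrite (QZ2 hg); last exact: (feD hg).
  have := gQ k; have := gQ m; have := dD m; rewrite /r.
  have : (m.+1%:R : R)^-1 <= (k.+1%:R)^-1 by rewrite lef_pV2 ?posrE// ler_nat.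
  move: (k.+1%:R^-1) (m.+1%:R^-1) => h h'; lra.
have gpt x : g k x @[k --> \oo] --> f x.
  apply/cvgrPdist_le => e e0.
  have /cvgrPdist_le/(_ _ e0)[N _ HN] := @cvg_harmonic R.
  exists (maxn N (pickle x).+1) => // k /=; rewrite geq_max => /andP[Nk xk].
  rewrite distrC; apply: le_trans ((gC k).2 x xk) _.
  by have := HN k Nk; rewrite sub0r normrN ger0_norm// ltW// harm_gt0.
(* Lower semicontinuity of the energy, with [m] tending to infinity, replaces g m by [f]. *)
have gfr k : fe (g k - f) /\ Q (g k - f) (g k - f) <= r k.
  apply: (@Q_fatou _ _ _ _ hg (fun m => g k - g m) _ _ k).
    by move=> x; apply: cvgB (gpt x); exact: cvg_cst.
  by move=> m km; exact: gr.
have r0 : r k @[k --> \oo] --> (0 : R).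
  rewrite (_ : 0 = 2 * (D - D) + 4 * 0 :> R); last by rewrite subrr !mulr0 addr0.
  apply: cvgD; apply: cvgMr; last exact: cvg_harmonic.
  by apply: cvgB => //; exact: cvg_cst.
have hf : fe f.
  have -> : f = g 0%N - (g 0%N - f) by rewrite opprB addrCA subrr addr0.
  by apply: (feB hg) => //; have [] := gfr 0%N.
apply: D0_intro => // e e0.
move/cvgrPdist_le : r0 => /(_ _ e0) [N1 _ H1].
have /cvgrPdist_le/(_ _ e0)[N2 _ H2] := gpt o.
pose k := maxn N1 N2; exists (g k); split.
- by have [] := gC k.
- have -> : f - g k = (-1) *: (g k - f) by rewrite scaleN1r opprB.
  rewrite (QZ2 hg); last exact: (gfr k).1.
  rewrite sqrrN expr1n mul1r.
  apply: (le_trans (gfr k).2); have := H1 k (leq_maxl _ _).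
  by rewrite sub0r normrN; apply: le_trans; exact: ler_norm.
- by have := H2 k (leq_maxr _ _).
Qed.

(** Together with [D0_bounded_limit] this describes [D0] by pointwise limits of bounded energy, a
    description in which [o] no longer occurs. *)
Lemma D0_bounded f : D0 b c o f -> exists (phi : nat -> X -> R) (M : R),
  [/\ forall n, fs (phi n), forall n, Q (phi n) (phi n) <= M &
      forall x, phi n x @[n --> \oo] --> f x].
Proof.
move=> hD; have [phi [h1 h2 h3]] := D0_approx hD; have hf := hD.1.
have /cvgrPdist_le/(_ _ ltr01)[N _ HN] := h2.
exists (fun n => phi (n + N)%N), (2 * Q f f + 2).
split => // [n|x]; last first.
  by have := h3 x; rewrite -(cvg_shiftn N).
have := HN (n + N)%N (leq_addl _ _); rewrite sub0r normrN => /(le_trans (ler_norm _)).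
have hp := fs_fe hg (h1 (n + N)%N).
(* Applied to [f] and f - phi, whose difference is phi: once Q(f - phi) <= 1, it yields Q phi <= 2 Q
   f + 2. *)
have := Q_parallelogram hg hf (feB hg hf hp).
have -> : f - (f - phi (n + N)%N) = phi (n + N)%N.
  by rewrite opprB addrCA subrr addr0.
have := Q_ge0 hg (f + (f - phi (n + N)%N)).
lra.
Qed.

Lemma D0_fs phi : fs phi -> D0 b c o phi.
Proof.
by move=> h; apply: (@D0_bounded_limit (fun=> phi) _ (Q phi phi)) => // x; exact: cvg_cst.
Qed.

Lemma D0L (a : R) f g : D0 b c o f -> D0 b c o g -> D0 b c o (a *: f + g).
Proof.
move=> /D0_bounded[phi [M [h1 h2 h3]]] /D0_bounded[psi [N [k1 k2 k3]]].
apply: (@D0_bounded_limit (fun n => a *: phi n + psi n) _ (2 * (a ^+ 2 * M) + 2 * N)).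
- by move=> n; exact: fsL.
- move=> n; have hp := fs_fe hg (h1 n); have hq := fs_fe hg (k1 n).
  have := Q_parallelogram hg (feZ hg a hp) hq.
  have := Q_ge0 hg (a *: phi n - psi n); rewrite (QZ2 hg)//.
  have : a ^+ 2 * Q (phi n) (phi n) <= a ^+ 2 * M by rewrite ler_wpM2l ?sqr_ge0.
  have := k2 n; lra.
- move=> x; apply: cvgD => //; exact: cvgMr.
Qed.

Lemma D0B f g : D0 b c o f -> D0 b c o g -> D0 b c o (f - g).
Proof. by move=> ? ?; rewrite -scaleN1r addrC; exact: D0L. Qed.

(** Green's formula gives orthogonality to finitely supported functions, and Cauchy-Schwarz carries
    it to their closure. *)
Lemma D0_orth f g : fe g -> (forall z, Lap b c g z = 0) -> D0 b c o f -> Q g f = 0.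
Proof.
move=> hgg h hf; have [phi [h1 h2 h3]] := D0_approx hf.
have K n : Q g (phi n) = 0.
  have [s us ->] := fsP (h1 n); rewrite (Q_restr hg)// big1// => y _.
  by rewrite h mulr0.
have := Q_cvg (fun n => fs_fe hg (h1 n)) hf.1 hgg h2.
under eq_fun do rewrite K.
by move=> /(cvg_lim (@Rhausdorff R)) <-; rewrite lim_cst//; exact: Rhausdorff.
Qed.

End D0_theory.

(** * Minimal solutions and the Green function *)

Section laplacian.
Context {R : realType} {X : countType}.
Variables (b : X -> X -> R) (c : X -> R).
Hypothesis hg : is_graph b c.
Implicit Types f g u v s : X -> R.

Definition degree x : R := rsum (b x) + c x.

Lemma LapE u x : inF b u ->
  Lap b c u x = degree x * u x - rsum (fun y => b x y * u y).
Proof.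
move=> /(inFP hg) hu; rewrite /Lap /degree.
have -> : (fun y => b x y * (u x - u y)) = (fun y => b x y * u x - b x y * u y).
  by apply/funext => y; ring.
rewrite rsumB//; last exact: (summ_bconst hg).
have -> : (fun y => b x y * u x) = (fun y => u x * b x y).
  by apply/funext => y; ring.
rewrite rsumZ; first ring.
by apply/(summ_ge0 (graph_b_ge0 hg x)); exact: (graph_b_sum hg).
Qed.

Lemma inFL (a : R) f g : inF b f -> inF b g -> inF b (a *: f + g).
Proof.
move=> /(inFP hg) hf /(inFP hg) hgg; apply/(inFP hg) => x.
have -> : (fun y => b x y * (a *: f + g) y) =
    (fun y => a * (b x y * f y) + b x y * g y).
  by apply/funext => y; rewrite -[(a *: f + g) y]/(a * f y + g y); ring.
by apply: summD => //; exact: summZ.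
Qed.

Lemma inF_const (a : R) : inF b (fun=> a).
Proof. by apply/(inFP hg) => x; exact: (summ_bconst hg). Qed.

Lemma inF_le f g : (forall x, `|f x| <= `|g x|) -> inF b g -> inF b f.
Proof.
move=> fg hgg x; apply: le_lt_trans (hgg x); apply: le_esum => y _.
by rewrite lee_fin ler_wpM2l// (graph_b_ge0 hg).
Qed.

Lemma LapL (a : R) f g x : inF b f -> inF b g ->
  Lap b c (a *: f + g) x = a * Lap b c f x + Lap b c g x.
Proof.
move=> hf hgg; rewrite !LapE//; last exact: inFL.
have /(inFP hg)/(_ x) sf := hf; have /(inFP hg)/(_ x) sg := hgg.
have -> : (fun y => b x y * (a *: f + g) y) =
    (fun y => a * (b x y * f y) + b x y * g y).
  by apply/funext => y; rewrite -[(a *: f + g) y]/(a * f y + g y); ring.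
rewrite rsumD//; last exact: summZ.
by rewrite rsumZ// -[(a *: f + g) x]/(a * f x + g x); ring.
Qed.

Lemma LapB f g x : inF b f -> inF b g ->
  Lap b c (f - g) x = Lap b c f x - Lap b c g x.
Proof. by move=> *; rewrite -scaleN1r addrC LapL// mulN1r addrC. Qed.

Lemma inFB f g : inF b f -> inF b g -> inF b (f - g).
Proof. by move=> *; rewrite -scaleN1r addrC; exact: inFL. Qed.

Lemma inF0 : inF b (0 : X -> R). Proof. exact: inF_const. Qed.

Lemma Lap_const (a : R) x : Lap b c (fun=> a) x = c x * a.
Proof.
rewrite /Lap [X in X + _](_ : _ = 0) ?add0r// -(@rsum0 R X).
by apply: eq_rsum => y; rewrite subrr mulr0.
Qed.

Definition supersol (h s : X -> R) : Prop :=
  [/\ forall x, 0 <= s x, inF b s & forall x, h x <= Lap b c s x].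

(** One term of the mean-value sum is kept: this is Harnack's inequality across a single edge. *)
Lemma superharmonic_edge s x y : supersol 0 s -> b x y * s y <= degree x * s x.
Proof.
move=> [s0 sF /(_ x)]; rewrite LapE// subr_ge0; apply: le_trans.
have /(inFP hg)/(_ x) ss := sF.
have p0 z : 0 <= b x z * s z by rewrite mulr_ge0// (graph_b_ge0 hg).
by have := le_summ_seq (s := [:: y]) p0 ss isT; rewrite big_seq1.
Qed.

Section iteration.
Hypothesis deg0 : forall x, 0 < degree x.
Variable h : X -> R.
Hypothesis h0 : forall x, 0 <= h x.

(* Jacobi iteration for [L u = h], set to 0 outside the first points of [X] so
   that every iterate is finitely supported. *)
Fixpoint approx_sol (n : nat) : X -> R :=
  if n is m.+1 then fun x => if (pickle x < m)%N
    then (rsum (fun y => b x y * approx_sol m y) + h x) / degree x else 0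
  else fun=> 0.
Local Notation it := approx_sol.

Lemma it_supp n x : (n <= pickle x)%N -> it n x = 0.
Proof.
case: n => //= n nx; rewrite ifF//; apply: negbTE; rewrite -leqNgt.
exact: ltnW.
Qed.

Lemma it_fs n : finitely_supported (it n).
Proof.
apply: (@sub_finite_set _ _ (pickle @^-1` `I_n)).
  move=> x /= hx; rewrite ltnNge; apply: contraNN hx => /it_supp ->.
  exact: eqxx.
apply: finite_preimage; last exact: finite_II.
by move=> x y _ _; exact: (pcan_inj pickleK).
Qed.

Lemma it_inF n : inF b (it n).
Proof. exact/(fe_inF hg)/(fs_fe hg)/it_fs. Qed.

Lemma it_ge0 n x : 0 <= it n x.
Proof.
elim: n x => //= n IH x; case: ifP => // _.
rewrite divr_ge0 ?(ltW (deg0 x))// addr_ge0// ge0_rsum// => y.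
by rewrite mulr_ge0// (graph_b_ge0 hg).
Qed.

Lemma rsum_b_le u v x : inF b u -> inF b v -> (forall y, u y <= v y) ->
  rsum (fun y => b x y * u y) <= rsum (fun y => b x y * v y).
Proof.
move=> /(inFP hg) hu /(inFP hg) hv uv; apply: ler_rsum => // y.
by rewrite ler_wpM2l// (graph_b_ge0 hg).
Qed.

Lemma it_le_succ n x : it n x <= it n.+1 x.
Proof.
elim: n x => [|n IH] x; first exact: it_ge0.
rewrite [leLHS]/= [leRHS]/=; case: ifPn => [nx|_]; last exact: (it_ge0 n.+2).
rewrite (ltn_trans nx)// ler_pM2r ?invr_gt0// lerD2r.
apply: (rsum_b_le x (it_inF n) (it_inF n.+1)); exact: IH.
Qed.

Lemma it_mono x : {homo (fun n => it n x) : m n / (m <= n)%N >-> m <= n}.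
Proof. by apply/nondecreasing_seqP => n; exact: it_le_succ. Qed.

(** A supersolution lies above its own Jacobi step, and the step is monotone, so induction keeps
    every iterate below it. *)
Lemma it_le_supersol s : supersol h s -> forall n x, it n x <= s x.
Proof.
move=> [s0 sF sh]; elim=> [|n IH] x //=; case: ifP => // _.
rewrite ler_pdivrMr// mulrC; have := sh x; rewrite LapE//.
have := rsum_b_le x (it_inF n) sF IH; lra.
Qed.

(** Where the iterate is not cut to 0, [degree] times its value is [h] plus the sum over the
    previous iterate, and the latter only grows when the current iterate is inserted. *)
Lemma Lap_it n x : it n x != 0 -> Lap b c (it n) x <= h x.
Proof.
case: n => [|n]; first by rewrite /= eqxx.
move=> hx; rewrite LapE; last exact: it_inF.
have xn : (pickle x < n)%N.
  by move: hx; rewrite /=; case: ifP => //; rewrite eqxx.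
rewrite [X in _ * X]/= xn mulrC divfK ?gt_eqF//.
have := rsum_b_le x (it_inF n) (it_inF n.+1) (it_le_succ n); lra.
Qed.

(** By Green's formula the energy is the sum of [it n] times its Laplacian, and [Lap_it] applies
    wherever [it n] is not zero. All energy bounds on the iterates start here. *)
Lemma Q_it n : dirichlet_form b c (it n) (it n) <= rsum (fun x => it n x * h x).
Proof.
have [s us e] := fsP (it_fs n).
rewrite {2}e (Q_restr hg)//; last exact/(fs_fe hg)/it_fs.
have -> : (fun x => it n x * h x) = restr s (fun x => it n x * h x).
  by apply/funext => x; rewrite {1}e /restr; case: ifP => //; rewrite mul0r.
rewrite (rsum_restr _ us).2; apply: ler_sum => x _.
have [->|/Lap_it hx] := eqVneq (it n x) 0; first by rewrite !mul0r.
by rewrite ler_wpM2l// it_ge0.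
Qed.

Hypothesis itM : forall x, exists M, forall n, it n x <= M.

Definition min_sol x : R := lim (it n x @[n --> \oo]).

Lemma it_cvg x : it n x @[n --> \oo] --> min_sol x.
Proof.
apply: nondecreasing_is_cvgn; first exact: it_mono.
by have [M HM] := itM x; exists M => _ [n _ <-].
Qed.

Lemma it_le_min_sol n x : it n x <= min_sol x.
Proof. by apply: nondecreasing_cvgn_le; [exact: it_mono|exact/cvgP/it_cvg]. Qed.

Lemma min_sol_ge0 x : 0 <= min_sol x.
Proof. exact: le_trans (it_ge0 0 x) (it_le_min_sol 0 x). Qed.

Lemma min_sol_le s : supersol h s -> forall x, min_sol x <= s x.
Proof.
move=> hs x; apply: (cvgr_to_le (@it_cvg x)); apply: nearW => n.
exact: it_le_supersol.
Qed.

(** Fatou along the recursion, whose left side is at most [degree] times [min_sol]. It contains the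
    inequality L [min_sol] >= [h] and the summability that makes L meaningful. *)
Lemma min_sol_sum_le x : (\esum_(y in [set: X]) (b x y * min_sol y)%:E
   <= (degree x * min_sol x - h x)%:E)%E.
Proof.
have bp y n : 0 <= b x y * it n y by rewrite mulr_ge0 ?it_ge0// (graph_b_ge0 hg).
(* From this index on, [it n.+1] is computed at [x] by the recursion instead of being cut to 0. *)
apply: (@fatou_esum _ _ (fun n y => b x y * it n y) _ _ (pickle x).+1) => //.
  by move=> y; apply: cvgMr; exact: it_cvg.
move=> n xn; have /(inFP hg)/(_ x) sf := it_inF n.
rewrite -rsum_EFin// lee_fin lerBrDr.
have := it_le_min_sol n.+1 x; rewrite /= xn ler_pdivrMr// => H.
by rewrite [leRHS]mulrC.
Qed.

Lemma min_sol_inF : inF b min_sol.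
Proof.
move=> x; apply: le_lt_trans (_ : _ <= (degree x * min_sol x - h x)%:E)%E _.
  apply: le_trans (min_sol_sum_le x); apply: le_esum => y _.
  by rewrite ger0_norm// min_sol_ge0.
exact: ltry.
Qed.

(** One inequality is [min_sol_sum_le]. For the other, each iterate is at most the Jacobi step of
    [min_sol], since the cut-off can only lower it. *)
Lemma Lap_min_sol x : Lap b c min_sol x = h x.
Proof.
rewrite (LapE _ min_sol_inF).
have /(inFP hg)/(_ x) sf := min_sol_inF.
have p0 y : 0 <= b x y * min_sol y by rewrite mulr_ge0 ?min_sol_ge0// (graph_b_ge0 hg).
have := min_sol_sum_le x; rewrite -rsum_EFin// lee_fin => h1.
suff : degree x * min_sol x <= rsum (fun y => b x y * min_sol y) + h x by lra.
rewrite mulrC -ler_pdivlMr//; apply: (cvgr_to_le (@it_cvg x)); apply: nearW.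
case=> [|n] /=; first by rewrite divr_ge0 ?(ltW (deg0 x))// addr_ge0// ge0_rsum.
case: ifP => _; last by rewrite divr_ge0 ?(ltW (deg0 x))// addr_ge0// ge0_rsum.
rewrite ler_pM2r ?invr_gt0// lerD2r.
apply: rsum_b_le; [exact: it_inF|exact: min_sol_inF|exact: it_le_min_sol].
Qed.

End iteration.
End laplacian.

(** * Transience as boundedness of point evaluations *)

Section greenable.
Context {R : realType} {X : countType}.
Variables (b : X -> X -> R) (c : X -> R) (o : X).
Hypothesis hg : is_graph b c.
Hypothesis hc : connected_graph b.
Implicit Types f g u v s : X -> R.
Local Notation Q := (dirichlet_form b c).
Local Notation fs := (@finitely_supported R X).

(** The form in which transience enters most arguments; it mentions neither [o] nor [D0]. *)
Definition eval_bound x : Prop := exists2 C, 0 <= C &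
  forall phi, fs phi -> phi x ^+ 2 <= C * Q phi phi.

Lemma eval_bound_all x : eval_bound x -> forall y, eval_bound y.
Proof.
move=> [C C0 H] y; have [K K0 HK] := path_bound hg y x hc.
exists (2 * C + 2 * K); first by rewrite addr_ge0// mulr_ge0.
move=> phi hp; have := H _ hp; have := HK _ (fs_fe hg hp).
have := sqr_ge0 ((phi y - phi x) - phi x); nra.
Qed.

Lemma Q_green f y phi : finite_energy b c f ->
  (forall x, Lap b c f x = ind1 y x) -> fs phi -> Q f phi = phi y.
Proof.
move=> hf hL /fsP[s us e]; rewrite {1}e (Q_restr hg)//.
have -> : \sum_(z <- s) phi z * Lap b c f z = \sum_(z <- s) phi z * ind1 y z.
  by apply: eq_bigr => z _; rewrite hL.
rewrite {2}e /restr; case: ifPn => ys.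
  rewrite (bigD1_seq y)//= ind1_eq mulr1 big1 ?addr0// => z zy.
  by rewrite ind1_ne// mulr0.
rewrite big_seq big1// => z zs; rewrite ind1_ne ?mulr0//.
by apply: contraNneq ys => <-.
Qed.

(** By [Q_green] the function [f] represents evaluation at [y], so Cauchy-Schwarz gives the constant
    Q f f. *)
Lemma green_eval_bound f y : is_green b c o y f -> eval_bound y.
Proof.
move=> [[hf _] _ hL]; exists (Q f f); first exact: (Q_ge0 hg).
move=> phi hp; rewrite -(Q_green hf hL hp).
by apply: (Q_CS2 hg) => //; exact: fs_fe.
Qed.

Hypothesis hE : forall x, eval_bound x.

(** The point mass at [x] has value 1 there and energy [degree x]. The Jacobi step divides by this
    number. *)
Lemma degree_gt0 x : 0 < degree b c x.
Proof.
have [C C0 H] := hE x; have := H _ (fs_ind1 x).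
rewrite (Q_ind1 hg) ?LapE//; [|exact/(fe_inF hg)/fe_ind1|exact: fe_ind1].
rewrite ind1_eq expr1n mulr1.
have -> : rsum (fun y => b x y * ind1 x y) = 0.
  have h y : y != x -> b x y * ind1 x y = 0 by move=> /ind1_ne ->; rewrite mulr0.
  by rewrite (rsum_single h).2 (graph_b_diag hg) mul0r.
rewrite subr0 => h; rewrite ltNge; apply/negP => d0.
by have := le_trans h (mulr_ge0_le0 C0 d0); rewrite ler10.
Qed.

(** A self-improving bound: Q u <= u y by [Q_it], and (u y)^2 <= C Q u by evaluation, hence u y <= C
    and Q u <= C. *)
Lemma it_ind1_bound y : exists2 M, 0 <= M & forall n,
  Q (approx_sol b c (ind1 y) n) (approx_sol b c (ind1 y) n) <= M.
Proof.
have [C C0 H] := hE y; exists C => // n.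
set u := approx_sol _ _ _ n.
have fu : fs u by exact: it_fs.
have qu : Q u u <= u y.
  apply: le_trans (Q_it hg degree_gt0 (ind1_ge0 y) n) _.
  by rewrite -/u -/(l2dot u (ind1 y)) l2dot_ind1.
apply: (le_trans qu); have u0 : 0 <= u y by exact: (it_ge0 hg degree_gt0 (ind1_ge0 y)).
have := H u fu => h.
have {}h : u y ^+ 2 <= C * u y by apply: (le_trans h); rewrite ler_wpM2l.
have [->//|un] := eqVneq (u y) 0.
by rewrite -(@ler_pM2r _ (u y)) -?expr2// lt_def un.
Qed.

Lemma it_ind1_pt_bound y x : exists M, forall n, approx_sol b c (ind1 y) n x <= M.
Proof.
have [M M0 HM] := it_ind1_bound y; have [C C0 H] := hE x.
exists (1 + C * M) => n; have := H _ (it_fs b c (ind1 y) n).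
move=> /le_trans/(_ (ler_wpM2l C0 (HM n))).
move: (approx_sol _ _ _ n x) => u hu; have := sqr_ge0 (u - 1); nra.
Qed.

Definition gfun y : X -> R := min_sol b c (ind1 y).

Lemma gfun_ge0 y x : 0 <= gfun y x.
Proof. exact: (min_sol_ge0 hg degree_gt0 (ind1_ge0 y) (it_ind1_pt_bound y)). Qed.

Lemma gfun_inF y : inF b (gfun y).
Proof. exact: (min_sol_inF hg degree_gt0 (ind1_ge0 y) (it_ind1_pt_bound y)). Qed.

Lemma Lap_gfun y x : Lap b c (gfun y) x = ind1 y x.
Proof. exact: (Lap_min_sol hg degree_gt0 (ind1_ge0 y) (it_ind1_pt_bound y)). Qed.

Lemma gfun_min y s : supersol b c (ind1 y) s -> forall x, gfun y x <= s x.
Proof. exact: (min_sol_le hg degree_gt0 (ind1_ge0 y) (it_ind1_pt_bound y)). Qed.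

Lemma gfun_D0 y : D0 b c o (gfun y).
Proof.
have [M M0 HM] := it_ind1_bound y.
apply: (@D0_bounded_limit _ _ _ _ _ hg _ _ _ (it_fs b c (ind1 y)) HM).
move=> x; exact: (it_cvg hg degree_gt0 (ind1_ge0 y) (it_ind1_pt_bound y)).
Qed.

Lemma gfun_green y : is_green b c o y (gfun y).
Proof. by split; [exact: gfun_D0|exact: gfun_inF|exact: Lap_gfun]. Qed.

(** Such a [w] is orthogonal to [D0], itself included, so its approximations satisfy Q(phi n) = Q(w
    - phi n), which tends to 0; the evaluation bound forces phi n to tend to 0 pointwise. *)
Lemma D0_harmonic_eq0 w : D0 b c o w -> (forall x, Lap b c w x = 0) -> w = 0.
Proof.
move=> hw hL; have [phi [h1 h2 h3]] := D0_approx hg hc hw.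
have qw : Q w w = 0 by exact: (D0_orth hg hc hw.1 hL hw).
have qn n : Q w (phi n) = 0 by exact: (D0_orth hg hc hw.1 hL (D0_fs _ hg (h1 n))).
have e n : Q (w - phi n) (w - phi n) = Q (phi n) (phi n).
  have fp := fs_fe hg (h1 n).
  rewrite (QBl hg)//; [|exact: hw.1|exact: (feB hg hw.1)].
  rewrite !(Qsym _ _ _ (w - _)) !(QBl hg)//; try exact: hw.1.
  rewrite (Qsym _ _ (phi n) w) qw qn; ring.
apply/funext => x; have [C C0 H] := hE x.
have l0 : phi n x @[n --> \oo] --> (0 : R).
  apply: (@cvg_sqr_le _ C _ _ _ h2) => n.
  by rewrite sub0r sqrrN e; exact: H.
by have := cvg_unique _ (h3 x) l0; apply; exact: Rhausdorff.
Qed.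

Lemma is_green_unique y f : is_green b c o y f -> f = gfun y.
Proof.
move=> [h1 h2 h3]; apply/eqP; rewrite -subr_eq0; apply/eqP.
apply: D0_harmonic_eq0; first exact: (D0B hg hc h1 (gfun_D0 y)).
by move=> x; rewrite (LapB hg)//; [rewrite h3 Lap_gfun subrr|exact: gfun_inF].
Qed.

Lemma eval_bound_transient : transient b c o.
Proof.
by move=> y; exists (gfun y); split; [exact: gfun_green|move=> f /is_green_unique].
Qed.

Lemma greenE x y : green b c o x y = gfun y x.
Proof.
rewrite /green; case: xgetP => [f _ /is_green_unique ->//|/(_ (gfun y)) []].
exact: gfun_green.
Qed.

End greenable.

Lemma transient_eval_bound {R : realType} {X : countType} (b : X -> X -> R)
    (c : X -> R) (o : X) : is_graph b c ->
  transient b c o -> forall y, eval_bound b c y.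
Proof.
by move=> hg ht y; have [f [hf _]] := ht y; exact: (green_eval_bound hg hf).
Qed.

(** * Contraction semigroups by backward Euler *)

Lemma cvg_pow2 {R : realType} (K : R) : K / 2 ^+ k @[k --> \oo] --> (0 : R).
Proof.
rewrite -(mulr0 K); apply: cvgMr.
under eq_fun do rewrite -exprVn.
apply: cvg_expr; rewrite ger0_norm ?invr_ge0// invf_lt1// ltr1n//.
Qed.

(** * Commuting contractions on a normed subspace *)

Section norm_space.
Context {R : realType} {V : lmodType R} (S : V -> Prop) (N : V -> R).
Hypothesis S0 : S 0.
Hypothesis SL : forall a u v, S u -> S v -> S (a *: u + v).
Hypothesis N0 : forall u, 0 <= N u.
Hypothesis ND : forall u v, S u -> S v -> N (u + v) <= N u + N v.
Hypothesis NZ : forall a u, S u -> N (a *: u) = `|a| * N u.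
Hypothesis N_eq0 : forall u, S u -> N u = 0 -> u = 0.

Lemma SZ a u : S u -> S (a *: u).
Proof. by move=> h; rewrite -[_ *: _]addr0; exact: SL. Qed.
Lemma SD u v : S u -> S v -> S (u + v).
Proof. by move=> h k; rewrite -[u]scale1r; exact: SL. Qed.
Lemma SB u v : S u -> S v -> S (u - v).
Proof. by move=> h k; rewrite -scaleN1r addrC; exact: SL. Qed.

Lemma N00 : N 0 = 0.
Proof. by rewrite -(scale0r (0 : V)) NZ// normr0 mul0r. Qed.

Lemma NC u v : S u -> S v -> N (u - v) = N (v - u).
Proof.
move=> h k; have -> : u - v = -1 *: (v - u) by rewrite scaleN1r opprB.
by rewrite NZ ?normrN1 ?mul1r//; exact: SB.
Qed.

Lemma NB u v : S u -> S v -> N (u - v) <= N u + N v.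
Proof.
move=> h k; rewrite -[- v]scaleN1r (le_trans (ND h (SZ (-1) k)))//.
by rewrite NZ// normrN1 mul1r.
Qed.

Lemma N_trans w u v : S u -> S v -> S w -> N (u - v) <= N (u - w) + N (w - v).
Proof.
move=> h k l; have -> : u - v = (u - w) + (w - v) by rewrite addrA subrK.
by apply: ND; exact: SB.
Qed.

Definition cvN (u : nat -> V) v := N (u n - v) @[n --> \oo] --> (0 : R).

Lemma cvN_squeeze (u : nat -> V) v (K : nat -> R) :
  (forall n, N (u n - v) <= K n) -> K n @[n --> \oo] --> (0 : R) -> cvN u v.
Proof.
move=> h; apply: squeeze_cvgr; last exact: cvg_cst.
by apply: nearW => n; rewrite N0 h.
Qed.

Lemma cvN_unique (u : nat -> V) v w : (forall n, S (u n)) -> S v -> S w ->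
  cvN u v -> cvN u w -> v = w.
Proof.
move=> hu hv hw uv uw; apply/eqP; rewrite -subr_eq0; apply/eqP.
apply: N_eq0; first exact: SB.
apply/eqP; rewrite eq_le N0 andbT.
have H : N (u n - v) + N (u n - w) @[n --> \oo] --> (0 + 0 : R) by exact: cvgD.
rewrite addr0 in H; apply: (cvgr_to_ge H).
apply: nearW => n; rewrite (NC (hu n) hv); exact: N_trans.
Qed.

Lemma cvN_le (u : nat -> V) v (M : R) : (forall n, S (u n)) -> S v ->
  cvN u v -> (forall n, N (u n) <= M) -> N v <= M.
Proof.
move=> hu hv uv h.
have H : M + N (u n - v) @[n --> \oo] --> (M + 0 : R).
  by apply: cvgD => //; exact: cvg_cst.
rewrite addr0 in H; apply: (cvgr_to_ge H); apply: nearW => n.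
have e : v = u n - (u n - v) by rewrite opprB addrC subrK.
rewrite {1}e; apply: (le_trans (NB (hu n) (SB (hu n) hv))).
by rewrite lerD.
Qed.

Lemma cvN_L a (u v : nat -> V) u' v' : (forall n, S (u n)) -> (forall n, S (v n)) ->
  S u' -> S v' -> cvN u u' -> cvN v v' -> cvN (fun n => a *: u n + v n) (a *: u' + v').
Proof.
move=> hu hv hu' hv' cu cv.
apply: (@cvN_squeeze _ _ (fun n => `|a| * N (u n - u') + N (v n - v'))) => [n|].
  have -> : a *: u n + v n - (a *: u' + v') = a *: (u n - u') + (v n - v').
    by rewrite scalerBr opprD addrACA.
  rewrite -NZ; last exact: SB.
  by apply: ND; [apply: SZ; exact: SB|exact: SB].
by rewrite -[0 : R]addr0 -[X in X + _](mulr0 `|a|); apply: cvgD => //; exact: cvgMr.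
Qed.

Lemma cvN_cst v : cvN (fun=> v) v.
Proof. by rewrite /cvN; under eq_fun do rewrite subrr N00; exact: cvg_cst. Qed.

Definition good (B : V -> V) : Prop :=
  [/\ forall f, S f -> S (B f),
      forall a f g, S f -> S g -> B (a *: f + g) = a *: B f + B g &
      forall f, S f -> N (B f) <= N f].

Lemma good_S B f : good B -> S f -> S (B f).
Proof. by move=> [h _ _]; exact: h. Qed.

Lemma good_id : good id. Proof. by split. Qed.

Lemma good_comp B C : good B -> good C -> good (fun f => B (C f)).
Proof.
move=> [B1 B2 B3] [C1 C2 C3]; split => [f hf|a f h hf hh|f hf].
- exact/B1/C1.
- by rewrite C2// B2//; exact: C1.
- exact: le_trans (B3 _ (C1 _ hf)) (C3 _ hf).
Qed.

Lemma good_iter B n : good B -> good (iter n B).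
Proof.
by move=> hB; elim: n => [|n IH]; [exact: good_id|exact: good_comp].
Qed.

Lemma goodB B f g : good B -> S f -> S g -> B (f - g) = B f - B g.
Proof. by move=> [_ BL _] hf hg; rewrite -scaleN1r addrC BL// scaleN1r addrC. Qed.

Lemma goodD B f g : good B -> S f -> S g -> B (f + g) = B f + B g.
Proof. by move=> [_ BL _] hf hg; rewrite -[f]scale1r BL// !scale1r. Qed.

Lemma goodZ B a f : good B -> S f -> B (a *: f) = a *: B f.
Proof.
move=> [_ BL _] hf; have B0 : B 0 = 0.
  by have := BL (-1) 0 0 S0 S0; rewrite scaler0 addr0 scaleN1r addNr.
by rewrite -[in LHS](addr0 (a *: f)) BL// B0 addr0.
Qed.

Lemma iter_comm B C n f : good B -> good C ->
  (forall g, S g -> B (C g) = C (B g)) -> S f ->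
  iter n B (C f) = C (iter n B f).
Proof.
move=> hB hC h; elim: n f => //= n IH f hf; rewrite IH// h//.
by have [+ _ _] := good_iter n hB; apply.
Qed.

Lemma iter_mul_comm B C n f : good B -> good C ->
  (forall g, S g -> B (C g) = C (B g)) -> S f ->
  iter n (fun g => B (C g)) f = iter n B (iter n C f).
Proof.
move=> hB hC h; elim: n f => //= n IH f hf; rewrite IH//.
congr (B _); rewrite (iter_comm n hB hC h)//.
by have [+ _ _] := good_iter n hC; apply.
Qed.

(** With powers written multiplicatively, B^(n+1) - C^(n+1) = B^n (B - C) + C (B^n - C^n), where
    commutation moves B^n past C; every factor in front is a contraction. *)
Lemma telescope_le B C n f : good B -> good C ->
  (forall g, S g -> B (C g) = C (B g)) -> S f ->
  N (iter n B f - iter n C f) <= n%:R * N (B f - C f).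
Proof.
move=> hB hC h hf; have [B1 B2 B3] := hB; have [C1 C2 C3] := hC.
elim: n => [|n IH] /=; first by rewrite subrr N00 mul0r.
have [Bn _ Bn3] := good_iter n hB; have [Cn _ _] := good_iter n hC.
have -> : B (iter n B f) - C (iter n C f) =
    iter n B (B f - C f) + C (iter n B f - iter n C f).
  rewrite (goodB (good_iter n hB)) ?(goodB hC) ?(iter_comm n hB hC h)//;
    do ?[exact: B1|exact: C1|exact: Bn|exact: Cn].
  by rewrite -iterSr iterS addrA subrK.
have s1 : S (B f - C f) by apply: SB; [exact: B1|exact: C1].
have s2 : S (iter n B f - iter n C f) by apply: SB; [exact: Bn|exact: Cn].
apply: le_trans (ND (Bn _ s1) (C1 _ s2)) _.
rewrite -natr1 mulrDl mul1r addrC; apply: lerD; last exact: Bn3.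
exact: le_trans (C3 _ s2) IH.
Qed.

End norm_space.

(** * Uniform boundedness near time zero *)

Section uniform_boundedness.
Context {R : realType} {V : lmodType R} (S : V -> Prop) (N : V -> R).
Hypothesis S0 : S 0.
Hypothesis SL : forall a u v, S u -> S v -> S (a *: u + v).
Hypothesis N0 : forall u, 0 <= N u.
Hypothesis ND : forall u v, S u -> S v -> N (u + v) <= N u + N v.
Hypothesis NZ : forall a u, S u -> N (a *: u) = `|a| * N u.
Hypothesis N_eq0 : forall u, S u -> N u = 0 -> u = 0.
Hypothesis complete : forall u : nat -> V, (forall n, S (u n)) ->
  (forall e, 0 < e -> exists n0, forall m n, (n0 <= m)%N -> (n0 <= n)%N ->
     N (u m - u n) <= e) -> exists2 v, S v & cvN N u v.
Variable T : R -> V -> V.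
Hypothesis T_S : forall t f, 0 <= t -> S f -> S (T t f).
Hypothesis T_L : forall t a f g, 0 <= t -> S f -> S g ->
  T t (a *: f + g) = a *: T t f + T t g.
Hypothesis T_bounded : forall t, 0 <= t ->
  exists M, forall f, S f -> N (T t f) <= M * N f.
Hypothesis T_0 : forall f, S f -> T 0 f = f.
Hypothesis T_cont : forall f e, S f -> 0 < e ->
  exists2 d, 0 < d & forall t, 0 < t -> t < d -> N (T t f - f) <= e.

Local Notation SZ := (SZ S0 SL).
Local Notation SB := (SB SL).
Local Notation SD := (SD SL).

Lemma T_Z t a f : 0 <= t -> S f -> T t (a *: f) = a *: T t f.
Proof.
move=> t0 sf; have B0 : T t 0 = 0.
  by have := T_L (-1) t0 S0 S0; rewrite scaler0 addr0 scaleN1r addNr.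
by rewrite -[in LHS](addr0 (a *: f)) T_L// B0 addr0.
Qed.

Lemma T_B t f g : 0 <= t -> S f -> S g -> T t (f - g) = T t f - T t g.
Proof. by move=> t0 sf sg; rewrite -scaleN1r addrC T_L// scaleN1r addrC. Qed.

(* Gliding hump: operators unbounded near time 0 would give points [x_n] with
   [N (T t_n x_n)] large, converging so fast that the limit [v] has
   [N (T t_n v)] unbounded, against continuity at 0. *)
Let hump (n : nat) (x : V) (r : R) (t B : R) (x' : V) : Prop :=
  [/\ [/\ 0 <= t, t <= (n.+1%:R)^-1 & 1 <= B],
      S x', N (x' - x) <= r, n.+1%:R <= N (T t x') &
      forall f, S f -> N (T t f) <= B * N f].

(** A multiple g of [f] of norm [r] has a large image. The images of x + g and x - g differ by twice
    that image, so one of the two is at least as large. *)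
Lemma hump_step : (forall d M, 0 < d -> 0 <= M -> exists t f,
    [/\ 0 <= t, t <= d, S f & M * N f < N (T t f)]) ->
  forall n x r, S x -> 0 < r -> exists t B x', hump n x r t B x'.
Proof.
move=> H n x r sx r0.
have M0 : 0 <= n.+1%:R / r by rewrite divr_ge0// ltW.
have [t [f [t0 td sf hf]]] := H _ _ (harm_gt0 n) M0.
have [B HB] := T_bounded t0.
have T0 : N (T t 0) = 0.
  by rewrite -(scale0r (0 : V)) T_Z// NZ ?normr0 ?mul0r//; exact: T_S.
have Nf : 0 < N f.
  rewrite lt_def N0 andbT; apply: contraTneq hf => /(N_eq0 sf) ->.
  by rewrite -leNgt T0 mulr_ge0.
pose g := (r / N f) *: f; have sg : S g by exact: SZ.
have Ng : N g = r.
  by rewrite NZ// ger0_norm ?divr_ge0 ?(ltW r0)// divfK// gt_eqF.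
have STf := T_S t0 sf; have STg := T_S t0 sg; have STx := T_S t0 sx.
have NTg : n.+1%:R <= N (T t g).
  rewrite T_Z// NZ// ger0_norm ?divr_ge0 ?(ltW r0)//.
  have -> : n.+1%:R = r / N f * (n.+1%:R / r * N f).
    move: (n.+1%:R : R) => a; field.
    by rewrite (gt_eqF r0) (gt_eqF Nf).
  by rewrite ler_pM2l ?divr_gt0// ltW.
have T1 : T t (x + g) = T t x + T t g by rewrite -[x]scale1r T_L// !scale1r.
have T2 : T t (x - g) = T t x - T t g by exact: T_B.
have K : n.+1%:R <= N (T t (x + g)) \/ n.+1%:R <= N (T t (x - g)).
  have S1 : S (T t (x + g)) by apply: T_S => //; exact: SD.
  have S2 : S (T t (x - g)) by apply: T_S => //; exact: SB.
  have := NB S0 SL ND NZ S1 S2.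
  have -> : T t (x + g) - T t (x - g) = 2 *: T t g.
    rewrite T1 T2 opprB scaler_nat mulr2n.
    by rewrite addrC addrA subrK.
  rewrite NZ// ger0_norm// => h.
  have [|h'] := leP (n.+1%:R) (N (T t (x + g))); first by left.
  by right; lra.
have hB f' : S f' -> N (T t f') <= Num.max 1 B * N f'.
  by move=> sf'; apply: le_trans (HB _ sf') _; rewrite ler_wpM2r// le_max lexx orbT.
exists t, (Num.max 1 B).
case: K => K; [exists (x + g)|exists (x - g)]; split => //.
- by split => //; rewrite le_max lexx.
- exact: SD.
- by rewrite addrAC subrr add0r Ng.
- by split => //; rewrite le_max lexx.
- exact: SB.
- by rewrite addrAC subrr add0r -scaleN1r NZ// normrN1 mul1r Ng.
Qed.

Lemma locally_bounded : exists d M, [/\ 0 < d, 0 <= M &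
  forall t f, 0 <= t -> t <= d -> S f -> N (T t f) <= M * N f].
Proof.
apply: contrapT => nH.
have H d M : 0 < d -> 0 <= M -> exists t f,
    [/\ 0 <= t, t <= d, S f & M * N f < N (T t f)].
  move=> d0 M0; apply: contrapT => nE; apply: nH; exists d, M; split => //.
  move=> t f t0 td sf; rewrite leNgt; apply/negP => h.
  by apply: nE; exists t, f.
(* The step is made total in (point, radius), so that one choice function serves every stage. *)
have step (n : nat) (q : V * R) : exists z : R * R * V,
    S q.1 -> 0 < q.2 -> hump n q.1 q.2 z.1.1 z.1.2 z.2.
  have [[s1 s2]|h] := pselect (S q.1 /\ 0 < q.2).
    by have [t [B [x' h]]] := hump_step H n s1 s2; exists (t, B, x').
  by exists (0, 0, 0) => s1 s2; case: h.
pose F n := projT1 (choice (step n)).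
have HF n q : S q.1 -> 0 < q.2 -> hump n q.1 q.2 (F n q).1.1 (F n q).1.2 (F n q).2.
  exact: projT2 (choice (step n)) q.
(* Dividing the radius by 3 B gives B n * r n.+1 = r n / 3: later moves change the image under T (tt
   n) by at most r n / 2 <= 1/2, so its size n + 1 remains at least n at the limit. *)
pose st := fix st n : V * R := if n is m.+1 then
  let z := F m (st m) in (z.2, (st m).2 / (3 * z.1.2)) else (0, 1).
have inv n : S (st n).1 /\ 0 < (st n).2.
  elim: n => [|n [s1 s2]] /=; first by split.
  have [[_ _ B1] sx _ _ _] := HF n (st n) s1 s2; split=> //.
  by rewrite divr_gt0// mulr_gt0// (lt_le_trans _ B1).
pose x n := (st n).1; pose r n := (st n).2.
pose tt n := (F n (st n)).1.1; pose B n := (F n (st n)).1.2.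
have hh n : hump n (x n) (r n) (tt n) (B n) (x n.+1).
  by have [s1 s2] := inv n; exact: HF.
have rE n : r n.+1 = r n / (3 * B n) by [].
have rp n : 0 < r n by have [] := inv n.
have B1 n : 1 <= B n by have [[_ _ ?] _ _ _ _] := hh n.
have Bp n : 0 < B n by exact: lt_le_trans (B1 n).
have Br n : B n * r n.+1 = r n / 3.
  by have := Bp n; rewrite rE; move: (B n) (r n) => p q p0; field; rewrite gt_eqF.
have r3 n : r n.+1 <= r n / 3.
  by rewrite -Br -[leLHS]mul1r ler_wpM2r ?(ltW (rp _)).
have rpow n : r n <= 1 / 2 ^+ n.
  elim: n => [|n IH]; first by rewrite expr0 divr1.
  have := r3 n; have := rp n; have e : 1 / 2 ^+ n.+1 = 1 / 2 ^+ n / 2 :> R.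
    by rewrite exprS; field; rewrite expf_neq0.
  rewrite e; lra.
have sx n : S (x n) by have [] := inv n.
(* Since r n.+1 <= r n / 3, each radius is at most 3/2 of the next decrement, and the decrements
   telescope. *)
have dist n j : N (x (n + j)%N - x n) <= 3 / 2 * (r n - r (n + j)%N).
  elim: j => [|j IH]; first by rewrite addn0 !subrr (N00 S0 NZ) mulr0.
  rewrite addnS; have [_ _ h _ _] := hh (n + j)%N.
  have := N_trans SL ND (sx (n + j).+1) (sx n) (sx (n + j)%N).
  have := r3 (n + j)%N; lra.
have dist2 n m : (n <= m)%N -> N (x m - x n) <= 3 / 2 * r n.
  move=> nm; have := dist n (m - n)%N; rewrite subnKC//; have := rp m; lra.
have [v sv xv] : exists2 v, S v & cvN N x v.
  apply: complete => // e e0; have e4 : 0 < e / 4 by rewrite divr_gt0.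
  have /cvgrPdist_le/(_ _ e4)[n0 _ Hn] := cvg_pow2 (1 : R).
  exists n0 => m n mm nn.
  have := Hn n0 (leqnn _); rewrite sub0r normrN => /(le_trans (ler_norm _)).
  have := rpow n0; have := dist2 _ _ mm; have := dist2 _ _ nn.
  have := N_trans SL ND (sx m) (sx n) (sx n0); rewrite (NC SL NZ (sx n0) (sx n)).
  lra.
have vn n : N (v - x n) <= 3 / 2 * r n.
  apply: (cvN_le S0 SL ND NZ (u := fun m => x (m + n)%N - x n)).
  - by move=> m; exact: SB.
  - exact: SB.
  - move: xv; rewrite /cvN -(cvg_shiftn n) => h; apply: cvg_trans h.
    apply: near_eq_cvg; apply: nearW => m /=.
    by rewrite opprB addrA subrK.
  by move=> m; apply: dist2; exact: leq_addl.
have big n : n%:R <= N (T (tt n) v).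
  have [[t0 _ _] _ _ h1 h2] := hh n.
  have := h2 _ (SB sv (sx n.+1)); rewrite T_B//.
  have S1 := T_S t0 sv; have S2 := T_S t0 (sx n.+1).
  have := NB S0 SL ND NZ S1 (SB S1 S2).
  rewrite opprB [_ + (_ - _)]addrC subrK.
  have : B n * N (v - x n.+1) <= B n * (3 / 2 * r n.+1) by rewrite ler_wpM2l// ltW.
  have -> : B n * (3 / 2 * r n.+1) = r n / 2 by rewrite mulrCA Br; field.
  have := rpow n; rewrite div1r; have : (2 ^+ n)^-1 <= 1 :> R.
    by rewrite invf_le1 ?exprn_gt0// exprn_ege1// ler1n.
  move: h1; rewrite -natr1; lra.
have [d d0 hd] := T_cont sv ltr01.
have /cvgrPdist_lt/(_ _ d0)[n1 _ Hn1] := @cvg_harmonic R.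
pose n2 := (Num.bound (N v + 1)); pose n := maxn n1 n2.
have [[t0 t1 _] _ _ _ _] := hh n.
have td : tt n < d.
  apply: le_lt_trans t1 _; have := Hn1 n (leq_maxl _ _).
  by rewrite sub0r normrN; apply: le_lt_trans; exact: ler_norm.
have : N (T (tt n) v) <= N v + 1.
  move: t0; rewrite le_eqVlt => /orP[/eqP <-|tp]; first by rewrite T_0// lerDl.
  have := ND (SB (T_S (ltW tp) sv) sv) sv; rewrite subrK.
  have := hd _ tp td; lra.
move=> /(le_trans (big n)); apply/negP; rewrite -ltNge.
apply: lt_le_trans (archi_boundP _) _; first by rewrite addr_ge0.
by rewrite ler_nat leq_maxr.
Qed.

End uniform_boundedness.

Lemma iter_double T (F : T -> T) n x : iter (n * 2) F x = iter n (fun y => F (F y)) x.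
Proof. by elim: n => //= n ->. Qed.

(** * Existence of the semigroup from its resolvents *)

Section generation.
Context {R : realType} {V : lmodType R} (S : V -> Prop) (N : V -> R).
Hypothesis S0 : S 0.
Hypothesis SL : forall a u v, S u -> S v -> S (a *: u + v).
Hypothesis N0 : forall u, 0 <= N u.
Hypothesis ND : forall u v, S u -> S v -> N (u + v) <= N u + N v.
Hypothesis NZ : forall a u, S u -> N (a *: u) = `|a| * N u.
Hypothesis N_eq0 : forall u, S u -> N u = 0 -> u = 0.
Hypothesis complete : forall u : nat -> V, (forall n, S (u n)) ->
  (forall e, 0 < e -> exists n0, forall m n, (n0 <= m)%N -> (n0 <= n)%N ->
     N (u m - u n) <= e) -> exists2 v, S v & cvN N u v.
Variables (A : V -> V -> Prop) (J : R -> V -> V).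
Hypothesis J_good : forall l, 0 <= l -> good S N (J l).
Hypothesis J0 : forall f, S f -> J 0 f = f.
Hypothesis AJ : forall l h, 0 < l -> S h -> A (J l h) (l^-1 *: (h - J l h)).
Hypothesis JA : forall l u w, 0 <= l -> A u w -> [/\ S u, S w & u = J l (u + l *: w)].
Hypothesis A_dense : forall f e, S f -> 0 < e -> exists u w, A u w /\ N (f - u) <= e.

Local Notation cvN := (cvN N).
Local Notation SZ := (SZ S0 SL).
Local Notation SB := (SB SL).
Local Notation SD := (SD SL).

Lemma JS l f : 0 <= l -> S f -> S (J l f).
Proof. by move=> /J_good[h _ _]; exact: h. Qed.

Lemma JN l f : 0 <= l -> S f -> N (J l f) <= N f.
Proof. by move=> /J_good[_ _ h]; exact: h. Qed.

Lemma A_S u w : A u w -> S u /\ S w.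
Proof. by move=> /(JA ler01)[]. Qed.

Lemma AJ1 h : S h -> A (J 1 h) (h - J 1 h).
Proof. by move=> hh; have := AJ ltr01 hh; rewrite invr1 scale1r. Qed.

(** [A] consists of the pairs (J 1 h, h - J 1 h), so its linearity is inherited from J 1. *)
Lemma A_L a u w u' w' : A u w -> A u' w' -> A (a *: u + u') (a *: w + w').
Proof.
move=> h h'; have [su sw e] := JA ler01 h; have [su' sw' e'] := JA ler01 h'.
rewrite !scale1r in e e'.
have s1 : S (u + w) by exact: SD.
have s2 : S (u' + w') by exact: SD.
have [_ JL _] := J_good (@ler01 R).
have E : J 1 (a *: (u + w) + (u' + w')) = a *: u + u' by rewrite JL// -e -e'.
have := AJ1 (SL a s1 s2); rewrite E; congr (A _ _).
by rewrite scalerDr addrACA addrC addrK.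
Qed.

Lemma J_eq l f g : 0 <= l -> A f g -> f = J l f + l *: J l g.
Proof.
move=> l0 h; have [sf sg e] := JA l0 h; have hJ := J_good l0.
by rewrite {1}e (goodD hJ)// ?(goodZ S0 _ hJ)//; exact: SZ.
Qed.

Lemma A_comm l f g : 0 <= l -> A f g -> A (J l f) (J l g).
Proof.
rewrite le_eqVlt => /orP[/eqP <-|l0] h; have [sf sg] := A_S h.
  by rewrite !J0.
have := AJ l0 sf; congr (A _ _).
rewrite {1}(J_eq (ltW l0) h) addrAC subrr add0r scalerA mulVf ?scale1r//.
by rewrite gt_eqF.
Qed.

Lemma J_comm l m h : 0 <= l -> 0 <= m -> S h -> J l (J m h) = J m (J l h).
Proof.
move=> l0; rewrite le_eqVlt => /orP[/eqP <-|m0] sh.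
  by rewrite !J0//; exact: JS.
have sJ : S (J m h) by exact: JS (ltW m0) sh.
have := A_comm l0 (AJ m0 sh) => /(JA (ltW m0))[_ _ ->]; congr (J m _).
have hJ := J_good l0.
rewrite (goodZ S0 _ hJ); last exact: SB.
rewrite scalerA divff ?gt_eqF// scale1r -(goodD hJ)//; last exact: SB.
by rewrite addrC subrK.
Qed.

(** Since (1 + l A)(1 + m A) = 1 + (l + m) A + l m A^2, the difference is - l m J_l J_m J_(l+m)
    applied to A^2 f = k. *)
Lemma J_add_le l m f g k : 0 <= l -> 0 <= m -> A f g -> A g k ->
  N (J l (J m f) - J (l + m) f) <= l * m * N k.
Proof.
move=> l0 m0 hf hk; have p0 : 0 <= l + m by exact: addr_ge0.
have [sf sg] := A_S hf; have [_ sk] := A_S hk.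
pose P := J (l + m); have sP h : S h -> S (P h) by exact: JS.
have u1 := A_comm p0 hf; have u2 := A_comm p0 hk.
have ef := J_eq p0 hf.
have hw : A (m *: P g + P f) (m *: P k + P g) := A_L m u2 u1.
have [_ _ ew] := JA l0 hw; have [_ _ eu] := JA m0 u1.
have gl := J_good l0; have gm := J_good m0.
have e1 : (m *: P g + P f) + l *: (m *: P k + P g) = (l * m) *: P k + f.
  rewrite [in RHS]ef scalerDr scalerA -/P scalerDl.
  by rewrite [LHS](AC (2*2) (3*(2*(4*1)))).
have e2 : P f = J m (J l ((l * m) *: P k + f)).
  by rewrite -e1 -ew addrC; exact: eu.
have s1 : S ((l * m) *: P k) by apply: SZ; exact: sP.
rewrite -/(P f) e2 (goodD gl)// (goodD gm); [|exact: JS ..].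
rewrite [J m (J l f)]J_comm// opprD addrCA subrr addr0.
rewrite (goodZ S0 _ gl) ?(goodZ S0 _ gm); [|exact/JS/sP|exact: sP].
rewrite -scaleNr NZ ?normrN; last by apply: JS => //; apply: JS => //; exact: sP.
rewrite ger0_norm ?mulr_ge0// ler_wpM2l ?mulr_ge0//.
apply: le_trans (JN m0 (JS l0 (sP _ sk))) _.
exact: le_trans (JN l0 (sP _ sk)) (JN p0 sk).
Qed.

(** The graph of the square of [A]; the second-order error of [J_add_le] makes sense on its
    domain. *)
Definition D2 f k := exists2 g, A f g & A g k.

Lemma D2_S f k : D2 f k -> S f /\ S k.
Proof. by move=> [g /A_S[sf _] /A_S[_ sk]]. Qed.

(** For [u] in the domain of [A], J l u lies in the domain of the square, and u - J l u = l J l w is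
    small with [l]. *)
Lemma D2_dense f e : S f -> 0 < e -> exists u k, D2 u k /\ N (f - u) <= e.
Proof.
move=> sf e0; have e2 : 0 < e / 2 by rewrite divr_gt0.
have [u [w [huw hu]]] := A_dense sf e2; have [su sw] := A_S huw.
pose l := e / 2 / (N w + 1).
have l0 : 0 < l by rewrite divr_gt0// ltr_wpDl.
have hJw := A_comm (ltW l0) huw.
exists (J l u), (l^-1 *: (w - J l w)); split.
  by exists (J l w) => //; exact: AJ.
have sJ := JS (ltW l0) su.
apply: le_trans (N_trans SL ND sf sJ su) _.
rewrite [leRHS]splitr lerD// {1}(J_eq (ltW l0) huw) addrAC subrr add0r.
rewrite NZ; last exact: JS (ltW l0) sw.
rewrite (ger0_norm (ltW l0)) /l mulrAC ler_pdivrMr ?ltr_wpDl//.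
rewrite ler_pM2l//; apply: le_trans (JN (ltW l0) sw) _; lra.
Qed.

(** Powers of two make each product a refinement of the previous one, so consecutive products are
    compared factor by factor. *)
Definition Xn (k : nat) (t : R) : V -> V := iter (2 ^ k)%N (J (t / 2 ^+ k)).

Lemma step_ge0 (t : R) (k : nat) : 0 <= t -> 0 <= t / 2 ^+ k.
Proof. by move=> t0; rewrite divr_ge0// exprn_ge0. Qed.

Lemma Xn_good k t : 0 <= t -> good S N (Xn k t).
Proof. by move=> t0; apply: good_iter; apply: J_good; exact: step_ge0. Qed.

Lemma Xn_S k t f : 0 <= t -> S f -> S (Xn k t f).
Proof. by move=> /(Xn_good k)[h _ _]; exact: h. Qed.

(** It serves twice: with both times equal to t / 2 it compares consecutive Euler products, and with
    general times it yields the semigroup law in the limit. *)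
Lemma Xn_JJ k s t f k' : 0 <= s -> 0 <= t -> D2 f k' ->
  N (iter (2 ^ k)%N (fun g => J (s / 2 ^+ k) (J (t / 2 ^+ k) g)) f - Xn k (s + t) f)
    <= s * t * N k' / 2 ^+ k.
Proof.
move=> s0 t0 [g hf hk]; have [sf _] := A_S hf.
have s0' := step_ge0 k s0; have t0' := step_ge0 k t0.
have p0 : 0 <= (s + t) / 2 ^+ k by apply: step_ge0; exact: addr_ge0.
have gg := good_comp (J_good s0') (J_good t0').
apply: le_trans (telescope_le S0 SL ND NZ (2 ^ k)%N gg (J_good p0) _ sf) _.
  by move=> h sh; rewrite (J_comm t0' p0)// (J_comm s0' p0)//; exact: JS.
have /(ler_wpM2l (ler0n R (2 ^ k)%N)) := J_add_le s0' t0' hf hk.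
rewrite -mulrDl => /le_trans; apply.
rewrite natrX le_eqVlt; apply/orP; left; apply/eqP.
by field; rewrite expf_neq0.
Qed.

Lemma Xn_step k t f k' : 0 <= t -> D2 f k' ->
  N (Xn k t f - Xn k.+1 t f) <= t ^+ 2 * N k' / 4 / 2 ^+ k.
Proof.
move=> t0 hf; have [sf _] := D2_S hf; have t2 : 0 <= t / 2 by rewrite divr_ge0.
have := Xn_JJ k t2 t2 hf.
have -> : t / 2 + t / 2 = t by rewrite -splitr.
have -> : Xn k.+1 t f = iter (2 ^ k)%N (fun g => J (t / 2 / 2 ^+ k) (J (t / 2 / 2 ^+ k) g)) f.
  rewrite /Xn expnSr iter_double; congr (iter _ _ f); apply/funext => g.
  suff -> : t / 2 ^+ k.+1 = t / 2 / 2 ^+ k by [].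
  by rewrite exprS invfM mulrA.
rewrite (NC SL NZ); 
  [|apply: (good_S _ sf); apply: good_iter; apply: good_comp;
    apply: J_good; exact: step_ge0|exact: Xn_S].
move/le_trans; apply; rewrite le_eqVlt; apply/orP; left; apply/eqP.
by field; rewrite expf_neq0.
Qed.

(** The increments of [Xn_step] are exactly differences of the geometric sequence on the right, so
    they telescope. *)
Lemma Xn_dist (k j : nat) t f k' : 0 <= t -> D2 f k' ->
  N (Xn k t f - Xn (k + j) t f)
    <= t ^+ 2 * N k' / 2 * ((2 ^+ k)^-1 - (2 ^+ (k + j))^-1).
Proof.
move=> t0 hf; have [sf _] := D2_S hf; elim: j => [|j IH].
  by rewrite addn0 !subrr (N00 S0 NZ) mulr0.
rewrite addnS.
apply: le_trans (N_trans SL ND (Xn_S k t0 sf) (Xn_S (k + j).+1 t0 sf) (Xn_S (k + j) t0 sf)) _.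
apply: le_trans (lerD IH (Xn_step (k + j) t0 hf)) _.
rewrite le_eqVlt; apply/orP; left; apply/eqP; rewrite [2 ^+ (k + j).+1]exprS.
by field; rewrite !expf_neq0.
Qed.

Lemma Xn_dist_le k m t f k' : 0 <= t -> D2 f k' -> (k <= m)%N ->
  N (Xn k t f - Xn m t f) <= t ^+ 2 * N k' / 2 / 2 ^+ k.
Proof.
move=> t0 hf km; have := Xn_dist k (m - k) t0 hf; rewrite subnKC// => /le_trans.
apply; rewrite ler_wpM2l ?gerBl ?invr_ge0 ?exprn_ge0//.
by rewrite divr_ge0// mulr_ge0// sqr_ge0.
Qed.

(** The products are contractions, so being Cauchy on the dense domain of the square extends to all
    of [S]. *)
Lemma Xn_cvg t f : 0 <= t -> S f -> exists2 v, S v & cvN (fun k => Xn k t f) v.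
Proof.
move=> t0 sf; apply: complete; first by move=> n; exact: Xn_S.
move=> e e0; have e4 : 0 < e / 4 by rewrite divr_gt0.
have [u [k' [hu fu]]] := D2_dense sf e4; have [su _] := D2_S hu.
have /cvgrPdist_le/(_ _ e4)[n0 _ Hn] := cvg_pow2 (t ^+ 2 * N k' / 2).
have H n : N (Xn n t f - Xn n t u) <= e / 4.
  have [X1 X2 X3] := Xn_good n t0.
  by rewrite -(goodB (Xn_good n t0))// (le_trans (X3 _ (SB sf su))).
have K n : (n0 <= n)%N -> N (Xn n0 t u - Xn n t u) <= e / 4.
  move=> nn; apply: le_trans (Xn_dist_le t0 hu nn) _.
  by have := Hn n0 (leqnn _); rewrite sub0r normrN; apply: le_trans; exact: ler_norm.
exists n0 => m n mm nn.
have S1 k := Xn_S k t0 sf; have S2 k := Xn_S k t0 su.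
have := N_trans SL ND (S1 m) (S1 n) (S2 m).
have := N_trans SL ND (S2 m) (S1 n) (S2 n).
have := N_trans SL ND (S2 m) (S2 n) (S2 n0).
have := H m; have := H n; have := K m mm; have := K n nn.
rewrite (NC SL NZ (S2 n0) (S2 m)) (NC SL NZ (S1 n) (S2 n)); lra.
Qed.

(* [J l] stands for the resolvent [(1 + l A)^{-1}]. *)
Definition sgT t f : V := xget f [set v | S v /\ cvN (fun k => Xn k t f) v].
Local Notation T := sgT.

Lemma sgTP t f : 0 <= t -> S f -> S (T t f) /\ cvN (fun k => Xn k t f) (T t f).
Proof.
move=> t0 sf; have [v sv cv] := Xn_cvg t0 sf; rewrite /sgT.
by case: xgetP => [w _ //|/(_ v)[]].
Qed.

Lemma sgT_eq t f v : 0 <= t -> S f -> S v -> cvN (fun k => Xn k t f) v -> T t f = v.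
Proof.
move=> t0 sf sv cv; have [s1 c1] := sgTP t0 sf.
by apply: (cvN_unique SL N0 ND NZ N_eq0 _ s1 sv c1 cv) => n; exact: Xn_S.
Qed.

Lemma sgT_good t : 0 <= t -> good S N (T t).
Proof.
move=> t0; split => [f sf|a f g sf sg|f sf]; first by have [] := sgTP t0 sf.
  have [s1 c1] := sgTP t0 sf; have [s2 c2] := sgTP t0 sg.
  apply: sgT_eq => //; [exact: SL|exact: SL|].
  have -> : (fun k => Xn k t (a *: f + g)) = (fun k => a *: Xn k t f + Xn k t g).
    by apply/funext => k; have [_ h _] := Xn_good k t0; rewrite h.
  by apply: (cvN_L S0 SL N0 ND NZ) => // n; exact: Xn_S.
have [s1 c1] := sgTP t0 sf.
apply: (cvN_le S0 SL ND NZ _ s1 c1) => n; first exact: Xn_S.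
by have [_ _ h] := Xn_good n t0; exact: h.
Qed.

Lemma sgT_S t f : 0 <= t -> S f -> S (T t f).
Proof. by move=> /sgT_good[h _ _]; exact: h. Qed.

Lemma sgT_N t f : 0 <= t -> S f -> N (T t f) <= N f.
Proof. by move=> /sgT_good[_ _ h]; exact: h. Qed.

Lemma sgT_comm B t f : good S N B ->
  (forall l g, 0 <= l -> S g -> B (J l g) = J l (B g)) -> 0 <= t -> S f ->
  T t (B f) = B (T t f).
Proof.
move=> hB h t0 sf; have [s1 c1] := sgTP t0 sf; have [B1 B2 B3] := hB.
apply: sgT_eq => //; do ?exact: B1.
apply: (cvN_squeeze N0 _ c1) => n.
rewrite /Xn (iter_comm _ (J_good (step_ge0 n t0)) hB)//; last first.
  by move=> g sg; rewrite h// step_ge0.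
by rewrite -(goodB hB) ?B3//; [exact: SB (Xn_S n t0 sf) _|exact: Xn_S].
Qed.

Lemma sgT_J l t f : 0 <= l -> 0 <= t -> S f -> T t (J l f) = J l (T t f).
Proof.
by move=> l0 t0 sf; apply: sgT_comm => //; [exact: J_good|move=> *; exact: J_comm].
Qed.

Lemma sgT_0 f : S f -> T 0 f = f.
Proof.
move=> sf; apply: sgT_eq => //.
have -> : (fun k => Xn k 0 f) = (fun=> f).
  apply/funext => k; rewrite /Xn mul0r; elim: (2 ^ k)%N => //= n ->.
  exact: J0.
exact: (cvN_cst S0 NZ).
Qed.

Lemma sgT_D2 s t f k' : 0 <= s -> 0 <= t -> D2 f k' -> T (s + t) f = T s (T t f).
Proof.
move=> s0 t0 hf; have [sf _] := D2_S hf; have p0 := addr_ge0 s0 t0.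
have [S1 c1] := sgTP t0 sf; have [S2 c2] := sgTP s0 S1.
apply: sgT_eq => //.
apply: (@cvN_squeeze _ _ _ N0 _ _ (fun k => s * t * N k' / 2 ^+ k +
   (N (Xn k t f - T t f) + N (Xn k s (T t f) - T s (T t f))))); last first.
  rewrite -[0 : R]addr0 -[X in _ + X]addr0.
  by apply: cvgD; [exact: cvg_pow2|exact: cvgD].
move=> k; have Sf := Xn_S k p0 sf; have St := Xn_S k t0 sf.
have Sst := Xn_S k s0 St; have SsT := Xn_S k s0 S1.
apply: le_trans (N_trans SL ND Sf S2 Sst) _; apply: lerD.
  rewrite (NC SL NZ)//; apply: le_trans (Xn_JJ k s0 t0 hf).
  rewrite /Xn -(iter_mul_comm _ (J_good (step_ge0 k s0)) (J_good (step_ge0 k t0)))//.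
  by move=> g sg; rewrite J_comm// step_ge0.
apply: le_trans (N_trans SL ND Sst S2 SsT) _; apply: lerD => //.
have [_ _ h] := Xn_good k s0.
by rewrite -(goodB (Xn_good k s0))//; apply: h; exact: SB.
Qed.

Lemma good_ext B C : good S N B -> good S N C ->
  (forall f k', D2 f k' -> B f = C f) -> forall f, S f -> B f = C f.
Proof.
move=> gB gC h f sf; apply/eqP; rewrite -subr_eq0; apply/eqP.
have [B1 _ B3] := gB; have [C1 _ C3] := gC.
have sBC := SB (B1 _ sf) (C1 _ sf).
apply: N_eq0 => //; apply/eqP; rewrite eq_le N0 andbT.
apply/ler_addgt0Pl => e e0; rewrite addr0.
have e2 : 0 < e / 2 by rewrite divr_gt0.
have [u [k' [hu fu]]] := D2_dense sf e2; have [su _] := D2_S hu.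
have -> : B f - C f = B (f - u) - C (f - u).
  rewrite (goodB gB)// (goodB gC)// (h _ _ hu).
  by rewrite opprB addrA subrK.
apply: le_trans (NB S0 SL ND NZ (B1 _ (SB sf su)) (C1 _ (SB sf su))) _.
rewrite [leRHS]splitr; apply: lerD.
  exact: le_trans (B3 _ (SB sf su)) fu.
exact: le_trans (C3 _ (SB sf su)) fu.
Qed.

Lemma sgT_add s t f : 0 <= s -> 0 <= t -> S f -> T (s + t) f = T s (T t f).
Proof.
move=> s0 t0 sf.
apply: (@good_ext (T (s + t)) (fun f => T s (T t f))) => //.
- by apply: sgT_good; exact: addr_ge0.
- by apply: good_comp; exact: sgT_good.
- by move=> g k'; exact: sgT_D2.
Qed.

Lemma sgT_lip t f g : 0 <= t -> A f g -> N (T t f - f) <= t * N g.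
Proof.
move=> t0 h; have [sf sg] := A_S h; have [S1 c1] := sgTP t0 sf.
have Xl k : N (Xn k t f - f) <= t * N g.
  have p0 := step_ge0 k t0.
  have := telescope_le S0 SL ND NZ (2 ^ k)%N (J_good p0) (good_id S N) (fun _ _ => erefl) sf.
  have -> : iter (2 ^ k)%N id f = f by elim: (2 ^ k)%N => //= n ->.
  move/le_trans; apply; rewrite /= {2}(J_eq p0 h) opprD addrA subrr add0r.
  rewrite -scaleNr NZ; last exact: JS.
  rewrite normrN ger0_norm//.
  apply: (@le_trans _ _ ((2 ^ k)%N%:R * (t / 2 ^+ k * N g))).
    by rewrite !ler_wpM2l// JN.
  rewrite natrX le_eqVlt; apply/orP; left; apply/eqP.
  by field; rewrite expf_neq0.
apply: (cvN_le S0 SL ND NZ (u := fun k => Xn k t f - f) _ _ _ Xl).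
- by move=> n; apply: SB => //; exact: Xn_S.
- exact: SB.
- apply: (cvN_squeeze N0 _ c1) => n.
  by rewrite opprB addrA subrK.
Qed.

(** The single Euler step J t f is the middle term: T t f - J t f is the tail estimate from level 0,
    and J t f - f + t g equals t^2 J t k. *)
Lemma sgT_est t f g k : 0 <= t -> A f g -> A g k ->
  N (T t f - f + t *: g) <= 2 * t ^+ 2 * N k.
Proof.
move=> t0 hf hg; have [sf sg] := A_S hf; have [_ sk] := A_S hg.
have hD : D2 f k by exists g.
have [S1 c1] := sgTP t0 sf; have SJ := JS t0 sf.
have E1 : N (T t f - J t f) <= t ^+ 2 * N k.
  apply: (cvN_le S0 SL ND NZ (u := fun n => Xn n t f - J t f)).
  - by move=> n; apply: SB => //; exact: Xn_S.
  - exact: SB.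
  - apply: (cvN_squeeze N0 _ c1) => n.
    by rewrite opprB addrA subrK.
  move=> n; have X0 : Xn 0 t f = J t f by rewrite /Xn expr0 divr1.
  rewrite (NC SL NZ (Xn_S n t0 sf) SJ) -X0.
  apply: le_trans (Xn_dist_le t0 hD (leq0n n)) _; rewrite expr0 divr1.
  have : 0 <= t ^+ 2 * N k by rewrite mulr_ge0 ?sqr_ge0.
  lra.
have E2 : N (J t f - f + t *: g) <= t ^+ 2 * N k.
  rewrite {2}(J_eq t0 hf) {2}(J_eq t0 hg).
  have SJk := JS t0 sk.
  have -> : J t f - (J t f + t *: J t g) + t *: (J t g + t *: J t k) = (t * t) *: J t k.
    by rewrite opprD addrA subrr add0r scalerDr addKr scalerA.
  by rewrite NZ// ger0_norm ?mulr_ge0// -expr2 ler_wpM2l ?sqr_ge0// JN.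
have -> : T t f - f + t *: g = (T t f - J t f) + (J t f - f + t *: g).
  by rewrite !addrA subrK.
apply: le_trans (ND _ _) _; [exact: SB|by apply: SD; [exact: SB|exact: SZ]|].
apply: le_trans (lerD E1 E2) _; lra.
Qed.

Lemma sgT_cont f e : S f -> 0 < e ->
  exists2 d, 0 < d & forall t, 0 <= t -> t <= d -> N (T t f - f) <= e.
Proof.
move=> sf e0; have e3 : 0 < e / 3 by rewrite divr_gt0.
have [u [w [hu fu]]] := A_dense sf e3; have [su sw] := A_S hu.
have w1 : 0 < N w + 1 by rewrite ltr_wpDl.
exists (e / 3 / (N w + 1)); first by rewrite divr_gt0.
move=> t t0; rewrite ler_pdivlMr// => td.
have St := sgT_S t0 su; have Sf := sgT_S t0 sf.
have := N_trans SL ND Sf sf St; have := N_trans SL ND St sf su.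
have := sgT_lip t0 hu; have := sgT_N t0 (SB sf su).
rewrite (goodB (sgT_good t0))// (NC SL NZ su sf); nra.
Qed.

Lemma J_cont f e : S f -> 0 < e -> exists2 l, 0 < l & N (f - J l f) <= e.
Proof.
move=> sf e0; have e3 : 0 < e / 3 by rewrite divr_gt0.
have [u [w [hu fu]]] := A_dense sf e3; have [su sw] := A_S hu.
have w1 : 0 < N w + 1 by rewrite ltr_wpDl.
pose l := e / 3 / (N w + 1); have l0 : 0 < l by rewrite divr_gt0.
exists l => //.
have Sl := JS (ltW l0) su; have Sf := JS (ltW l0) sf.
have := N_trans SL ND sf Sf su; have := N_trans SL ND su Sf Sl.
have := JN (ltW l0) (SB sf su).
have hJ := J_good (ltW l0).
have : N (u - J l u) <= e / 3.
  rewrite {1}(J_eq (ltW l0) hu) addrAC subrr add0r NZ; last exact: JS (ltW l0) sw.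
  rewrite ger0_norm ?(ltW l0)// /l mulrAC ler_pdivrMr// ler_pM2l//.
  by apply: le_trans (JN (ltW l0) sw) _; lra.
rewrite (goodB hJ)// (NC SL NZ Sf Sl); lra.
Qed.

(** When [f] is only in the domain of [A], write f = J l f + (f - J l f). The first part is in the
    domain of the square, where [sgT_est] applies; on the second, A takes the small value g - J l g
    and [sgT_lip] suffices. *)
Lemma sgT_derive f g e : A f g -> 0 < e ->
  exists2 d, 0 < d & forall t, 0 < t -> t <= d -> N (T t f - f + t *: g) <= t * e.
Proof.
move=> h e0; have [sf sg] := A_S h.
have e4 : 0 < e / 4 by rewrite divr_gt0.
have [l l0 hl] := J_cont sg e4.
have h1 := A_comm (ltW l0) h; have h2 := AJ l0 sg.
set k := l^-1 *: _ in h2.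
have k1 : 0 < N k + 1 by rewrite ltr_wpDl.
exists (e / 4 / (N k + 1)); first by rewrite divr_gt0.
move=> t t0; rewrite ler_pdivlMr// => td.
have SJf := JS (ltW l0) sf; have SJg := JS (ltW l0) sg.
have h3 : A (f - J l f) (g - J l g).
  by have := A_L (-1) h1 h; rewrite !scaleN1r ![- _ + _]addrC.
have t0' := ltW t0; have gT := sgT_good t0'.
have E1 := sgT_lip t0' h3; have E2 := sgT_est t0' h1 h2.
have -> : T t f - f + t *: g = (T t (f - J l f) - (f - J l f)) +
   ((T t (J l f) - J l f + t *: J l g) + t *: (g - J l g)).
  rewrite (goodB gT)// scalerBr.
  move: (T t f) (T t (J l f)) (t *: J l g) (t *: g) => p q d x.
  move: (J l f) => r.
  have -> : (q - r + d) + (x - d) = (q - r) + x.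
    by rewrite -addrA [d + _]addrC subrK.
  rewrite opprB [p - q + _](AC (2*2) ((1*4)*(3*2))) -[RHS]addrA; congr (_ + _).
  by rewrite addrA [r - q + _]addrA subrK subrr add0r.
have Sk : S k by have [] := A_S h2.
have S1 := sgT_S t0' SJf.
have S2 : S (g - J l g) := SB sg SJg.
have S3 : S (T t (J l f) - J l f + t *: J l g).
  by apply: SD; [exact: SB|exact: SZ].
have S4 : S (T t (f - J l f) - (f - J l f)).
  by apply: SB; [apply: sgT_S => //; exact: SB|exact: SB].
apply: le_trans (ND S4 (SD S3 (SZ t S2))) _.
have := ND S3 (SZ t S2); rewrite (NZ t S2) ger0_norm// => E3.
have E4 : t * N (g - J l g) <= t * (e / 4) by rewrite ler_wpM2l.
have E5 : t * (t * (N k + 1)) <= t * (e / 4) by rewrite ler_wpM2l.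
have : 0 <= t * t * 1 by rewrite !mulr_ge0.
nra.
Qed.

(** The generator cannot properly extend - A because 1 + A is already onto. Concretely, J 1 f has
    derivative J 1 f - f by [sgT_derive] and J 1 g by applying J 1 to the hypothesis, so f = J 1 (f
    - g). *)
Lemma generator_A f g : S f -> S g ->
  (forall e d, 0 < e -> 0 < d ->
    exists t, [/\ 0 < t, t <= d & N (T t f - f - t *: g) <= t * e]) ->
  A f (- g).
Proof.
move=> sf sg H; have j0 := @ler01 R; have hJ := J_good j0.
have Sf := JS j0 sf; have Sg := JS j0 sg.
suff v0 : f - J 1 f + J 1 g = 0.
  have e : J 1 (f - g) = f.
    rewrite (goodB hJ)//; apply/esym/eqP; rewrite -subr_eq0 opprB addrA addrAC v0.
    exact: eqxx.
  by have := AJ1 (SB sf sg); rewrite e addrAC subrr add0r.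
have Sv : S (f - J 1 f + J 1 g) by apply: SD => //; exact: SB.
apply: N_eq0 => //; apply/eqP; rewrite eq_le N0 andbT.
apply/ler_addgt0Pl => e e0; rewrite addr0.
have e2 : 0 < e / 2 by rewrite divr_gt0.
have [d d0 Hd] := sgT_derive (AJ1 sf) e2.
have [t [t0 td Ht]] := H _ _ e2 d0.
have {Hd} := Hd t t0 td.
have t0' := ltW t0; have ST := sgT_S t0' sf; have STJ := sgT_S t0' Sf.
have S1 : S (T t f - f - t *: g) by apply: SB; [exact: SB|exact: SZ].
have := le_trans (JN j0 S1) Ht.
rewrite (goodB hJ)//; [|exact: SB|exact: SZ].
rewrite (goodB hJ)// (goodZ S0 _ hJ)// -(sgT_J j0 t0' sf) => E1 E2.
rewrite -(ler_pM2l t0) -[X in X * N _](ger0_norm t0') -NZ//.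
have S2 : S (T t (J 1 f) - J 1 f - t *: J 1 g) by apply: SB; [exact: SB|exact: SZ].
have S3 : S (T t (J 1 f) - J 1 f + t *: (f - J 1 f)).
  by apply: SD; [exact: SB|apply: SZ; exact: SB].
have -> : t *: (f - J 1 f + J 1 g) = (T t (J 1 f) - J 1 f + t *: (f - J 1 f)) -
    (T t (J 1 f) - J 1 f - t *: J 1 g).
  rewrite scalerDr; move: (T t (J 1 f) - J 1 f) (t *: (f - J 1 f)) (t *: J 1 g).
  by move=> p q r; rewrite opprB [RHS]addrC addrA subrK addrC.
apply: le_trans (NB S0 SL ND NZ S3 S2) _.
by rewrite [e]splitr mulrDr lerD.
Qed.

(** * Uniqueness of the semigroup with a given generator *)

Section uniqueness.
Variable T' : R -> V -> V.
Hypothesis T'_S : forall t f, 0 <= t -> S f -> S (T' t f).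
Hypothesis T'_L : forall t a f g, 0 <= t -> S f -> S g ->
  T' t (a *: f + g) = a *: T' t f + T' t g.
Hypothesis T'_bounded : forall t, 0 <= t ->
  exists M, forall f, S f -> N (T' t f) <= M * N f.
Hypothesis T'_0 : forall f, S f -> T' 0 f = f.
Hypothesis T'_D : forall s t f, 0 <= s -> 0 <= t -> S f -> T' (s + t) f = T' s (T' t f).
Hypothesis T'_cont : forall f e, S f -> 0 < e ->
  exists2 d, 0 < d & forall t, 0 < t -> t < d -> N (T' t f - f) <= e.
Hypothesis T'_gen : forall f g, S f -> S g ->
  (forall e, 0 < e -> exists2 d, 0 < d &
     forall t, 0 < t -> t < d -> N (T' t f - f - t *: g) <= t * e) <-> A f (- g).

(** The difference quotient at time 0 commutes with the bounded operator T' t, so T' t preserves the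
    generator. *)
Lemma T'_A t f g : 0 <= t -> A f g -> A (T' t f) (T' t g).
Proof.
move=> t0 h; have [sf sg] := A_S h.
have SNg h' : S h' -> S (- h') by move=> ?; rewrite -scaleN1r; exact: SZ.
have T'N h' : S h' -> T' t (- h') = - T' t h'.
  by move=> sh; rewrite -scaleN1r (T_Z S0 T'_L)// scaleN1r.
have [M HM] := T'_bounded t0.
rewrite -[T' t g]opprK -T'N//.
apply/T'_gen; [exact: T'_S|exact/T'_S/SNg|move=> e e0].
have M1 : 0 < `|M| + 1 by rewrite ltr_wpDl.
have e1 : 0 < e / (`|M| + 1) by rewrite divr_gt0.
have hg : A f (- - g) by rewrite opprK.
have [d d0 Hd] := (T'_gen sf (SNg _ sg)).2 hg _ e1.
exists d => // s s0 sd; have := Hd s s0 sd.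
have SsT := T'_S (ltW s0) sf.
have SSg := SNg _ sg.
have S1 : S (T' s f - f - s *: - g) by apply: SB; [exact: SB|exact: SZ].
move/(ler_wpM2l (normr_ge0 M)) => h1; have := HM _ S1.
rewrite (T_B T'_L)//; [|exact: SB|exact: SZ].
rewrite (T_B T'_L)// (T_Z S0 T'_L)// -!T'_D// ?(ltW s0)// [t + s]addrC.
have : M * N (T' s f - f - s *: - g) <= `|M| * N (T' s f - f - s *: - g).
  by rewrite ler_wpM2r// ler_norm.
have : `|M| * (s * (e / (`|M| + 1))) <= s * e.
  rewrite mulrCA ler_pM2l// mulrA ler_pdivrMr// mulrC ler_wpM2l ?(ltW e0)//.
  by rewrite lerDl.
by move=> h2 h3 h4; exact: le_trans h4 (le_trans h3 (le_trans h1 h2)).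
Qed.

Lemma T'_J l t f : 0 <= l -> 0 <= t -> S f -> T' t (J l f) = J l (T' t f).
Proof.
rewrite le_eqVlt => /orP[/eqP <-|l0] t0 sf.
  by rewrite !J0//; exact: T'_S.
have Sl := JS (ltW l0) sf; have SlB := SB sf Sl.
have [_ _ ->] := JA (ltW l0) (T'_A t0 (AJ l0 sf)); congr (J l _).
rewrite (T_Z S0 T'_L)// scalerA divff ?gt_eqF// scale1r (T_B T'_L)//.
by rewrite addrC subrK.
Qed.

(** T' commutes with the resolvents, hence with the Euler products and with their limit. *)
Lemma T'_T s t f : 0 <= s -> 0 <= t -> S f -> T' s (T t f) = T t (T' s f).
Proof.
move=> s0 t0 sf; have [M HM] := T'_bounded s0.
have [S1 c1] := sgTP t0 sf; have S2 := T'_S s0 sf.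
apply/esym/sgT_eq => //; first exact: T'_S.
apply: (@cvN_squeeze _ _ _ N0 _ _ (fun k => M * N (Xn k t f - T t f))).
  move=> k; have SX := Xn_S k t0 sf.
  have -> : Xn k t (T' s f) = T' s (Xn k t f).
    rewrite /Xn; elim: (2 ^ k)%N => //= n ->.
    by rewrite T'_J ?step_ge0//; exact: good_S (good_iter n (J_good (step_ge0 k t0))) sf.
  by rewrite -(T_B T'_L)// HM//; exact: SB.
by rewrite -(mulr0 M); exact: cvgMr.
Qed.

Lemma T'_bounded_on t : exists2 K, 0 <= K &
  forall s f, 0 <= s -> s <= t -> S f -> N (T' s f) <= K * N f.
Proof.
have [d [M [d0 M0 H]]] :=
  locally_bounded S0 SL N0 ND NZ N_eq0 complete T'_S T'_L T'_bounded T'_0 T'_cont.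
have M1 : 0 <= M + 1 by rewrite addr_ge0.
have K n s f : 0 <= s -> s <= n%:R * d -> S f -> N (T' s f) <= (M + 1) ^+ n * N f.
  elim: n s f => [|n IH] s f s0.
    rewrite mul0r => s1 sf; have -> : s = 0 by apply/eqP; rewrite eq_le s1.
    by rewrite T'_0// expr0 mul1r.
  rewrite -natr1 mulrDl mul1r => sn sf; rewrite exprS -mulrA.
  have [sd|ds] := leP s d.
    apply: le_trans (H _ _ s0 sd sf) _; apply: ler_pM => //; first by rewrite lerDl.
    by rewrite -[leLHS]mul1r ler_wpM2r// exprn_ege1// lerDr.
  have s1 : 0 <= s - d by rewrite subr_ge0 ltW.
  have -> : s = d + (s - d) by rewrite addrCA subrr addr0.
  have Ss := T'_S s1 sf.
  rewrite T'_D// ?(ltW d0)//; apply: le_trans (H _ _ (ltW d0) (lexx _) Ss) _.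
  apply: ler_pM => //; first by rewrite lerDl.
  by apply: IH => //; rewrite lerBlDr.
pose n := Num.bound `|t / d|; exists ((M + 1) ^+ n); first by rewrite exprn_ge0.
move=> s f s0 st sf; apply: K => //; apply: (le_trans st).
by rewrite -ler_pdivrMr//; exact/ltW/(le_lt_trans (ler_norm _))/archi_boundP/normr_ge0.
Qed.

(** With s = t / n, the difference of the n-th powers of T' s and T s is telescoped, using that T'
    and T commute. On the domain of [A] both have derivative - A u at 0, so each of the n terms is
    o(1/n); density and boundedness give the rest. *)
Lemma sgT_unique t f : 0 <= t -> S f -> T' t f = T t f.
Proof.
move=> t0 sf.
have [K K0 HK] := T'_bounded_on t.
have dom u w : A u w -> T' t u = T t u.
  move=> h; have [su sw] := A_S h.
  have SN : S (- w) by rewrite -scaleN1r; exact: SZ.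
  have s1 := T'_S t0 su; have s2 := sgT_S t0 su.
  apply/eqP; rewrite -subr_eq0; apply/eqP; apply: N_eq0; first exact: SB.
  apply/eqP; rewrite eq_le N0 andbT; apply/ler_addgt0Pl => e e0; rewrite addr0.
  move: t0; rewrite le_eqVlt => /orP[/eqP t0|tp].
    by rewrite -t0 T'_0// sgT_0// subrr (N00 S0 NZ) ltW.
  (* The n terms, each at most 2 K s e', add up to K t e / (K t + 1) <= e. *)
  have Kt : 0 < K * t + 1 by rewrite ltr_wpDl// mulr_ge0// ltW.
  pose e' := e / (K * t + 1) / 2; have e'0 : 0 < e' by rewrite !divr_gt0.
  have [d d0 Hd] := sgT_derive h e'0.
  have h' : A u (- - w) by rewrite opprK.
  have [d' d'0 Hd'] := (T'_gen su SN).2 h' _ e'0.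
  pose m := Num.min d d'; have m0 : 0 < m by rewrite lt_min d0.
  (* So many steps that both derivative estimates hold at time [s]. *)
  pose n := (Num.bound `|t / m|).+1; pose s := t / n%:R.
  have s0 : 0 < s by rewrite divr_gt0.
  have sm : s < m.
    rewrite /s ltr_pdivrMr// mulrC -ltr_pdivrMr//.
    apply: le_lt_trans (ler_norm _) (lt_trans (archi_boundP (normr_ge0 _)) _).
    by rewrite ltr_nat.
  have s0' := ltW s0.
  have Ss := T'_S s0' su; have St := sgT_S s0' su.
  have one : N (T' s u - T s u) <= s * (e' * 2).
    have sd : s <= d by apply/ltW/(lt_le_trans sm); rewrite ge_min lexx.
    have sd' : s < d' by apply: (lt_le_trans sm); rewrite ge_min lexx orbT.
    have -> : T' s u - T s u = (T' s u - u - s *: - w) - (T s u - u + s *: w).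
      rewrite scalerN opprK opprD addrACA subrr addr0.
      by rewrite opprB addrA subrK.
    have := Hd s s0 sd; have := Hd' s s0 sd'.
    have S1 : S (T' s u - u - s *: - w) by apply: SB; [exact: SB|exact: SZ].
    have S2 : S (T s u - u + s *: w) by apply: SD; [exact: SB|exact: SZ].
    have := NB S0 SL ND NZ S1 S2; lra.
  have step j : (j <= n)%N -> N (T' (j%:R * s) u - T (j%:R * s) u)
      <= j%:R * (K * (s * (e' * 2))).
    elim: j => [|j IH] jn.
      by rewrite !mul0r T'_0// sgT_0// subrr (N00 S0 NZ).
    have j0 : 0 <= j%:R * s by rewrite mulr_ge0.
    have jt : j%:R * s <= t.
      rewrite /s mulrA ler_pdivrMr// mulrC ler_pM2l// ler_nat; exact: ltnW.
    have S1 := T'_S j0 Ss; have S2 := T'_S j0 St.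
    have S3 : S (T (j%:R * s) (T s u)) by exact: sgT_S.
    have S4 := T'_S j0 su; have S5 := sgT_S j0 su.
    rewrite -natr1 mulrDl mul1r T'_D// sgT_add//.
    apply: le_trans (N_trans SL ND S1 S3 S2) _.
    rewrite [leRHS]mulrDl mul1r addrC; apply: lerD; last first.
      rewrite -(T_B T'_L)//; apply: le_trans (HK _ _ j0 jt (SB Ss St)) _.
      by rewrite ler_wpM2l.
    rewrite T'_T// -sgT_add// [j%:R * s + s]addrC sgT_add//.
    rewrite -(goodB (sgT_good s0'))//; apply: le_trans (IH (ltnW jn)).
    by apply: sgT_N => //; exact: SB.
  have := step n (leqnn n).
  have -> : n%:R * s = t by rewrite /s mulrC divfK// pnatr_eq0.
  move/le_trans; apply.
  have -> : n%:R * (K * (s * (e' * 2))) = K * t * e / (K * t + 1).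
    have -> : n%:R * (K * (s * (e' * 2))) = K * (s * n%:R) * (e' * 2) by ring.
    rewrite /s divfK ?pnatr_eq0// /e' divfK ?pnatr_eq0//.
    by rewrite mulrA.
  by rewrite ler_pdivrMr// mulrC ler_wpM2l ?(ltW e0)// lerDl.
apply/eqP; rewrite -subr_eq0; apply/eqP.
have S1 := T'_S t0 sf; have S2 := sgT_S t0 sf.
apply: N_eq0; first exact: SB.
apply/eqP; rewrite eq_le N0 andbT; apply/ler_addgt0Pl => e e0; rewrite addr0.
have K1 : 0 < K + 1 by rewrite ltr_wpDl.
have [u [w [hu fu]]] := A_dense sf (divr_gt0 e0 K1); have [su sw] := A_S hu.
have Sd := SB sf su.
have -> : T' t f - T t f = T' t (f - u) - T t (f - u).
  rewrite (T_B T'_L)// (goodB (sgT_good t0))// (dom _ _ hu).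
  by rewrite opprB addrA subrK.
apply: le_trans (NB S0 SL ND NZ (T'_S t0 Sd) (sgT_S t0 Sd)) _.
apply: le_trans (lerD (HK _ _ t0 (lexx _) Sd) (sgT_N t0 Sd)) _.
by move: fu; rewrite ler_pdivlMr// mulrDr mulr1 mulrC.
Qed.

End uniqueness.

End generation.

(** * Resolvents, heat semigroup and heat kernel *)

Section killed.
Context {R : realType} {X : countType}.
Variables (b : X -> X -> R) (c : X -> R) (o : X).
Hypothesis hg : is_graph b c.
Hypothesis hc : connected_graph b.
Variable a : R.
Hypothesis a0 : 0 < a.
Implicit Types f g h u v s : X -> R.

Definition killed (x : X) : R := c x + a.
Local Notation ca := killed.
Local Notation Q := (dirichlet_form b c).
Local Notation Qa := (dirichlet_form b ca).
Local Notation fs := (@finitely_supported R X).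

Lemma killed_graph : is_graph b ca.
Proof.
by case: hg => *; split => // x; rewrite addr_ge0// ltW.
Qed.
Local Notation hga := killed_graph.

Lemma killed_fe f : finite_energy b ca f <-> finite_energy b c f /\ l2 f.
Proof.
have c0 := graph_c_ge0 hg.
rewrite (feP hga) (feP hg) /wfin /killed.
have E : (\esum_(i in [set: X]) ((c i + a) * f i ^+ 2)%:E =
   (\esum_(i in [set: X]) (c i * f i ^+ 2)%:E) +
   a%:E * \esum_(i in [set: X]) (f i ^+ 2)%:E)%E.
  rewrite -esumZ ?(ltW a0)//; last by move=> i _; rewrite lee_fin sqr_ge0.
  rewrite -esumD; last first.
  - by move=> i _; rewrite mule_ge0// lee_fin ?sqr_ge0// ltW.
  - by move=> i _; rewrite lee_fin mulr_ge0// sqr_ge0.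
  by apply: eq_esum => i _; rewrite -EFinM -EFinD mulrDl.
rewrite E; split=> [[-> h]|[[-> h1] h2]].
  split; [split => //|].
    apply: le_lt_trans h; rewrite leeDl// mule_ge0// ?lee_fin ?(ltW a0)//.
    by rewrite esum_neqNy// => i; rewrite lee_fin sqr_ge0.
  rewrite /l2 ltNge leye_eq; apply/eqP => e; move: h.
  rewrite e gt0_muley ?lte_fin// addey ?ltxx//.
  rewrite gt_eqF// (@lt_le_trans _ _ 0%E)// esum_neqNy// => i.
  by rewrite lee_fin mulr_ge0// sqr_ge0.
by split => //; rewrite lte_add_pinfty// lte_mul_pinfty// lee_fin ltW.
Qed.

Lemma killed_Q f g : finite_energy b ca f -> finite_energy b ca g ->
  Qa f g = Q f g + a * l2dot f g.
Proof.
move=> /killed_fe[/(feP hg)[_ f1] f2] /killed_fe[/(feP hg)[_ g1] g2].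
rewrite !QE -addrA; congr (_ + _); have c0 := graph_c_ge0 hg.
rewrite l2dotE /wdot -rsumZ; last first.
  exact: (wfin_summ one_ge0 ((l2_wfin f).1 f2) ((l2_wfin g).1 g2)).
rewrite -rsumD; first by apply: eq_rsum => x; rewrite /killed; ring.
  exact: wfin_summ.
by apply: summZ; exact: (wfin_summ one_ge0 ((l2_wfin f).1 f2) ((l2_wfin g).1 g2)).
Qed.

Lemma killed_l2 f : finite_energy b ca f -> a * l2norm f ^+ 2 <= Qa f f.
Proof.
by move=> hf; rewrite killed_Q// l2norm_sqr lerDr (Q_ge0 hg).
Qed.

Lemma killed_QQ f : finite_energy b ca f -> Q f f <= Qa f f.
Proof.
by move=> hf; rewrite killed_Q// lerDl mulr_ge0 ?(ltW a0)// l2dot_ge0.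
Qed.

Lemma killed_Lap f x : Lap b ca f x = Lap b c f x + a * f x.
Proof. by rewrite /Lap /killed; ring. Qed.

(** The killing term alone bounds the value, as a phi(x)^2 is at most the energy; so this graph is
    transient even when the original one is not. *)
Lemma killed_eval x : eval_bound b ca x.
Proof.
exists a^-1; first by rewrite invr_ge0 ltW.
move=> phi hp; rewrite mulrC ler_pdivlMr//.
apply: le_trans (kill_bound hga x (fs_fe hga hp)).
by rewrite mulrC ler_wpM2r ?sqr_ge0// /killed lerDr (graph_c_ge0 hg).
Qed.

Lemma killed_D0 f : D0 b ca o f -> form_dom b c o f.
Proof.
move=> hf; have /killed_fe[f1 f2] := hf.1; split => //.
have [phi [M [h1 h2 h3]]] := D0_bounded hga hc hf.
apply: (D0_bounded_limit _ hg h1 _ h3) => n; apply: le_trans (h2 n).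
exact: (killed_QQ (fs_fe hga (h1 n))).
Qed.

(** The truncation level may vary from point to point; joint Lipschitz dependence on level and value
    keeps the energy of a truncated function under control. *)
Definition clip (r z : R) : R := Num.max (- `|r|) (Num.min `|r| z).

Lemma clip_lip (r r' z z' : R) : `|clip r z - clip r' z'| <= `|z - z'| + `|r - r'|.
Proof.
have := lerB_dist r r'; have := lerB_dist r' r; rewrite (distrC r').
have := ler_norm (z - z'); have := ler_norm (z' - z); rewrite (distrC z').
rewrite /clip; have := normr_ge0 r; have := normr_ge0 r'.
move: `|r| `|r'| `|r - r'| `|z - z'| => p p' d e *; rewrite ler_norml.
by rewrite /Num.max /Num.min; do ![case: ifPn]; rewrite -?leNgt => *; apply/andP; split; lra.
Qed.

Lemma clip_le (r z : R) : `|clip r z| <= `|r|.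
Proof.
have := normr_ge0 r; rewrite /clip; move: `|r| => p p0; rewrite ler_norml.
by rewrite /Num.max /Num.min; do ![case: ifPn]; rewrite -?leNgt => *; apply/andP; split; lra.
Qed.

Lemma clip0 (r : R) : clip r 0 = 0.
Proof.
have := normr_ge0 r; rewrite /clip; move: `|r| => p p0.
by rewrite /Num.max /Num.min; do ![case: ifPn]; rewrite -?leNgt => *; lra.
Qed.

Lemma clip_id (r : R) : clip r r = r.
Proof.
have := ler_norm r; have := ler_norm (- r); rewrite normrN /clip.
move: `|r| => p ? ?.
by rewrite /Num.max /Num.min; do ![case: ifPn]; rewrite -?leNgt => *; lra.
Qed.

(** Approximations of [f] in [D0] have bounded energy but no l2 bound. Truncating them at the level
    |f| keeps them finitely supported, at most doubles the energies of both functions, bounds the l2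
    norm by that of [f], and does not disturb the pointwise limit. *)
Lemma form_dom_killed f : form_dom b c o f -> D0 b ca o f.
Proof.
move=> [hD hl]; have hf := hD.1.
have [phi [M [h1 h2 h3]]] := D0_bounded hg hc hD.
pose psi n x := clip (f x) (phi n x).
have psis n : fs (psi n).
  apply: (@sub_finite_set _ _ [set x | phi n x != 0]); last exact: h1.
  by move=> x /=; apply: contraNN => /eqP e; rewrite /psi e clip0.
have psil n x : `|psi n x| <= `|f x| by exact: clip_le.
apply: (D0_bounded_limit _ hga psis (M := M *+ 2 + Q f f *+ 2 + a * l2norm f ^+ 2)).
  move=> n; have hfp := fs_fe hga (psis n).
  have [e1 e2] := (killed_fe _).1 hfp.
  rewrite killed_Q// -l2norm_sqr; apply: lerD.
    have q0 x : `|psi n x| <= `|phi n x| + `|f x|.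
      by rewrite (le_trans (psil n x))// lerDr.
    have [_ q] := @fe_contraction _ _ _ _ hg (phi n) f (psi n) (fs_fe hg (h1 n)) hf
      (fun x y => clip_lip _ _ _ _) q0.
    by apply: (le_trans q); rewrite lerD2r lerMn2r h2 orbT.
  rewrite ler_pM2l// lerXn2r ?nnegrE ?l2norm_ge0//.
  have := @l2norm_le_esum _ _ (psi n) (l2norm f) (l2norm_ge0 f).
  rewrite l2norm_EFin// => -[]//; apply: le_esum => x _; rewrite lee_fin.
  rewrite -real_normK ?num_real// -[leRHS]real_normK ?num_real//.
  by rewrite lerXn2r ?nnegrE.
move=> x; have /cvgrPdist_le hx := h3 x; apply/cvgrPdist_le => e e0.
apply: filterS (hx e e0) => n; apply: le_trans.
by rewrite -{1}(clip_id (f x)); apply: le_trans (clip_lip _ _ _ _) _; rewrite subrr normr0 addr0.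
Qed.

(** Green's formula settles finitely supported tests; the killed form dominates the l2 norm, so both
    sides pass to the closure. *)
Lemma killed_weak u h f : D0 b ca o u -> (forall x, Lap b ca u x = h x) -> l2 h ->
  form_dom b c o f -> Qa u f = l2dot h f.
Proof.
move=> hu hL hl hf; have hfa := form_dom_killed hf.
have [phi [h1 h2 h3]] := D0_approx hga hc hfa.
have c1 := Q_cvg hga (fun n => fs_fe hga (h1 n)) hfa.1 hu.1 h2.
have fl n : l2 (phi n) := fs_l2 (h1 n).
have e n : Qa u (phi n) = l2dot h (phi n).
  have [s us e] := fsP (h1 n).
  rewrite {1}e (Q_restr hga)//; last exact: hu.1.
  rewrite /l2dot; have -> : (fun x => h x * phi n x) = restr s (fun x => phi n x * h x).
    apply/funext => x; rewrite {1}e /restr; case: ifP => _; last by rewrite mulr0.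
    exact: mulrC.
  by rewrite (rsum_restr _ us).2; apply: eq_bigr => y _; rewrite hL.
have c2 : l2dot h (phi n) @[n --> \oo] --> l2dot h f.
  apply: (@cvg_sqr_le _ (l2norm h ^+ 2 / a) _ _ _ h2) => n.
  have sfp : l2 (f - phi n) by apply: l2B => //; exact: hf.2.
  have -> : l2dot h f - l2dot h (phi n) = l2dot h (f - phi n).
    by rewrite !(l2dotC h) l2dotB//; exact: hf.2.
  rewrite -(real_normK (num_real (l2dot h _))).
  apply: (@le_trans _ _ ((l2norm h * l2norm (f - phi n)) ^+ 2)).
    by rewrite lerXn2r ?nnegrE ?mulr_ge0 ?l2norm_ge0// l2_CS.
  rewrite exprMn -mulrA ler_wpM2l ?sqr_ge0// mulrC ler_pdivlMr// mulrC.
  by apply: killed_l2; apply: (feB hga); [exact: hfa.1|exact: (fs_fe hga)].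
rewrite (funext e) in c1.
by have := cvg_unique _ c1 c2; apply; exact: Rhausdorff.
Qed.

Section positive_rhs.
Variable h : X -> R.
Hypothesis h0 : forall x, 0 <= h x.
Hypothesis hl : l2 h.
Let D0a := degree_gt0 hga (fun x => killed_eval x).

(** The chain a |u|^2 <= Qa u <= <u, h> <= |u| |h| is uniform in [n]. It replaces the argument by
    point evaluation when [h] is a general l2 function. *)
Lemma killed_it_bound n : l2norm (approx_sol b ca h n) <= l2norm h / a /\
  Qa (approx_sol b ca h n) (approx_sol b ca h n) <= l2norm h ^+ 2 / a.
Proof.
set u := approx_sol _ _ _ _.
have fu : fs u := it_fs b ca h n.
have lu := fs_l2 fu.
have q1 : Qa u u <= l2dot u h := Q_it hga D0a h0 n.
have q2 := killed_l2 (fs_fe hga fu).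
have q3 := le_trans (ler_norm _) (l2_CS lu hl).
have n0 := l2norm_ge0 u.
have q4 : l2norm u <= l2norm h / a.
  rewrite ler_pdivlMr//; have [->|un] := eqVneq (l2norm u) 0.
    by rewrite mul0r l2norm_ge0.
  have up : 0 < l2norm u by rewrite lt_def un.
  rewrite -(ler_pM2l up) mulrA -expr2 mulrC.
  exact: le_trans q2 (le_trans q1 q3).
split => //; apply: (le_trans q1); apply: (le_trans q3).
by rewrite expr2 -mulrA mulrC ler_wpM2l ?l2norm_ge0.
Qed.

Lemma killed_it_pt x : exists M, forall n, approx_sol b ca h n x <= M.
Proof.
exists (l2norm h / a) => n; apply: le_trans (killed_it_bound n).1.
by apply: le_trans (ler_norm _) (l2_pt x _); exact/fs_l2/it_fs.
Qed.

Definition killed_sol : X -> R := min_sol b ca h.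
Local Notation u := killed_sol.

Lemma killed_sol_ge0 x : 0 <= u x.
Proof. exact: (min_sol_ge0 hga D0a h0 killed_it_pt). Qed.

Lemma killed_sol_D0 : D0 b ca o u.
Proof.
apply: (D0_bounded_limit _ hga (it_fs b ca h) (fun n => (killed_it_bound n).2)).
move=> x; exact: (it_cvg hga D0a h0 killed_it_pt).
Qed.

Lemma killed_sol_Lap x : Lap b ca u x = h x.
Proof. exact: (Lap_min_sol hga D0a h0 killed_it_pt). Qed.

Lemma killed_sol_min s : supersol b ca h s -> forall x, u x <= s x.
Proof. exact: (min_sol_le hga D0a h0 killed_it_pt). Qed.

Lemma killed_sol_opL : opL b c o u (h - a *: u).
Proof.
have hf := killed_D0 killed_sol_D0; have lu := hf.2.
split => //; first by apply: l2B => //; exact: l2Z.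
move=> f hff; have lf := hff.2.
have := killed_weak killed_sol_D0 killed_sol_Lap hl hff.
rewrite killed_Q; [|exact: killed_sol_D0.1|exact: (form_dom_killed hff).1].
rewrite l2dotB//; last exact: l2Z.
by rewrite l2dotZ//; lra.
Qed.

End positive_rhs.
End killed.

Lemma cvg_at_right0P {R : realType} (F : R -> R) : (forall t, 0 <= F t) ->
  (F t @[t --> (0 : R)^'+] --> (0 : R)) <->
  (forall e, 0 < e -> exists2 d, 0 < d & forall t, 0 < t -> t < d -> F t <= e).
Proof.
move=> F0; split => [/cvgrPdist_le h e e0|h].
  have [d d0 hd] := h e e0; exists d => // t t0 td.
  have := hd t; rewrite /= !sub0r !normrN (ger0_norm (ltW t0)) => /(_ td t0).
  exact: le_trans (ler_norm _).
apply/cvgrPdist_le => e e0; have [d d0 hd] := h e e0.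
exists d => // t /=; rewrite !sub0r !normrN => td t0.
by rewrite ger0_norm// hd// (le_lt_trans (ler_norm _) td).
Qed.

(** * The heat semigroup on l2 *)

Section heat_semigroup.
Context {R : realType} {X : countType}.
Variables (b : X -> X -> R) (c : X -> R) (o : X).
Hypothesis hg : is_graph b c.
Hypothesis hc : connected_graph b.
Implicit Types f g h u v s w : X -> R.
Local Notation Q := (dirichlet_form b c).
Local Notation A := (opL b c o).
Local Notation S := (@l2 R X).
Local Notation N := (@l2norm R X).

Lemma form_domL (a : R) f g : form_dom b c o f -> form_dom b c o g ->
  form_dom b c o (a *: f + g).
Proof. by move=> [? ?] [? ?]; split; [exact: D0L|exact: l2L]. Qed.

Lemma form_dom_fe f : form_dom b c o f -> finite_energy b c f.
Proof. by case=> [[]]. Qed.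

Lemma opL_L (a : R) u w u' w' : A u w -> A u' w' -> A (a *: u + u') (a *: w + w').
Proof.
move=> [u1 w1 h1] [u2 w2 h2]; split; [exact: form_domL|exact: l2L|].
move=> f hf; rewrite (QL hg); try exact: form_dom_fe.
by rewrite l2dotL//; [rewrite h1// h2|exact: hf.2].
Qed.

(** The differences v = u - u' and z = w - w' satisfy v = - l z, whence |v|^2 = - l Q(v, v) <= 0. *)
Lemma opL_inj (l : R) u w u' w' : 0 <= l -> A u w -> A u' w' ->
  u + l *: w = u' + l *: w' -> u = u'.
Proof.
move=> l0 h h' e; have := opL_L (-1) h' h; rewrite !scaleN1r ![- _ + _]addrC.
move=> [k1 k2 k3]; apply/eqP; rewrite -subr_eq0; apply/eqP.
have {}e : u - u' = - l *: (w - w').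
  apply/eqP; rewrite scaleNr -subr_eq0 opprK scalerBr addrACA -opprD e.
  by rewrite subrr.
have lv := k1.2; apply: l2norm0_eq0 => //.
have : l2norm (u - u') ^+ 2 <= 0.
  rewrite l2norm_sqr {1}e l2dotZ// -k3//.
  by rewrite mulNr oppr_le0 mulr_ge0// (Q_ge0 hg).
move=> h0; apply/eqP; rewrite -sqrf_eq0 eq_le h0 sqr_ge0//.
Qed.

Lemma res_exists (l : R) h : 0 < l -> S h -> exists u, A u (l^-1 *: (h - u)).
Proof.
move=> l0 hl; have a0 : 0 < l^-1 by rewrite invr_gt0.
have K g : (forall x, 0 <= g x) -> S g -> exists u, A u (l^-1 *: (g - u)).
  move=> g0 gl; pose k := l^-1 *: g.
  have k0 x : 0 <= k x by rewrite mulr_ge0// ltW.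
  have kl : S k by exact: l2Z.
  exists (killed_sol b c l^-1 k); rewrite scalerBr.
  exact: (killed_sol_opL o hg hc a0 k0 kl).
(* The minimal solution needs a non-negative right-hand side, so [h] is split into its positive and
   negative parts. *)
pose p x := Num.max (h x) 0; pose n x := Num.max (- h x) 0.
have p0 x : 0 <= p x by rewrite le_max lexx orbT.
have n0 x : 0 <= n x by rewrite le_max lexx orbT.
have pl : S p.
  by apply: l2_le hl => x; rewrite ger0_norm// ge_max normr_ge0 andbT ler_norm.
have nl : S n.
  apply: l2_le hl => x; rewrite ger0_norm// ge_max normr_ge0 andbT -normrN.
  exact: ler_norm.
have [u hu] := K p p0 pl; have [v hv] := K n n0 nl.
exists (u - v); have := opL_L (-1) hv hu; rewrite !scaleN1r ![- _ + _]addrC.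
congr (A _ _); rewrite -scalerBr; congr (_ *: _).
apply/funext => x.
rewrite -[LHS]/(p x - u x - (n x - v x)) -[RHS]/(h x - (u x - v x)) /p /n.
by rewrite /Num.max; do ![case: ifPn]; rewrite -?leNgt; lra.
Qed.

(** The resolvent (1 + l L)^(-1); the identity at l = 0 makes the Euler products meaningful at time
    0. *)
Definition Jr (l : R) h : X -> R :=
  if l == 0 then h else xget h [set u | A u (l^-1 *: (h - u))].

Lemma JrP l h : 0 < l -> S h -> A (Jr l h) (l^-1 *: (h - Jr l h)).
Proof.
move=> l0 hl; rewrite /Jr gt_eqF//.
by case: xgetP => [u _ //|H]; have [u hu] := res_exists l0 hl; case: (H u).
Qed.

Lemma Jr0 f : Jr 0 f = f. Proof. by rewrite /Jr eqxx. Qed.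

Lemma Jr_eq l u w : 0 <= l -> A u w -> [/\ S u, S w & u = Jr l (u + l *: w)].
Proof.
move=> l0 h; have [u1 w1 _] := h; have ul := u1.2; split => //.
move: l0; rewrite le_eqVlt => /orP[/eqP <-|l0]; first by rewrite Jr0 scale0r addr0.
have hl : S (u + l *: w) by apply: l2D => //; exact: l2Z.
apply: (opL_inj (ltW l0) h (JrP l0 hl)).
by rewrite scalerA divff ?gt_eqF// scale1r addrC [RHS]addrC subrK [RHS]addrC addrC.
Qed.

Lemma Jr_good l : 0 <= l -> good S N (Jr l).
Proof.
rewrite le_eqVlt => /orP[/eqP <-|l0].
  by split=> *; rewrite !Jr0.
have JS f : S f -> S (Jr l f) by move=> /(JrP l0)[[]].
split => // [a f g fl gl|f fl].
  have h := opL_L a (JrP l0 fl) (JrP l0 gl).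
  have [_ _ ->] := Jr_eq (ltW l0) h; congr (Jr l _).
  apply/funext => x; move: (Jr l f) (Jr l g) => p q.
  rewrite -[LHS]/(a * f x + g x) -[RHS]/(a * p x + q x +
    l * (a * (l^-1 * (f x - p x)) + l^-1 * (g x - q x))).
  by field; rewrite gt_eqF.
have [k1 k2 k3] := JrP l0 fl; set u := Jr l f in k1 k2 k3 *.
have ul := k1.2.
have fE : f = l *: (l^-1 *: (f - u)) + u.
  by rewrite scalerA divff ?gt_eqF// scale1r subrK.
have h : l2norm u ^+ 2 <= l2norm f * l2norm u.
  apply: le_trans (le_trans (ler_norm _) (l2_CS fl ul)).
  rewrite {1}fE l2dotL// l2norm_sqr lerDr -k3// mulr_ge0 ?(ltW l0)//.
  exact: (Q_ge0 hg).
have [->|un] := eqVneq (l2norm u) 0; first exact: l2norm_ge0.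
by rewrite -(@ler_pM2r _ (l2norm u)) -?expr2// lt_def un l2norm_ge0.
Qed.

Lemma Jr_killed l h : 0 < l -> (forall x, 0 <= h x) -> S h ->
  Jr l h = killed_sol b c l^-1 (l^-1 *: h).
Proof.
move=> l0 h0 hl; have a0 : 0 < l^-1 by rewrite invr_gt0.
have k0 x : 0 <= (l^-1 *: h) x by rewrite mulr_ge0// ltW.
have := killed_sol_opL o hg hc a0 k0 (l2Z _ hl); rewrite -scalerBr.
move=> /(Jr_eq (ltW l0))[_ _ ->]; congr (Jr l _).
by rewrite scalerA divff ?gt_eqF// scale1r addrC subrK.
Qed.

Lemma Jr_ge0 l h : 0 <= l -> (forall x, 0 <= h x) -> S h -> forall x, 0 <= Jr l h x.
Proof.
rewrite le_eqVlt => /orP[/eqP <-|l0] h0 hl x; first by rewrite Jr0.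
have a0 : 0 < l^-1 by rewrite invr_gt0.
have k0 y : 0 <= (l^-1 *: h) y by rewrite mulr_ge0// ltW.
by rewrite Jr_killed//; exact: (killed_sol_ge0 hg a0 k0 (l2Z _ hl)).
Qed.

(** Since (1 + l L) s >= s >= h, the function [s] is a supersolution of the equation whose minimal
    solution is J l h. *)
Lemma Jr_le_superharmonic l h s : 0 <= l -> (forall x, 0 <= h x <= s x) -> S h ->
  supersol b c 0 s -> forall x, Jr l h x <= s x.
Proof.
rewrite le_eqVlt => /orP[/eqP <-|l0] h0 hl [s1 s2 s3] x.
  by rewrite Jr0; have /andP[] := h0 x.
have a0 : 0 < l^-1 by rewrite invr_gt0.
have hh y : 0 <= h y by have /andP[] := h0 y.
have k0 y : 0 <= (l^-1 *: h) y by rewrite mulr_ge0// ltW.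
rewrite Jr_killed//; apply: (killed_sol_min hg a0 k0 (l2Z _ hl)).
split=> // y; rewrite killed_Lap; have := s3 y.
have : l^-1 * h y <= l^-1 * s y by rewrite ler_pM2l//; have /andP[] := h0 y.
rewrite -[(l^-1 *: h) y]/(l^-1 * h y) -[(0 : X -> R) y]/(0 : R); lra.
Qed.

(** A non-negative summable function is bounded by its sum, hence square summable. This puts L 1_y
    in l2 and all finitely supported functions in the domain of L. *)
Lemma l2_b y : S (b y).
Proof.
have b0 := graph_b_ge0 hg y.
have sb : summ (b y) by apply/(summ_ge0 b0); exact: (graph_b_sum hg).
apply: (@le_lt_trans _ _ ((rsum (b y))%:E * \esum_(x in [set: X]) (b y x)%:E)%E).
  rewrite -esumZ ?ge0_rsum//; last by move=> x _; rewrite lee_fin.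
  apply: le_esum => x _; rewrite -EFinM lee_fin expr2 ler_wpM2r//.
  by have := le_summ_seq (s := [:: x]) b0 sb isT; rewrite big_seq1.
by rewrite lte_mul_pinfty ?lee_fin ?ge0_rsum// (graph_b_sum hg).
Qed.

(** The Laplacian of the point mass at [y], written through the symmetry of [b]. *)
Definition Lind y : X -> R := degree b c y *: (ind1 y : X -> R) - b y.

Lemma opL_ind1 y : A (ind1 y) (Lind y).
Proof.
have hi : form_dom b c o (ind1 y).
  by split; [apply: D0_fs => //; exact: fs_ind1|exact: l2_ind1].
have l1 : S (degree b c y *: (ind1 y : X -> R)) by apply: l2Z; exact: l2_ind1.
split => //; first by apply: l2B => //; exact: l2_b.
move=> f hf; have ff := form_dom_fe hf; have lf := hf.2.
rewrite (Qsym b c) (Q_ind1 hg)// (LapE hg); last exact: (fe_inF hg).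
rewrite l2dotB//; last exact: l2_b.
by rewrite l2dotZ ?l2_ind1//; [rewrite (l2dotC (ind1 y)) l2dot_ind1|exact: l2_ind1].
Qed.

Lemma opL0 : A 0 0.
Proof. by have := opL_L (-1) (opL_ind1 o) (opL_ind1 o); rewrite !scaleN1r !addNr. Qed.

Lemma opL_dense f e : S f -> 0 < e -> exists u w, A u w /\ N (f - u) <= e.
Proof.
move=> fl e0; have [s us hs] := l2_restr_dense fl e0.
exists (restr s f); suff [w hw] : exists w, A (restr s f) w by exists w.
rewrite restrE//; elim: s {us hs} => [|y s [w hw]].
  by exists 0; rewrite big_nil; exact: opL0.
exists (f y *: Lind y + w); rewrite big_cons.
by apply: opL_L => //; exact: opL_ind1.
Qed.

Lemma l2_cvN (u : nat -> X -> R) : (forall n, S (u n)) ->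
  (forall e, 0 < e -> exists n0, forall m n, (n0 <= m)%N -> (n0 <= n)%N ->
     N (u m - u n) <= e) -> exists2 v, S v & cvN N u v.
Proof.
move=> hu h; have [v [v1 v2 v3]] := l2_complete hu h; exists v => //.
apply/cvgrPdist_le => e e0; have [n0 hn] := v3 e e0; exists n0 => // n nn.
by rewrite sub0r normrN ger0_norm ?l2norm_ge0//; exact: hn.
Qed.

Definition Sg : R -> (X -> R) -> X -> R := sgT S N Jr.

Let sl0 := @l20 R X.
Let slL := @l2L R X.
Let n0 := @l2norm_ge0 R X.
Let nD := @l2_triangle R X.
Let nZ := @l2normZ R X.
Let n_eq0 := @l2norm0_eq0 R X.
Let J0 f (_ : S f) := Jr0 f.

Lemma Sg_good t : 0 <= t -> good S N (Sg t).
Proof.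
exact: (sgT_good sl0 slL n0 nD nZ n_eq0 l2_cvN Jr_good J0 JrP Jr_eq opL_dense).
Qed.

Lemma Sg_S t f : 0 <= t -> S f -> S (Sg t f).
Proof. by move=> t0 fl; exact: good_S (Sg_good t0) fl. Qed.

Lemma Sg_N t f : 0 <= t -> S f -> N (Sg t f) <= N f.
Proof. by move=> t0 fl; have [_ _ h] := Sg_good t0; exact: h. Qed.

Lemma Sg0 f : S f -> Sg 0 f = f.
Proof.
exact: (sgT_0 sl0 slL n0 nD nZ n_eq0 l2_cvN Jr_good J0 JrP Jr_eq opL_dense).
Qed.

Lemma SgD (r t : R) f : 0 <= r -> 0 <= t -> S f -> Sg (r + t) f = Sg r (Sg t f).
Proof.
exact: (sgT_add sl0 slL n0 nD nZ n_eq0 l2_cvN Jr_good J0 JrP Jr_eq opL_dense).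
Qed.

Lemma Sg_cont f e : S f -> 0 < e ->
  exists2 d, 0 < d & forall t, 0 <= t -> t <= d -> N (Sg t f - f) <= e.
Proof.
exact: (sgT_cont sl0 slL n0 nD nZ n_eq0 l2_cvN Jr_good J0 JrP Jr_eq opL_dense).
Qed.

Lemma Sg_lip t f g : 0 <= t -> A f g -> N (Sg t f - f) <= t * N g.
Proof.
exact: (sgT_lip sl0 slL n0 nD nZ l2_cvN Jr_good J0 JrP Jr_eq opL_dense).
Qed.

Lemma Sg_est t f g k : 0 <= t -> A f g -> A g k ->
  N (Sg t f - f + t *: g) <= 2 * t ^+ 2 * N k.
Proof.
exact: (sgT_est sl0 slL n0 nD nZ l2_cvN Jr_good J0 JrP Jr_eq opL_dense).
Qed.

Lemma Sg_derive f g e : A f g -> 0 < e ->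
  exists2 d, 0 < d & forall t, 0 < t -> t <= d -> N (Sg t f - f + t *: g) <= t * e.
Proof.
exact: (sgT_derive sl0 slL n0 nD nZ n_eq0 l2_cvN Jr_good J0 JrP Jr_eq opL_dense).
Qed.

Lemma Sg_generator f g : S f -> S g ->
  (forall e d, 0 < e -> 0 < d ->
    exists t, [/\ 0 < t, t <= d & N (Sg t f - f - t *: g) <= t * e]) ->
  A f (- g).
Proof.
exact: (generator_A sl0 slL n0 nD nZ n_eq0 l2_cvN Jr_good J0 JrP Jr_eq opL_dense).
Qed.

Lemma Sg_cvN t f : 0 <= t -> S f -> S (Sg t f) /\ cvN N (fun k => Xn Jr k t f) (Sg t f).
Proof.
exact: (sgTP sl0 slL n0 nD nZ l2_cvN Jr_good J0 JrP Jr_eq opL_dense).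
Qed.

Lemma quotient_cvgP (T : R -> (X -> R) -> X -> R) f g :
  (forall t, 0 <= t -> S (T t f)) -> S f -> S g ->
  (l2norm (fun x => (T t f x - f x) / t - g x) @[t --> (0 : R)^'+] --> (0 : R)) <->
  (forall e, 0 < e -> exists2 d, 0 < d &
     forall t, 0 < t -> t < d -> N (T t f - f - t *: g) <= t * e).
Proof.
move=> TS fl gl.
have E t : 0 < t -> l2norm (fun x => (T t f x - f x) / t - g x) =
    t^-1 * N (T t f - f - t *: g).
  move=> t0; rewrite -[X in X * _]ger0_norm ?invr_ge0 ?(ltW t0)// -nZ; last first.
    by apply: l2B; [apply: l2B => //; exact: TS (ltW t0)|exact: l2Z].
  congr l2norm; apply/funext => x.
  rewrite -[RHS]/(t^-1 * (T t f x - f x - t * g x)).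
  by field; rewrite gt_eqF.
rewrite cvg_at_right0P; last by move=> t; exact: l2norm_ge0.
split=> h e e0; have [d d0 hd] := h e e0; exists d => // t t0 td; have := hd t t0 td.
  by rewrite E// ler_pdivrMl.
by rewrite E// ler_pdivrMl.
Qed.

Lemma Sg_semigroup : semigroup_of A Sg.
Proof.
split.
- by move=> t f; exact: Sg_S.
- by move=> t a f g t0 fl gl; have [_ h _] := Sg_good t0; exact: h.
- move=> t t0; exists 1 => f fl; rewrite mul1r; exact: Sg_N.
- exact: Sg0.
- exact: SgD.
- move=> f fl; apply/cvg_at_right0P => [t|e e0]; first exact: l2norm_ge0.
  have [d d0 hd] := Sg_cont fl e0; exists d => // t t0 td.
  exact: hd (ltW t0) (ltW td).
- move=> f g fl gl; rewrite quotient_cvgP//; last by move=> t t0; exact: Sg_S.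
  split=> [h|h e e0].
    apply: Sg_generator => // e d e0 d0; have [d' d'0 hd] := h e e0.
    pose m := Num.min d d'; have m0 : 0 < m by rewrite lt_min d0.
    exists (m / 2); split; first by rewrite divr_gt0.
      have : m <= d by rewrite ge_min lexx.
      lra.
    apply: hd; first by rewrite divr_gt0.
    have : m <= d' by rewrite ge_min lexx orbT.
    lra.
  have [d d0 hd] := Sg_derive h e0; exists d => // t t0 td.
  have := hd t t0 (ltW td); congr (l2norm _ <= _).
  by congr (_ + _); apply/funext => x; rewrite -[LHS]/(t * - g x) mulrN.
Qed.

Lemma heat_semigroup : semigroup_of A (heat b c o).
Proof.
rewrite /heat; case: xgetP => [T _ //|/(_ Sg)[]]; exact: Sg_semigroup.
Qed.

(** [heat] comes from a choice, so uniqueness of the semigroup is the only access to its values. *)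
Lemma heatE t f : 0 <= t -> S f -> heat b c o t f = Sg t f.
Proof.
have [h1 h2 h3 h4 h5 h6 h7] := heat_semigroup.
apply: (sgT_unique sl0 slL n0 nD nZ n_eq0 l2_cvN Jr_good J0 JrP Jr_eq opL_dense h1
  _ h3 h4 h5).
- by move=> t' a f' g t0 fl gl; exact: h2.
- move=> f' e fl e0; have := h6 f' fl.
  by move=> /(cvg_at_right0P (fun t => l2norm_ge0 _))/(_ e e0).
- move=> f' g fl gl.
  by rewrite -(h7 f' g fl gl) quotient_cvgP// => t' t0; exact: h1.
Qed.

End heat_semigroup.

(** * Symmetry, positivity and domination of the heat kernel *)

Section heat_kernel.
Context {R : realType} {X : countType}.
Variables (b : X -> X -> R) (c : X -> R) (o : X).
Hypothesis hg : is_graph b c.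
Hypothesis hc : connected_graph b.
Implicit Types (f g h u v w : X -> R) (t r : R).
Local Notation S := (@l2 R X).
Local Notation N := (@l2norm R X).
Local Notation A := (opL b c o).
Local Notation Sg := (Sg b c o).
Local Notation Jr := (Jr b c o).

Lemma Xn_pt t f x : 0 <= t -> S f -> Xn Jr k t f x @[k --> \oo] --> Sg t f x.
Proof.
move=> t0 fl; have [s1 c1] := Sg_cvN o hg hc t0 fl.
have sX k : S (Xn Jr k t f).
  by apply: (good_S _ fl); apply: (Xn_good (Jr_good o hg hc)).
apply/cvgrPdist_le => e e0; move/cvgrPdist_le : c1 => /(_ e e0).
apply: filterS => k; rewrite sub0r normrN ger0_norm ?l2norm_ge0// distrC.
by apply: le_trans; exact: (l2_pt x (l2B (sX k) s1)).
Qed.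

Lemma iter_Jr_between s n l f : supersol b c 0 s -> 0 <= l -> S f ->
  (forall x, 0 <= f x <= s x) ->
  S (iter n (Jr l) f) /\ forall x, 0 <= iter n (Jr l) f x <= s x.
Proof.
move=> hs l0 fl fs; elim: n => //= n [h1 h2].
have h3 x : 0 <= iter n (Jr l) f x by have /andP[] := h2 x.
split=> [|x]; first exact: good_S (Jr_good o hg hc l0) h1.
by rewrite (Jr_ge0 o hg hc)//= (Jr_le_superharmonic o hg hc l0 h2).
Qed.

Lemma Sg_between s t f : supersol b c 0 s -> 0 <= t -> S f ->
  (forall x, 0 <= f x <= s x) -> forall x, 0 <= Sg t f x <= s x.
Proof.
move=> hs t0 fl fs x; have hX := @Xn_pt t f x t0 fl.
have st k := step_ge0 k t0.
have K k := (iter_Jr_between (2 ^ k)%N hs (st k) fl fs).2 x.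
apply/andP; split.
  by apply: (cvgr_to_ge hX); apply: nearW => k; have /andP[] := K k.
by apply: (cvgr_to_le hX); apply: nearW => k; have /andP[] := K k.
Qed.

Lemma iter_Jr_ge0 n l f : 0 <= l -> S f ->
  (forall x, 0 <= f x) ->
  S (iter n (Jr l) f) /\ forall x, 0 <= iter n (Jr l) f x.
Proof.
move=> l0 fl fs; elim: n => //= n [h1 h2].
split=> [|x]; first exact: good_S (Jr_good o hg hc l0) h1.
by rewrite (Jr_ge0 o hg hc).
Qed.

Lemma Sg_ge0 t f : 0 <= t -> S f -> (forall x, 0 <= f x) -> forall x, 0 <= Sg t f x.
Proof.
move=> t0 fl f0 x; have hX := @Xn_pt t f x t0 fl.
apply: (cvgr_to_ge hX); apply: nearW => k.
exact: (iter_Jr_ge0 (2 ^ k)%N (step_ge0 k t0) fl f0).2.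
Qed.

(** With u = J f and v = J g, both sides equal l Q(u, v) + <u, v>. *)
Lemma Jr_sym l f g : 0 <= l -> S f -> S g -> l2dot (Jr l f) g = l2dot f (Jr l g).
Proof.
rewrite le_eqVlt => /orP[/eqP <-|l0] fl gl; first by rewrite !Jr0.
have [u1 w1 h1] := JrP o hg hc l0 fl; have [u2 w2 h2] := JrP o hg hc l0 gl.
have fE (k : X -> R) : k = l *: (l^-1 *: (k - Jr l k)) + Jr l k.
  by rewrite scalerA divff ?gt_eqF// scale1r subrK.
have e1 := h1 _ u2; have e2 := h2 _ u1.
have ul := u1.2; have vl := u2.2; have Ef := fE f; have Eg := fE g.
move: (Jr l f) (Jr l g) (l^-1 *: (f - Jr l f)) (l^-1 *: (g - Jr l g))
  w1 w2 e1 e2 ul vl Ef Eg => u v wu wv wul wvl e1 e2 ul vl Ef Eg.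
rewrite Ef Eg [LHS]l2dotC (l2dotL l wvl vl ul) (l2dotL l wul ul vl).
by rewrite -e1 -e2 (Qsym b c) (l2dotC v).
Qed.

Lemma Xn_sym k t f g : 0 <= t -> S f -> S g ->
  l2dot (Xn Jr k t f) g = l2dot f (Xn Jr k t g).
Proof.
move=> t0 fl gl; rewrite /Xn; have l0 := step_ge0 k t0.
have JS h : S h -> S (Jr (t / 2 ^+ k) h) by exact: good_S (Jr_good o hg hc l0).
have Js h h' : S h -> S h' -> l2dot (Jr (t / 2 ^+ k) h) h' = l2dot h (Jr (t / 2 ^+ k) h').
  exact: Jr_sym.
move: (Jr _) JS Js => B BS Bs.
elim: (2 ^ k)%N f g fl gl => // n IH f g fl gl.
have Sn : S (iter n B g) by elim: n {IH} => //= n; exact: BS.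
by rewrite iterSr; exact: etrans (IH _ _ (BS _ fl) gl) (Bs _ _ fl Sn).
Qed.

Lemma Sg_sym t f g : 0 <= t -> S f -> S g -> l2dot (Sg t f) g = l2dot f (Sg t g).
Proof.
move=> t0 fl gl.
have [s1 c1] := Sg_cvN o hg hc t0 fl; have [s2 c2] := Sg_cvN o hg hc t0 gl.
have sX k h : S h -> S (Xn Jr k t h).
  by move=> hl; apply: (good_S _ hl); apply: (Xn_good (Jr_good o hg hc)).
have K h h' v : S h -> S h' -> S v -> cvN N (fun k => Xn Jr k t h) v ->
    l2dot (Xn Jr k t h) h' @[k --> \oo] --> l2dot v h'.
  move=> hl h'l vl cv; apply/cvgrPdist_le => e e0.
  have n1 : 0 < N h' + 1 by rewrite ltr_wpDl// l2norm_ge0.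
  move/cvgrPdist_le : cv => /(_ _ (divr_gt0 e0 n1)).
  apply: filterS => k; rewrite sub0r normrN ger0_norm ?l2norm_ge0//.
  rewrite ler_pdivlMr// => hk.
  rewrite -l2dotB//; last exact: sX.
  apply: le_trans (l2_CS (l2B vl (sX k h hl)) h'l) _.
  apply: le_trans hk; rewrite (NC l2L (@l2normZ R X) vl (sX k h hl)).
  by rewrite ler_wpM2l ?l2norm_ge0// lerDl.
have h1 := K f g _ fl gl s1 c1.
have h2 := K g f _ gl fl s2 c2.
rewrite [RHS]l2dotC; apply: (cvg_unique _ h1); first exact: Rhausdorff.
rewrite (funext (fun k => Xn_sym k t0 fl gl)).
by rewrite (funext (fun k => l2dotC f _)).
Qed.

Definition hk (t : R) (x y : X) : R := Sg t (ind1 y) x.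

Lemma hk_ge0 t x y : 0 <= t -> 0 <= hk t x y.
Proof. by move=> t0; apply: Sg_ge0 => //; exact: l2_ind1. Qed.

Lemma hk_sym t x y : 0 <= t -> hk t x y = hk t y x.
Proof.
move=> t0; rewrite /hk -[LHS](l2dot_ind1 _ x) -[RHS](l2dot_ind1 _ y).
have E := Sg_sym t0 (l2_ind1 y) (l2_ind1 x).
exact: (etrans E (l2dotC _ _)).
Qed.

Lemma hk_Sg t x : 0 <= t -> hk t x = Sg t (ind1 x).
Proof. by move=> t0; apply/funext => y; rewrite (hk_sym x y t0). Qed.

Lemma Sg_hk t f x : 0 <= t -> S f -> Sg t f x = l2dot (hk t x) f.
Proof.
move=> t0 fl; rewrite (hk_Sg x t0) -[LHS](l2dot_ind1 _ x).
have E := Sg_sym t0 fl (l2_ind1 x).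
exact: (etrans E (l2dotC _ _)).
Qed.

Lemma hk_l2 t x : 0 <= t -> S (hk t x).
Proof.
move=> t0; rewrite (hk_Sg x t0).
by apply: Sg_S => //; exact: l2_ind1.
Qed.

Lemma Sg_hk_esum t f x : 0 <= t -> S f -> (forall y, 0 <= f y) ->
  ((Sg t f x)%:E = \esum_(y in [set: X]) (hk t x y * f y)%:E)%E.
Proof.
move=> t0 fl f0; rewrite Sg_hk// rsum_EFin//.
  by move=> y; rewrite mulr_ge0// hk_ge0.
have := wfin_summ one_ge0 ((l2_wfin _).1 (hk_l2 x t0)) ((l2_wfin _).1 fl).
by congr summ; apply/funext => y; rewrite mul1r.
Qed.

Lemma hk_add r t x y : 0 <= r -> 0 <= t ->
  ((hk (r + t) x y)%:E = \esum_(z in [set: X]) (hk r x z * hk t z y)%:E)%E.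
Proof.
move=> r0 t0; rewrite /hk SgD//; last exact: l2_ind1.
rewrite Sg_hk_esum//; first by apply: Sg_S => //; exact: l2_ind1.
by move=> z; exact: hk_ge0.
Qed.

Lemma hk_add_ge r t x y z : 0 <= r -> 0 <= t -> hk r x z * hk t z y <= hk (r + t) x y.
Proof.
move=> r0 t0; rewrite -lee_fin hk_add//.
apply: (@esum_ge1 _ _ (fun z => (hk r x z * hk t z y)%:E)) => w.
by rewrite lee_fin mulr_ge0// hk_ge0.
Qed.

Lemma Sg_pt_lip f g r t x : A f g -> 0 <= r -> 0 <= t ->
  `|Sg r f x - Sg t f x| <= `|r - t| * N g.
Proof.
move=> hA; have fl : S f by have [[]] := hA.
wlog rt : r t / r <= t.
  move=> H r0 t0; have [rt|/ltW tr] := leP r t; first exact: H.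
  by rewrite distrC [`|r - t|]distrC; exact: H.
move=> r0 t0; have d0 : 0 <= t - r by rewrite subr_ge0.
have -> : Sg t f = Sg r (Sg (t - r) f).
  have E := SgD o hg hc r0 d0 fl; rewrite addrCA subrr addr0 in E.
  exact: E.
have s1 := Sg_S o hg hc d0 fl.
rewrite distrC.
apply: le_trans (l2_pt x (l2B (Sg_S o hg hc r0 s1) (Sg_S o hg hc r0 fl))) _.
rewrite -(goodB (Sg_good o hg hc r0))//.
apply: le_trans (Sg_N o hg hc r0 (l2B s1 fl)) _.
rewrite [`|r - t|]distrC ger0_norm//.
exact: (Sg_lip hg hc d0 hA).
Qed.

Lemma hk_lip r t x y : 0 <= r -> 0 <= t ->
  `|hk r x y - hk t x y| <= `|r - t| * N (Lind b c y).
Proof. exact: Sg_pt_lip (opL_ind1 o hg y). Qed.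

Lemma hk0 x y : hk 0 x y = ind1 y x.
Proof. by rewrite /hk Sg0//; exact: l2_ind1. Qed.

(** The kernel starts at 1 on the diagonal and is Lipschitz in time, so it is positive for a short
    time; the semigroup law then bounds it below by a power of a positive number. *)
Lemma hk_diag_gt0 t x : 0 <= t -> 0 < hk t x x.
Proof.
move=> t0; have n1 : 0 < N (Lind b c x) + 1 by rewrite ltr_wpDl// l2norm_ge0.
(* Large enough that during the time t / (n + 1) the kernel drops by less than 1. *)
pose n := Num.bound (t * (N (Lind b c x) + 1)).
have B0 : 0 <= t * (N (Lind b c x) + 1) by rewrite mulr_ge0// ltW.
have hn : t * (N (Lind b c x) + 1) < n.+1%:R.
  by apply: lt_trans (archi_boundP B0) _; rewrite ltr_nat.
have s0 : 0 <= t / n.+1%:R by rewrite divr_ge0.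
have sp : 0 < hk (t / n.+1%:R) x x.
  have := hk_lip x x (lexx 0) s0; rewrite hk0 ind1_eq sub0r normrN (ger0_norm s0).
  have : t / n.+1%:R * N (Lind b c x) < 1.
    rewrite mulrAC ltr_pdivrMr// mul1r; apply: le_lt_trans hn.
    by rewrite ler_wpM2l// lerDl.
  move=> h1 /(le_trans (ler_norm _)) h2; have := le_lt_trans h2 h1.
  by rewrite ltrBlDr ltrDl.
have -> : t = n.+1%:R * (t / n.+1%:R) by rewrite mulrC divfK.
move: (t / _) s0 sp => s s0 sp; elim: n.+1 => [|m IH].
  by rewrite mul0r hk0 ind1_eq.
rewrite -natr1 mulrDl mul1r.
have m0 : 0 <= m%:R * s by exact: mulr_ge0.
exact: lt_le_trans (mulr_gt0 IH sp) (hk_add_ge x x x m0 s0).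
Qed.

(** Off the diagonal the kernel vanishes at time 0 with derivative b x y, so it is at least t b x y
    / 2 for small times. *)
Lemma hk_edge_gt0 x y : 0 < b x y ->
  exists2 d, 0 < d & forall t, 0 < t -> t <= d -> 0 < hk t x y.
Proof.
move=> bxy; have b2 : 0 < b x y / 2 by rewrite divr_gt0.
have [d d0 hd] := Sg_derive hg hc (opL_ind1 o hg y) b2.
exists d => // t t0 td; have := hd t t0 td.
have l1 := @l2_ind1 R X y.
have lL : S (Lind b c y) by have [] := opL_ind1 o hg y.
have sv := l2D (l2B (Sg_S o hg hc (ltW t0) l1) l1) (l2Z t lL).
move=> /(le_trans (l2_pt x sv)).
rewrite -[(_ - _ + _) x]/(hk t x y - ind1 y x + t * (degree b c y * ind1 y x - b y x)).
have xy : x != y by apply: contraTneq bxy => ->; rewrite (graph_b_diag hg) ltxx.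
rewrite ind1_ne// (graph_b_sym hg y) mulr0 subr0 sub0r mulrN.
rewrite ler_norml => /andP[h _]; have : 0 < t * b x y by rewrite mulr_gt0.
have : t * (b x y / 2) = t * b x y / 2 by ring.
lra.
Qed.

(** A path is followed with a short time on each edge, and the remaining time is spent on the
    diagonal at its end. *)
Lemma hk_gt0 t x y : 0 < t -> 0 < hk t x y.
Proof.
have [p []] := hc x y; elim: p x t => [|z p IH] x t /=.
  by move=> _ -> /ltW; exact: hk_diag_gt0.
move=> /andP[bxz pz] lz t0.
have [d d0 hd] := hk_edge_gt0 bxz.
pose s := Num.min d (t / 2).
have s0 : 0 < s by rewrite lt_min d0 divr_gt0.
have sd : s <= d by rewrite ge_min lexx.
have st : s <= t / 2 by rewrite ge_min lexx orbT.
have ts : 0 < t - s by lra.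
have -> : t = s + (t - s) by rewrite addrCA subrr addr0.
apply: lt_le_trans (hk_add_ge x y z (ltW s0) (ltW ts)).
by apply: mulr_gt0; [exact: hd|exact: IH].
Qed.

Lemma heat_hk t x y : 0 <= t -> heat b c o t (ind1 y) x = hk t x y.
Proof. by move=> t0; rewrite heatE//; exact: l2_ind1. Qed.

Definition Pt (t : R) (H : X -> \bar R) (x : X) : \bar R :=
  (\esum_(y in [set: X]) ((hk t x y)%:E * H y))%E.

Lemma heat_extE t H x : 0 <= t -> heat_ext b c o t H x = Pt t H x.
Proof. by move=> t0; apply: eq_esum => y _; rewrite heat_hk. Qed.

Lemma Pt_ge0 t H x : 0 <= t -> (forall y, 0 <= H y)%E -> (0 <= Pt t H x)%E.
Proof.
by move=> t0 H0; apply: esum_neqNy => y; rewrite mule_ge0// lee_fin hk_ge0.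
Qed.

(** [s] need not lie in l2: it is cut to finite sets, where [Sg_between] applies, and the supremum
    is taken. *)
Lemma Pt_superharmonic s t x : supersol b c 0 s -> 0 <= t ->
  (Pt t (fun y => (s y)%:E) x <= (s x)%:E)%E.
Proof.
move=> hs t0; have [s0 _ _] := hs; apply: esum_le_seq => q uq.
have fq := fs_restr q s; have lq := fs_l2 fq.
have rq y : 0 <= restr q s y <= s y.
  by rewrite /restr; case: ifP => _; rewrite ?s0 ?lexx.
have := Sg_between hs t0 lq rq x => /andP[_]; rewrite Sg_hk// -lee_fin.
apply: le_trans; rewrite /l2dot.
have -> : (fun y => hk t x y * restr q s y) = restr q (fun y => hk t x y * s y).
  by apply/funext => y; rewrite /restr; case: ifP => _ //; rewrite mulr0.
rewrite (rsum_restr _ uq).2 -sumEFin; apply: lee_sum => y _.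
by rewrite EFinM.
Qed.

Lemma Pt_add r t f x : 0 <= r -> 0 <= t -> (forall y, 0 <= f y) ->
  Pt (r + t) (EFin \o f) x = Pt r (Pt t (EFin \o f)) x.
Proof.
move=> r0 t0 f0; pose H := EFin \o f.
have H0 y : (0 <= H y)%E by rewrite lee_fin.
rewrite /Pt -/H.
have K z : ((hk r x z)%:E * Pt t H z = \esum_(y in [set: X])
    ((hk r x z)%:E * ((hk t z y)%:E * H y)))%E.
  rewrite esumZ ?hk_ge0// => y _; rewrite mule_ge0// lee_fin hk_ge0//.
rewrite [RHS](eq_esum (b := fun z => \esum_(y in [set: X])
    ((hk r x z)%:E * ((hk t z y)%:E * H y)))%E); last by move=> z _; exact: K.
rewrite (@esum_interchange _ _ _ (fun p => (hk r x p.1)%:E * ((hk t p.1 p.2)%:E * H p.2))%E);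
  last by move=> p; rewrite !mule_ge0// lee_fin hk_ge0.
apply: eq_esum => y _ /=.
have E := congr1 (fun q => (q * (f y)%:E)%E) (hk_add x y r0 t0).
rewrite /= in E; rewrite /H /=; apply: (etrans E).
have p0 z : (0 <= (hk r x z * hk t z y)%:E)%E by rewrite lee_fin mulr_ge0// hk_ge0.
rewrite muleC -(esumZ (f0 y) (fun z _ => p0 z)); apply: eq_esum => z _.
by rewrite -!EFinM; congr EFin; ring.
Qed.

End heat_kernel.

Lemma is_derive_quadratic {R : realType} (f : R -> R) (t l K d : R) : 0 < d ->
  (forall s, `|s - t| < d -> `|f s - f t - (s - t) * l| <= K * (s - t) ^+ 2) ->
  is_derive t 1 f l.
Proof.
move=> d0 H.
have cv : h^-1 *: (f (h *: 1 + t) - f t) @[h --> 0^'] --> l.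
  apply/cvgrPdist_le => e e0.
  have K1 : 0 < `|K| + 1 by rewrite ltr_wpDl.
  pose m := Num.min d (e / (`|K| + 1)).
  have m0 : 0 < m by rewrite lt_min d0 divr_gt0.
  exists m => //= h /=; rewrite sub0r normrN => hm h0.
  have hd : `|h| < d by apply: (lt_le_trans hm); rewrite ge_min lexx.
  have he : `|h| * (`|K| + 1) <= e.
    rewrite -ler_pdivlMr//; apply/ltW/(lt_le_trans hm).
    by rewrite ge_min lexx orbT.
  have := H (h + t); rewrite addrK => /(_ hd) hq.
  have hn : 0 < `|h| by rewrite normr_gt0.
  rewrite -(ler_pM2l hn) -normrM.
  have -> : h * (l - h^-1 *: (f (h *: 1 + t) - f t)) = - (f (h + t) - f t - h * l).
    rewrite -[h *: 1]/(h * 1) mulr1 -[h^-1 *: _]/(h^-1 * _).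
    by field.
  rewrite normrN; apply: (le_trans hq); rewrite -real_normK ?num_real// expr2.
  rewrite mulrCA ler_pM2l//; apply: le_trans he; rewrite [leRHS]mulrC ler_wpM2r//.
  by rewrite (le_trans (ler_norm K))// lerDl.
apply: DeriveDef; first exact: (cvgP _ cv).
by rewrite /derive; apply: cvg_lim cv; exact: Rhausdorff.
Qed.

Lemma lip_continuous {R : realType} (f : R -> R) (K : R) :
  (forall s t, `|f s - f t| <= `|s - t| * K) -> continuous f.
Proof.
move=> H t; apply/cvgrPdist_le => e e0.
have K1 : 0 < `|K| + 1 by rewrite ltr_wpDl.
exists (e / (`|K| + 1)); first by rewrite /= divr_gt0.
move=> s /= hs; apply: (le_trans (H t s)).
have : `|t - s| * (`|K| + 1) <= e by rewrite -ler_pdivlMr// ltW.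
apply: le_trans; rewrite ler_wpM2l//.
by rewrite (le_trans (ler_norm K))// lerDl.
Qed.

(** * The Green function as a time integral *)

Section pos.
Context {R : realType}.
Implicit Types s t : R.

(* Clamping time at 0 makes the heat kernel a total continuous function. *)
Definition pos t : R := Num.max t 0.

Lemma pos_ge0 t : 0 <= pos t. Proof. by rewrite le_max lexx orbT. Qed.
Lemma posE t : 0 <= t -> pos t = t. Proof. by move=> t0; rewrite /pos max_l. Qed.

Lemma pos_lip s t : `|pos s - pos t| <= `|s - t|.
Proof.
have := ler_norm (s - t); have := ler_norm (t - s); rewrite (distrC t) => h1 h2.
rewrite ler_norml /pos /Num.max.
by do ![case: ifPn]; rewrite -?leNgt => *; apply/andP; split; lra.
Qed.

End pos.

(** * Laplace transform of the heat kernel *)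

Section time.
Context {R : realType} {X : countType}.
Variables (b : X -> X -> R) (c : X -> R) (o : X).
Hypothesis hg : is_graph b c.
Hypothesis hc : connected_graph b.
Local Notation N := (@l2norm R X).
Local Notation A := (opL b c o).
Local Notation Sg := (Sg b c o).
Local Notation hk := (hk b c o).

(** Two-sided in time, as a derivative at interior times requires. The constant 3 is 2 from [Sg_est]
    plus, when s < t, 1 from moving the derivative from time s to time t. *)
Lemma Sg_quadratic f g k (s t : R) (x : X) : A f g -> A g k -> 0 <= s -> 0 <= t ->
  `|Sg s f x - Sg t f x - (s - t) * - Sg t g x| <= 3 * N k * (s - t) ^+ 2.
Proof.
move=> hf hk' s0 t0.
have fl : l2 f by have [[]] := hf.
have gl : l2 g by have [] := hf.
have Nk := l2norm_ge0 k.
have Sl u r : 0 <= r -> l2 u -> l2 (Sg r u) by move=> ? ?; exact: Sg_S.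
have [st|/ltW ts] := leP t s.
  pose h := s - t; have h0 : 0 <= h by rewrite subr_ge0.
  have hl : l2 (Sg h f - f) by exact: (l2B (Sl _ _ h0 fl) fl).
  have el : l2 (Sg h f - f + h *: g) by exact: (l2D hl (l2Z h gl)).
  have gt := Sg_good o hg hc t0.
  have E : Sg t (Sg h f - f + h *: g) = Sg s f - Sg t f + h *: Sg t g.
    have E1 := goodD gt hl (l2Z h gl).
    have E2 := goodB gt (Sl _ _ h0 fl) fl.
    have E3 := goodZ l20 h gt gl.
    have E4 := SgD o hg hc t0 h0 fl.
    rewrite /h addrCA subrr addr0 -/h in E4.
    by rewrite E1 E2 E3 -E4.
  have -> : Sg s f x - Sg t f x - (s - t) * - Sg t g x =
      (Sg s f - Sg t f + h *: Sg t g) x.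
    rewrite -[RHS]/(Sg s f x - Sg t f x + (s - t) * Sg t g x).
    by move: (Sg s f x) (Sg t f x) (Sg t g x) => *; ring.
  rewrite -E.
  apply: le_trans (l2_pt x (Sl _ _ t0 el)) _.
  apply: le_trans (Sg_N o hg hc t0 el) _.
  apply: le_trans (Sg_est hg hc h0 hf hk') _.
  by rewrite -/h; have := mulr_ge0 (sqr_ge0 h) Nk; move: (N k) => *; lra.
pose h := t - s; have h0 : 0 <= h by rewrite subr_ge0.
have hl : l2 (Sg h f - f) by exact: (l2B (Sl _ _ h0 fl) fl).
have e1 : l2 (Sg h f - f + h *: g) by exact: (l2D hl (l2Z h gl)).
have hgl : l2 (Sg h g - g) by exact: (l2B (Sl _ _ h0 gl) gl).
have e2 : l2 (- h *: (Sg h g - g)) by exact: l2Z.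
have el := l2B e2 e1.
have gt := Sg_good o hg hc s0.
have E : Sg s (- h *: (Sg h g - g) - (Sg h f - f + h *: g)) =
    - h *: (Sg t g - Sg s g) - (Sg t f - Sg s f + h *: Sg s g).
  have E4 := SgD o hg hc s0 h0 fl; have E5 := SgD o hg hc s0 h0 gl.
  rewrite /h addrCA subrr addr0 -/h in E4 E5.
  apply: (etrans (goodB gt e2 e1)); congr (_ - _).
    apply: (etrans (goodZ l20 (- h) gt hgl)); congr (_ *: _).
    by rewrite (goodB gt (Sl _ _ h0 gl) gl) -E5.
  apply: (etrans (goodD gt hl (l2Z h gl))); congr (_ + _).
    by rewrite (goodB gt (Sl _ _ h0 fl) fl) -E4.
  exact: (goodZ l20 h gt gl).
have -> : Sg s f x - Sg t f x - (s - t) * - Sg t g x =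
    (- h *: (Sg t g - Sg s g) - (Sg t f - Sg s f + h *: Sg s g)) x.
  rewrite -[RHS]/(- (t - s) * (Sg t g x - Sg s g x) -
     (Sg t f x - Sg s f x + (t - s) * Sg s g x)).
  by move: (Sg s f x) (Sg t f x) (Sg t g x) (Sg s g x) => *; ring.
rewrite -E.
apply: le_trans (l2_pt x (Sl _ _ s0 el)) _.
apply: le_trans (Sg_N o hg hc s0 el) _.
apply: le_trans (NB l20 l2L (@l2_triangle R X) (@l2normZ R X) e2 e1) _.
have h1 := Sg_est hg hc h0 hf hk'; have h2 := ler_wpM2l h0 (Sg_lip hg hc h0 hk').
rewrite (l2normZ (- h) hgl) normrN (ger0_norm h0).
have -> : (s - t) ^+ 2 = h ^+ 2 by rewrite /h -sqrrN opprB.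
move: h1 h2; move: (N (Sg h g - g)) (N (Sg h f - f + h *: g)) (N k) => p q r.
by move=> *; lra.
Qed.

Lemma hk_continuous x y : continuous (fun t => hk (pos t) x y).
Proof.
apply: (@lip_continuous _ _ (N (Lind b c y))) => s t.
apply: le_trans (hk_lip o hg hc x y (pos_ge0 s) (pos_ge0 t)) _.
by rewrite ler_wpM2r ?l2norm_ge0// pos_lip.
Qed.

Section laplace.
Variable a : R.
Hypothesis a0 : 0 < a.

Definition resk (y : X) : X -> R := killed_sol b c a (ind1 y).

Lemma resk_opL y : A (resk y) (ind1 y - a *: resk y).
Proof.
exact: (killed_sol_opL o hg hc a0 (ind1_ge0 y) (l2_ind1 y)).
Qed.

Lemma resk_l2 y : l2 (resk y). Proof. by have [[]] := resk_opL y. Qed.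

(** L applied to the resolvent kernel is 1_y minus a multiple of that kernel, and both are in the
    domain of L; [Sg_quadratic] needs this second application. *)
Lemma resk_opL2 y : exists k, A (ind1 y - a *: resk y) k.
Proof.
have := opL_L hg hc (- a) (resk_opL y) (opL_ind1 o hg y).
rewrite scaleNr addrC => h; eexists; exact: h.
Qed.

Lemma resk_ge0 y x : 0 <= resk y x.
Proof. exact: (killed_sol_ge0 hg a0 (ind1_ge0 y) (l2_ind1 y)). Qed.

(* [psi' = - ehk], so integrating [ehk] yields the resolvent kernel. *)
Definition psi x y t : R := expR (- a * t) * Sg (pos t) (resk y) x.

Lemma is_derive_psi x y (t : R) : 0 < t ->
  is_derive t (1 : R) (psi x y) (- (expR (- a * t) * hk (pos t) x y)).
Proof.
move=> t0; have [k hk'] := resk_opL2 y.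
have d1 : is_derive t 1 (fun t => Sg (pos t) (resk y) x)
    (- Sg t (ind1 y - a *: resk y) x).
  apply: (@is_derive_quadratic _ _ _ _ (3 * N k) t) => // s hs.
  have s0 : 0 <= s by move: hs; rewrite ltr_norml => /andP[? _]; lra.
  rewrite !posE ?(ltW t0)//.
  exact: (Sg_quadratic x (resk_opL y) hk' s0 (ltW t0)).
have d2 : is_derive t 1 (fun t => expR (- a * t)) (- a * expR (- a * t)).
  have dl : is_derive t (1 : R) (fun t => - a * t) (- a).
    apply: (@is_derive_quadratic _ _ _ _ 0 1) => // s _.
    have -> : - a * s - - a * t - (s - t) * - a = 0 by ring.
    by rewrite normr0 mul0r.
  rewrite mulrC; exact: (is_derive1_comp (is_derive_expR (- a * t)) dl).
have d3 := is_deriveM d2 d1.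
apply: (is_derive_eq d3).
have gt := Sg_good o hg hc (ltW t0).
have E : Sg t (ind1 y - a *: resk y) x = hk t x y - a * Sg t (resk y) x.
  rewrite (goodB gt (l2_ind1 y) (l2Z a (resk_l2 y))).
  by rewrite (goodZ l20 a gt (resk_l2 y)).
rewrite E posE ?(ltW t0)//.
rewrite -![_ *: _]/(_ * _); move: (hk _ _ _) (Sg _ _ _) => *; ring.
Qed.

Lemma resk_continuous x y : continuous (fun t => Sg (pos t) (resk y) x).
Proof.
apply: (@lip_continuous _ _ (N (ind1 y - a *: resk y))) => s t.
apply: le_trans (Sg_pt_lip hg hc x (resk_opL y) (pos_ge0 s) (pos_ge0 t)) _.
by rewrite ler_wpM2r ?l2norm_ge0// pos_lip.
Qed.

Lemma expRa_continuous : continuous (fun t : R => expR (- a * t)).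
Proof.
move=> t; apply: continuous_comp; last exact: continuous_expR.
by apply: cvgMr; exact: cvg_id.
Qed.

Lemma psi_continuous x y : continuous (fun t => - psi x y t).
Proof.
move=> t; apply: cvgN; apply: cvgM; first exact: expRa_continuous.
exact: resk_continuous.
Qed.

Definition ehk x y (t : R) : R := expR (- a * t) * hk (pos t) x y.

Lemma ehk_continuous x y : continuous (ehk x y).
Proof.
by move=> t; apply: cvgM; [exact: expRa_continuous|exact: hk_continuous].
Qed.

Lemma ehk_ge0 x y t : 0 <= ehk x y t.
Proof. by rewrite mulr_ge0 ?expR_ge0// hk_ge0// pos_ge0. Qed.

Lemma is_derive_Npsi x y (t : R) : 0 < t ->
  is_derive t (1 : R) (fun t => - psi x y t) (ehk x y t).
Proof.
move=> t0; have := is_deriveN (is_derive_psi x y t0).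
by rewrite opprK.
Qed.

Lemma psi0 x y : psi x y 0 = resk y x.
Proof.
rewrite /psi mulr0 expR0 mul1r posE// Sg0//; exact: resk_l2.
Qed.

Lemma integral_ehk x y (T : R) : 0 < T ->
  (\int[lebesgue_measure]_(t in `[0%R, T]) (ehk x y t)%:E
   = (resk y x)%:E - (psi x y T)%:E)%E.
Proof.
move=> T0; rewrite (@continuous_FTC2 _ _ (fun t => - psi x y t) _ _ T0).
- by rewrite psi0 -!EFinB opprK addrC.
- by apply: continuous_subspaceT; exact: ehk_continuous.
- split.
  + move=> t; rewrite in_itv/= => /andP[t0 _].
    by have [] := is_derive_Npsi x y t0.
  + by apply: cvg_at_right_filter; exact: psi_continuous.
  + by apply: cvg_at_left_filter; exact: psi_continuous.
- move=> t; rewrite in_itv/= => /andP[t0 _]; rewrite derive1E.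
  by have [_ ->] := is_derive_Npsi x y t0.
Qed.

Lemma psi_bound x y t : 0 <= t -> `|psi x y t| <= expR (- a * t) * N (resk y).
Proof.
move=> t0; rewrite normrM ger0_norm ?expR_ge0// ler_wpM2l ?expR_ge0//.
rewrite posE//.
apply: le_trans (l2_pt x (Sg_S o hg hc t0 (resk_l2 y))) _.
exact: (Sg_N o hg hc t0 (resk_l2 y)).
Qed.

Lemma psi_cvg0 x y : - psi x y t @[t --> +oo%R] --> (0 : R).
Proof.
rewrite -oppr0; apply: cvgN.
have e0 : expR (- a * t) * N (resk y) @[t --> +oo%R] --> (0 : R).
  rewrite -(mul0r (N (resk y))); apply: cvgMl.
  have h : a * t @[t --> +oo%R] --> +oo%R by apply: gt0_cvgMry => //; exact: cvg_id.
  have := @cvg_comp _ _ _ (fun t => a * t) (fun u => expR (- u)) _ _ _ h (@cvgr_expR R).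
  by apply: cvg_trans; apply: near_eq_cvg; apply: nearW => t; rewrite /= mulNr.
apply/cvgrPdist_le => e e1; move/cvgrPdist_le : e0 => /(_ e e1).
apply: filterS2 (nbhs_pinfty_ge (num_real (0 : R))) => t t0.
rewrite !sub0r !normrN [X in X <= _ -> _]ger0_norm ?mulr_ge0 ?expR_ge0 ?l2norm_ge0//.
by apply: le_trans; exact: psi_bound.
Qed.

Lemma integral_ehk_y x y :
  (\int[lebesgue_measure]_(t in `[0%R, +oo[) (ehk x y t)%:E = (resk y x)%:E)%E.
Proof.
rewrite (@ge0_continuous_FTC2y _ _ (fun t => - psi x y t) 0 0).
- by rewrite psi0 -EFinB opprK add0r.
- by move=> t _; exact: ehk_ge0.
- by apply: continuous_subspaceT; exact: ehk_continuous.
- exact: psi_cvg0.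
- by move=> t t0; have [] := is_derive_Npsi x y t0.
- by apply: cvg_at_right_filter; exact: psi_continuous.
- move=> t; rewrite in_itv/= andbT => t0; rewrite derive1E.
  by have [_ ->] := is_derive_Npsi x y t0.
Qed.

End laplace.
End time.

Lemma continuous_measurable_EFin {R : realType} (f : R -> R) (D : set R) :
  continuous f -> measurable_fun D (fun t => (f t)%:E).
Proof.
move=> cf; apply/measurable_EFinP/measurable_funTS.
exact: continuous_measurable_fun.
Qed.

(** * Letting the resolvent parameter tend to zero *)

Section green_integral.
Context {R : realType} {X : countType}.
Variables (b : X -> X -> R) (c : X -> R) (o : X).
Hypothesis hg : is_graph b c.
Hypothesis hc : connected_graph b.
Hypothesis hE : forall x, eval_bound b c x.
Local Notation G := (gfun b c).
Local Notation hk := (hk b c o).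
Local Notation Pt := (Pt b c o).
Local Notation resk := (resk b c).
Local Notation an := (fun n : nat => (n.+1%:R)^-1 : R).

Lemma resk_Lap (a : R) y x : 0 < a ->
  Lap b c (resk a y) x = ind1 y x - a * resk a y x.
Proof.
move=> a0; have := killed_sol_Lap hg a0 (ind1_ge0 y) (l2_ind1 y) x.
by rewrite killed_Lap => <-; rewrite addrK.
Qed.

Lemma resk_inF (a : R) y : 0 < a -> inF b (resk a y).
Proof.
move=> a0; apply: (fe_inF hg).
exact: (form_dom_fe (killed_D0 hg hc a0 (killed_sol_D0 o hg a0 (ind1_ge0 y) (l2_ind1 y)))).
Qed.

Lemma resk_le (a : R) y s : 0 < a -> (forall x, 0 <= s x) -> inF b s ->
  (forall x, ind1 y x <= Lap b c s x + a * s x) -> forall x, resk a y x <= s x.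
Proof.
move=> a0 s0 sF hs; apply: (killed_sol_min hg a0 (ind1_ge0 y) (l2_ind1 y)).
by split => // x; rewrite killed_Lap.
Qed.

Lemma resk_le_green (a : R) y x : 0 < a -> resk a y x <= G y x.
Proof.
move=> a0; apply: resk_le => //; [exact: gfun_ge0|exact: gfun_inF|move=> z].
by rewrite Lap_gfun// lerDl mulr_ge0 ?(ltW a0)// gfun_ge0.
Qed.

Lemma resk_mono (a a' : R) y x : 0 < a -> a <= a' -> resk a' y x <= resk a y x.
Proof.
move=> a0 aa; have a'0 := lt_le_trans a0 aa.
have r0 z : 0 <= resk a y z by exact: resk_ge0.
apply: resk_le => //; first exact: resk_inF.
by move=> z; rewrite resk_Lap// addrAC -addrA lerDl subr_ge0 ler_wpM2r.
Qed.

Lemma an_gt0 n : 0 < an n. Proof. exact: harm_gt0. Qed.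

Lemma an_mono m n : (m <= n)%N -> an n <= an m.
Proof. by move=> mn; rewrite lef_pV2 ?posrE// ler_nat ltnS. Qed.

(** The kernels increase as the parameter decreases and stay below G. Their limit F satisfies L F >=
    1_y, so minimality of G gives the reverse inequality. *)
Lemma resk_cvg y x : resk (an n) y x @[n --> \oo] --> G y x.
Proof.
have mono z : {homo (fun n => resk (an n) y z) : m n / (m <= n)%N >-> m <= n}.
  by move=> m n mn; apply: resk_mono; [exact: an_gt0|exact: an_mono].
have ub z : has_ubound (range (fun n => resk (an n) y z)).
  by exists (G y z) => _ [n _ <-]; apply: resk_le_green; exact: an_gt0.
have cv z := nondecreasing_is_cvgn (mono z) (ub z).
pose F z := lim (resk (an n) y z @[n --> \oo]).
have Fn n z : resk (an n) y z <= F z by apply: nondecreasing_cvgn_le.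
have r0 n z : 0 <= resk (an n) y z by apply: (resk_ge0 hg); exact: an_gt0.
have F0 z : 0 <= F z by exact: le_trans (r0 0%N z) (Fn 0%N z).
have FG z : F z <= G y z.
  apply: (cvgr_to_le (cv z)); apply: nearW => n.
  by apply: resk_le_green; exact: an_gt0.
have FF : inF b F.
  apply: (inF_le hg _ (gfun_inF hg hE y)) => z.
  by rewrite !ger0_norm// (le_trans (F0 z)).
suff -> : G y x = F x by exact: cv.
apply/eqP; rewrite eq_le FG andbT; apply: (gfun_min hg hE).
split => // z; rewrite (LapE hg)//.
have /(inFP hg)/(_ z) sF := FF.
have bF w : 0 <= b z w * F w by rewrite mulr_ge0// (graph_b_ge0 hg).
suff : rsum (fun w => b z w * F w) <= degree b c z * F z - ind1 y z by lra.
apply/ler_addgt0Pl => e e0; rewrite -lee_fin rsum_EFin//.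
have G1 : 0 < G y z + 1 by rewrite ltr_wpDl// (le_trans (F0 z)).
(* From [N] on, a_n (G y z + 1) <= e, which absorbs the zeroth-order term of the resolvent
   equation. *)
have /cvgrPdist_le/(_ _ (divr_gt0 e0 G1))[N _ HN] := @cvg_harmonic R.
apply: (@fatou_esum _ _ (fun n w => b z w * resk (an n) y w) _ _ N).
- by move=> n w; rewrite mulr_ge0// (graph_b_ge0 hg).
- by move=> w; apply: cvgMr; exact: cv.
move=> n Nn; have a0 := an_gt0 n.
have /(inFP hg)/(_ z) sf := resk_inF y a0.
rewrite -rsum_EFin// ?lee_fin; last first.
  by move=> w; rewrite mulr_ge0// (graph_b_ge0 hg).
have := resk_Lap y z a0; rewrite (LapE hg); last exact: resk_inF.
have h1 : degree b c z * resk (an n) y z <= degree b c z * F z.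
  by rewrite ler_wpM2l// ltW// (degree_gt0 hg hE).
have h2 : an n * resk (an n) y z <= e.
  apply: (@le_trans _ _ (an n * (G y z + 1))).
    rewrite ler_wpM2l ?(ltW a0)//.
    by apply: le_trans (le_trans (Fn n z) (FG z)) _; rewrite lerDl.
  rewrite -ler_pdivlMr//; have := HN n Nn.
  by rewrite sub0r normrN => /(le_trans (ler_norm _)).
move: h1 h2; move: (an n * _) (degree b c z * resk _ _ _) => p q; lra.
Qed.

Lemma expR_an_cvg (t : R) : expR (- an n * t) @[n --> \oo] --> (1 : R).
Proof.
have h : - an n * t @[n --> \oo] --> (0 : R).
  rewrite -(mul0r t) -oppr0; apply: cvgMl; apply: cvgN; exact: cvg_harmonic.
have := @cvg_comp _ _ _ (fun n => - an n * t) expR _ _ _ h (@continuous_expR R 0).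
by rewrite expR0.
Qed.

Lemma integral_ehk_cvg (D : set R) x y : measurable D -> (forall t, D t -> 0 <= t) ->
  (\int[lebesgue_measure]_(t in D) (ehk b c o (an n) x y t)%:E)%E @[n --> \oo]
    --> (\int[lebesgue_measure]_(t in D) (hk (pos t) x y)%:E)%E.
Proof.
move=> mD D0.
have := @cvg_monotone_convergence _ _ R lebesgue_measure D mD
  (fun n t => (ehk b c o (an n) x y t)%:E).
rewrite (_ : (\int[lebesgue_measure]_(t in D)
    limn ((fun n t => (ehk b c o (an n) x y t)%:E)^~ t))%E =
    (\int[lebesgue_measure]_(t in D) (hk (pos t) x y)%:E)%E).
  apply.
  - move=> n; apply: continuous_measurable_EFin.
    exact: ehk_continuous.
  - by move=> n t _; rewrite lee_fin; exact: ehk_ge0.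
  - move=> t Dt m n mn; rewrite lee_fin ler_wpM2r//.
      by apply: hk_ge0 => //; exact: pos_ge0.
    by rewrite ler_expR ler_wpM2r ?D0// lerN2; exact: an_mono.
apply: eq_integral => t _; apply: cvg_lim => //.
apply: cvg_EFin; first by apply: nearW.
rewrite -[X in _ --> X]mul1r; apply: cvgMl; exact: expR_an_cvg.
Qed.

Lemma integral_hk_y x y :
  (\int[lebesgue_measure]_(t in `[0%R, +oo[) (hk (pos t) x y)%:E = (G y x)%:E)%E.
Proof.
have h1 := @integral_ehk_cvg `[0%R, +oo[%classic x y (measurable_itv _) _.
have h2 : (\int[lebesgue_measure]_(t in `[0%R, +oo[) (ehk b c o (an n) x y t)%:E)%E
    @[n --> \oo] --> (G y x)%:E.
  rewrite (_ : (fun n => _) = (fun n => (resk (an n) y x)%:E)); last first.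
    by apply/funext => n; rewrite integral_ehk_y//; exact: an_gt0.
  by apply: cvg_EFin; [exact: nearW|exact: resk_cvg].
apply: (cvg_unique _ (h1 _) h2); first exact: ereal_hausdorff.
by move=> t /=; rewrite in_itv/= andbT.
Qed.

(** The finite-time formula [integral_ehk] is passed to the limit a -> 0. Fatou for the remainder at
    time [T] gives one inequality; domination of the resolvent kernels by G gives the other. *)
Lemma integral_hk x y (T : R) : 0 < T ->
  (\int[lebesgue_measure]_(t in `[0%R, T]) (hk (pos t) x y)%:E
    + Pt T (fun z => (G y z)%:E) x = (G y x)%:E)%E.
Proof.
move=> T0; have T0' := ltW T0.
have h1 : (\int[lebesgue_measure]_(t in `[0%R, T]) (ehk b c o (an n) x y t)%:E)%E
   @[n --> \oo] --> (\int[lebesgue_measure]_(t in `[0%R, T]) (hk (pos t) x y)%:E)%E.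
  by apply: integral_ehk_cvg => // t /=; rewrite in_itv/= => /andP[].
set I := (\int[lebesgue_measure]_(t in `[0%R, T]) (hk (pos t) x y)%:E)%E in h1 *.
pose B n := psi b c o (an n) x y T.
have hn n := integral_ehk o hg hc (an_gt0 n) x y T0.
have Be n : ((B n)%:E = \esum_(z in [set: X])
    (expR (- an n * T) * (hk T x z * resk (an n) y z))%:E)%E.
  have r0 z : 0 <= resk (an n) y z by apply: (resk_ge0 hg); exact: an_gt0.
  have hl : l2 (resk (an n) y) by apply: (resk_l2 o hg hc); exact: an_gt0.
  have E := Sg_hk_esum o hg hc x T0' hl r0.
  have p0 z : [set: X] z -> (0 <= (hk T x z * resk (an n) y z)%:E)%E.
    by move=> _; rewrite lee_fin mulr_ge0// hk_ge0.
  rewrite /B /psi posE// EFinM E -(esumZ (expR_ge0 _) p0).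
  by apply: eq_esum => z _; rewrite -EFinM.
have hk0' z : 0 <= hk T x z by exact: hk_ge0.
have G0 z : 0 <= G y z by exact: (gfun_ge0 hg hE).
have PT0 : (0 <= Pt T (fun z => (G y z)%:E) x)%E.
  by apply: Pt_ge0 => // z; rewrite lee_fin.
have I0 : (0 <= I)%E.
  by apply: integral_ge0 => t _; rewrite lee_fin hk_ge0// pos_ge0.
have An n : (\int[lebesgue_measure]_(t in `[0%R, T]) (ehk b c o (an n) x y t)%:E
    = (resk (an n) y x - B n)%:E)%E by rewrite hn EFinB.
rewrite (funext An) in h1.
(* Each side is an integral over [0, T] of an integrand that increases with the index. *)
have mono m n : (m <= n)%N -> resk (an m) y x - B m <= resk (an n) y x - B n.
  have key (I1 I2 : \bar R) (r1 r2 : R) : I1 = r1%:E -> I2 = r2%:E ->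
      (I1 <= I2)%E -> r1 <= r2 by move=> -> ->; rewrite lee_fin.
  move=> mn; apply: (key _ _ _ _ (An m) (An n)).
  apply: ge0_le_integral; first exact: measurable_itv.
  - by move=> t _; rewrite lee_fin; exact: ehk_ge0.
  - apply: continuous_measurable_EFin.
    exact: ehk_continuous.
  - apply: continuous_measurable_EFin.
    exact: ehk_continuous.
  - move=> t /=; rewrite in_itv/= => /andP[t0 _].
    rewrite lee_fin ler_wpM2r//; first by apply: hk_ge0 => //; exact: pos_ge0.
    by rewrite ler_expR ler_wpM2r// lerN2; exact: an_mono.
have PtG m : (Pt T (fun z => (G y z)%:E) x <= (G y x - (resk (an m) y x - B m))%:E)%E.
  rewrite /Pt; under eq_esum do rewrite -EFinM.
  apply: (@fatou_esum _ _ (fun n z => expR (- an n * T) * (hk T x z * resk (an n) y z))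
     _ _ m).
  - move=> n z; rewrite !mulr_ge0 ?expR_ge0//.
    by apply: (resk_ge0 hg); exact: an_gt0.
  - move=> z; rewrite -[X in _ --> X]mul1r; apply: cvgM; first exact: expR_an_cvg.
    by apply: cvgMr; exact: resk_cvg.
  - move=> n mn; rewrite -Be lee_fin.
    have aux (p q r s u : R) : p - q <= r - s -> r <= u -> s <= u - (p - q) by lra.
    exact: aux (mono _ _ mn) (resk_le_green y x (an_gt0 n)).
have PGfin : Pt T (fun z => (G y z)%:E) x \is a fin_num.
  by rewrite ge0_fin_numE//; apply: le_lt_trans (PtG 0%N) _; exact: ltry.
apply/eqP; rewrite eq_le; apply/andP; split.
  rewrite -leeBrDr//; apply: (cvge_to_le h1); apply: nearW => n.
  have := PtG n; rewrite -(fineK PGfin) -EFinB !lee_fin.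
  by move: (fine _) (resk _ _ _ - _) => p q; lra.
have G1 : (resk (an n) y x)%:E @[n --> \oo] --> (G y x)%:E.
  by apply: cvg_EFin; [exact: nearW|exact: resk_cvg].
apply: (cvge_to_le G1); apply: nearW => n.
have -> : (resk (an n) y x)%:E = ((resk (an n) y x - B n)%:E + (B n)%:E)%E.
  by rewrite -EFinD subrK.
clear hn An; clearbody B I; apply: leeD.
  apply: (cvge_to_ge h1); exists n => // m /= nm.
  by rewrite lee_fin mono.
rewrite Be /Pt; apply: le_esum => z _; rewrite -EFinM lee_fin.
have r0 : 0 <= resk (an n) y z by apply: (resk_ge0 hg); exact: an_gt0.
apply: (@le_trans _ _ (hk T x z * resk (an n) y z)).
  rewrite ler_piMl ?mulr_ge0// -expR0 ler_expR mulNr oppr_le0.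
  by rewrite mulr_ge0// ltW// an_gt0.
by rewrite ler_wpM2l// resk_le_green// an_gt0.
Qed.

End green_integral.

(** * Potential theory *)

Section potential_theory.
Context {R : realType} {X : countType}.
Variables (b : X -> X -> R) (c : X -> R).
Hypothesis hg : is_graph b c.
Hypothesis hc : connected_graph b.
Implicit Types (k s u v : X -> R).

(** [superharmonic_edge] is chained along a path; the constant does not depend on [s]. *)
Lemma harnack x y : exists2 C, 0 <= C & forall s, supersol b c 0 s -> s y <= C * s x.
Proof.
have [p []] := hc x y; elim: p x => [|z p IH] x /=.
  by move=> _ ->; exists 1 => // s _; rewrite mul1r.
move=> /andP[bxz pz] lz; have [C C0 H] := IH z pz lz.
exists (C * (`|degree b c x| / b x z)).
  by rewrite mulr_ge0// divr_ge0// ltW.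
move=> s hs; have [s0 _ _] := hs; apply: le_trans (H s hs) _.
rewrite -mulrA ler_wpM2l// mulrAC ler_pdivlMr// mulrC.
apply: le_trans (superharmonic_edge hg x z hs) _.
by rewrite ler_wpM2r// ler_norm.
Qed.

Hypothesis hE : forall x, eval_bound b c x.
Local Notation G := (gfun b c).

Lemma gfun_supersol y : supersol b c 0 (G y).
Proof.
split; [exact: gfun_ge0|exact: gfun_inF|move=> x].
by rewrite Lap_gfun//; exact: ind1_ge0.
Qed.

(** Induction on the poles: minimality of G y gives k y * G y <= s, so subtracting this term leaves
    a non-negative supersolution for [k] with its entry at [y] erased. *)
Lemma green_seq_min (q : seq X) k s x : uniq q -> (forall y, 0 <= k y) ->
  supersol b c k s -> \sum_(y <- q) G y x * k y <= s x.
Proof.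
elim: q k s => [|y q IH] k s /=.
  by move=> _ _ [s0 _ _]; rewrite big_nil.
move=> /andP[yq uq] k0 [s0 sF sk].
have Gy0 z : 0 <= G y z by exact: gfun_ge0.
have le1 z : k y * G y z <= s z.
  have := k0 y; rewrite le_eqVlt => /orP[/eqP <-|ky]; first by rewrite mul0r.
  have ey : (k y)^-1 *: s + 0 = (k y)^-1 *: s by rewrite addr0.
  have hs : supersol b c (ind1 y) ((k y)^-1 *: s).
    split=> [w||w].
    - by rewrite mulr_ge0// invr_ge0 ltW.
    - by rewrite -ey; apply: (inFL hg) => //; exact: (inF0 hg).
    - rewrite -ey (LapL hg)//; last exact: (inF0 hg).
      have -> : Lap b c (0 : X -> R) w = 0 by have := Lap_const b c 0 w; rewrite mulr0.
      rewrite addr0 ler_pdivlMl//; apply: le_trans (sk w).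
      have [->|wy] := eqVneq w y; first by rewrite ind1_eq mulr1.
      by rewrite ind1_ne// mulr0.
  have := gfun_min hg hE hs z; rewrite -[((_ *: s) z)]/((k y)^-1 * s z).
  by rewrite ler_pdivlMl.
pose k' z := k z - k y * ind1 y z; pose s' := (- k y) *: G y + s.
have hs' : supersol b c k' s'.
  split=> [z||z].
  - by rewrite -[s' z]/(- k y * G y z + s z) addrC mulNr subr_ge0.
  - by apply: (inFL hg) => //; exact: gfun_inF.
  - rewrite (LapL hg)//; last exact: gfun_inF.
    by rewrite (Lap_gfun hg hE) /k' mulNr addrC lerD2l.
have k'0 z : 0 <= k' z.
  rewrite /k'; have [->|zy] := eqVneq z y; first by rewrite ind1_eq mulr1 subrr.
  by rewrite ind1_ne// mulr0 subr0.
have := IH k' s' uq k'0 hs'; rewrite big_cons.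
have -> : \sum_(z <- q) G z x * k' z = \sum_(z <- q) G z x * k z.
  rewrite big_seq [RHS]big_seq; apply: eq_bigr => z zq.
  by rewrite /k' ind1_ne ?mulr0 ?subr0//; apply: contraNneq yq => <-.
by rewrite -[s' x]/(- k y * G y x + s x) mulNr; move: (\sum_(_ <- _) _) => S; lra.
Qed.

Lemma green_sum_min k s x : (forall y, 0 <= k y) -> supersol b c k s ->
  (\esum_(y in [set: X]) (G y x * k y)%:E <= (s x)%:E)%E.
Proof.
move=> k0 hs; apply: esum_le_seq => q uq; rewrite sumEFin lee_fin.
exact: green_seq_min.
Qed.

(** L is applied under the sum by Tonelli. The equation is written without subtraction, as sum plus
    [k] equals [degree] times [u], so finiteness of the sum, hence membership in F, falls out of
    it. *)
Lemma green_sum_Lap k u : (forall y, 0 <= k y) ->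
  (forall x, (u x)%:E = \esum_(y in [set: X]) (G y x * k y)%:E)%E ->
  [/\ forall x, 0 <= u x, inF b u & forall x, Lap b c u x = k x].
Proof.
move=> k0 hu.
have G0 y x : 0 <= G y x by exact: gfun_ge0.
have b0 := graph_b_ge0 hg.
have u0 x : 0 <= u x.
  by rewrite -lee_fin hu esum_neqNy// => y; rewrite lee_fin mulr_ge0.
have key x : ((\esum_(z in [set: X]) (b x z * u z)%:E) + (k x)%:E
    = (degree b c x * u x)%:E)%E.
  have E1 : (\esum_(z in [set: X]) (b x z * u z)%:E = \esum_(z in [set: X])
      \esum_(y in [set: X]) (b x z * (G y z * k y))%:E)%E.
    apply: eq_esum => z _; rewrite EFinM hu -esumZ//.
    by move=> y _; rewrite lee_fin mulr_ge0.
  rewrite E1 (@esum_interchange _ _ _ (fun p => (b x p.1 * (G p.2 p.1 * k p.2))%:E));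
    last by move=> p; rewrite lee_fin !mulr_ge0.
  have E2 y : (\esum_(z in [set: X]) (b x z * (G y z * k y))%:E =
      ((degree b c x * G y x - ind1 y x) * k y)%:E)%E.
    have /(inFP hg)/(_ x) sG := gfun_inF hg hE y.
    have p0 z : 0 <= b x z * G y z by rewrite mulr_ge0.
    have e : rsum (fun z => b x z * G y z) = degree b c x * G y x - ind1 y x.
      rewrite -(Lap_gfun hg hE y x) (LapE hg); last exact: gfun_inF.
      by rewrite opprB addrCA subrr addr0.
    rewrite -e mulrC EFinM rsum_EFin// -esumZ//; last by move=> z _; rewrite lee_fin.
    by apply: eq_esum => z _; rewrite -EFinM; congr EFin; ring.
  rewrite [Z in (Z + _)%E](_ : _ = \esum_(y in [set: X])
      ((degree b c x * G y x - ind1 y x) * k y)%:E)%E; last first.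
    by apply: eq_esum => y _; exact: E2.
  have E3 : ((k x)%:E = \esum_(y in [set: X]) (ind1 y x * k y)%:E)%E.
    rewrite (@esum_single _ _ _ x).
    - by rewrite ind1_eq mul1r.
    - by move=> y yx; rewrite ind1_ne ?mul0r// eq_sym.
    - by rewrite lee_fin mulr_ge0// ind1_ge0.
  rewrite E3 -esumD; first last.
  - by move=> y _; rewrite lee_fin mulr_ge0// ind1_ge0.
  - move=> y _; rewrite lee_fin mulr_ge0//.
    rewrite -(Lap_gfun hg hE y x) (LapE hg); last exact: gfun_inF.
    rewrite opprB addrCA subrr addr0 ge0_rsum// => z; exact: mulr_ge0.
  rewrite EFinM hu -esumZ; first last.
  - by move=> y _; rewrite lee_fin mulr_ge0.
  - exact/ltW/(degree_gt0 hg hE).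
  by apply: eq_esum => y _; rewrite -EFinD -EFinM; congr EFin; ring.
have fin x : (\esum_(z in [set: X]) (b x z * u z)%:E < +oo)%E.
  rewrite ltNge leye_eq; apply/eqP => e; have := key x.
  by rewrite e addye.
have uF : inF b u.
  by move=> x; under eq_esum do rewrite ger0_norm//; exact: fin.
split => // x; rewrite (LapE hg)//.
have /(inFP hg)/(_ x) sU := uF.
have := key x; rewrite -rsum_EFin//; last by move=> z; rewrite mulr_ge0.
by rewrite -EFinD => -[<-]; rewrite addrC addKr.
Qed.

End potential_theory.

(** * Symmetry of the Green function *)

Section green_symmetry.
Context {R : realType} {X : countType}.
Variables (b : X -> X -> R) (c : X -> R) (o : X).
Hypothesis hg : is_graph b c.
Hypothesis hc : connected_graph b.

(** Each of the two kernels is tested in the weak equation of the other; the form is symmetric. *)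
Lemma resk_sym (a : R) x y : 0 < a -> resk b c a y x = resk b c a x y.
Proof.
move=> a0.
have D z := killed_sol_D0 o hg a0 (ind1_ge0 z) (l2_ind1 z).
have L z := killed_sol_Lap hg a0 (ind1_ge0 z) (l2_ind1 z).
have W z w := killed_weak hg hc a0 (D z) (L z) (l2_ind1 z) (killed_D0 hg hc a0 (D w)).
have := W x y; have := W y x; rewrite (Qsym b _ (killed_sol b c a (ind1 x))).
move=> -> e; rewrite /resk -(l2dot_ind1 (killed_sol _ _ _ (ind1 y)) x).
rewrite -(l2dot_ind1 (killed_sol _ _ _ (ind1 x)) y).
by rewrite l2dotC -e l2dotC.
Qed.

Lemma gfun_sym x y : (forall x, eval_bound b c x) -> gfun b c y x = gfun b c x y.
Proof.
move=> hE; have h1 := @resk_cvg R X b c o hg hc hE y x; have h2 := @resk_cvg R X b c o hg hc hE x y.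
have <- := cvg_lim (@Rhausdorff R) h1; have <- := cvg_lim (@Rhausdorff R) h2.
by under eq_fun do rewrite resk_sym ?harm_gt0//.
Qed.

End green_symmetry.

(** * Non-constant superharmonic functions force transience *)

Section recurrence.
Context {R : realType} {X : countType}.
Variables (b : X -> X -> R) (o : X).
Local Notation c0 := (fun _ : X => 0 : R).
Hypothesis hg : is_graph b c0.
Hypothesis hc : connected_graph b.

(** Where s <= m, truncation only lowers the neighbouring values; elsewhere the truncated function
    sits at its maximum. *)
Lemma supersol_min s (m : R) : supersol b c0 0 s -> 0 <= m ->
  supersol b c0 0 (fun x => Num.min (s x) m).
Proof.
move=> [s0 sF sL] m0; pose f x := Num.min (s x) m.
have fs x : f x <= s x by rewrite ge_min lexx.
have fm x : f x <= m by rewrite ge_min lexx orbT.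
have f0 x : 0 <= f x by rewrite le_min s0.
have fF : inF b f by apply: (inF_le hg _ sF) => x; rewrite !ger0_norm.
split => // x; rewrite -/f; have /(inFP hg)/(_ x) sfF := fF.
have := sL x; rewrite /Lap !mul0r !addr0 => h.
have [sm|ms] := leP (s x) m.
  have e : f x = s x by rewrite /f min_l.
  apply: (le_trans h); apply: ler_rsum; [exact: (inF_summ hg x sF)|exact: (inF_summ hg x fF)|].
  by move=> y; rewrite e ler_wpM2l ?(graph_b_ge0 hg)// lerD2l lerN2.
have e : f x = m by rewrite /f min_r// ltW.
apply: ge0_rsum => y; rewrite e mulr_ge0 ?(graph_b_ge0 hg)// subr_ge0//.
Qed.

Lemma path_edge_change (s : X -> R) x y : s x != s y ->
  exists v w, 0 < b v w /\ s v < s w.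
Proof.
have [p []] := hc x y; elim: p x => [|z p IH] x /=.
  by move=> _ ->; rewrite eqxx.
move=> /andP[bxz pz] lz sxy.
have [e|] := eqVneq (s x) (s z); first by apply: (IH z) => //; rewrite -e.
rewrite neq_lt => /orP[h|h]; first by exists x, z.
by exists z, x; rewrite (graph_b_sym hg).
Qed.

(** On an edge with s v < s w, truncation of [s] at the level s w makes [w] a maximum with a
    strictly lower neighbour, so the Laplacian there is at least e > 0. Division by [e] gives a
    supersolution for 1_w that bounds the iteration; its limit is a Green function at [w]. *)
Lemma nonconstant_transient s x y : supersol b c0 0 s -> s x != s y ->
  transient b c0 o.
Proof.
move=> hs sxy; have [v [w [bvw svw]]] := path_edge_change sxy.
have m0 : 0 <= s w by have [h _ _] := hs; exact: h.
have [f0 fF fL] := supersol_min hs m0; set f := (fun x => Num.min _ _) in f0 fF fL.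
have fw : f w = s w by rewrite /f minxx.
have fm z : f z <= s w by rewrite /f ge_min lexx orbT.
pose e := b w v * (s w - s v).
have e0 : 0 < e by rewrite mulr_gt0 ?subr_gt0// (graph_b_sym hg).
have eL : e <= Lap b c0 f w.
  rewrite /Lap mul0r addr0.
  have p0 z : 0 <= b w z * (f w - f z).
    by rewrite mulr_ge0 ?(graph_b_ge0 hg)// fw subr_ge0.
  have := le_summ_seq (s := [:: v]) p0 (inF_summ hg w fF) isT.
  rewrite big_seq1; apply: le_trans; rewrite /e fw ler_wpM2l ?(graph_b_ge0 hg)//.
  by rewrite lerD2l lerN2 /f ge_min lexx.
(* No evaluation bound is available yet; positivity comes from connectedness and the existence of
   two distinct points. *)
have deg0 z : 0 < degree b c0 z.
  have [z' bz] : exists z', 0 < b z z'.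
    have vw : v != w by apply: contraTneq bvw => ->; rewrite (graph_b_diag hg) ltxx.
    have [t zt] : exists t, z != t.
      by have [->|] := eqVneq z v; [exists w|exists v].
    have [[|z' p] [/= hp hl]] := hc z t; first by rewrite hl eqxx in zt.
    by exists z'; have /andP[] := hp.
  rewrite /degree addr0; apply: (lt_le_trans bz).
  have sb : summ (b z).
    by apply/(summ_ge0 (graph_b_ge0 hg z)); exact: (graph_b_sum hg).
  by have := le_summ_seq (s := [:: z']) (graph_b_ge0 hg z) sb isT; rewrite big_seq1.
have fe : e^-1 *: f + 0 = e^-1 *: f by rewrite addr0.
have hf : supersol b c0 (ind1 w) (e^-1 *: f).
  split=> [z||z].
  - by rewrite mulr_ge0 ?invr_ge0 ?(ltW e0)// f0.
  - by rewrite -fe; apply: (inFL hg) => //; exact: (inF0 hg).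
  - rewrite -fe (LapL hg)//; last exact: (inF0 hg).
    have -> : Lap b c0 (0 : X -> R) z = 0 by have := Lap_const b c0 0 z; rewrite mulr0.
    rewrite addr0 ler_pdivlMl//.
    have [->|zw] := eqVneq z w; first by rewrite ind1_eq mulr1.
    by rewrite ind1_ne// mulr0; exact: fL.
have i0 := ind1_ge0 (R := R) w.
have itM z : exists M, forall n, approx_sol b c0 (ind1 w) n z <= M.
  by exists ((e^-1 *: f) z) => n; exact: (it_le_supersol hg deg0 hf).
have QM n : dirichlet_form b c0 (approx_sol b c0 (ind1 w) n)
    (approx_sol b c0 (ind1 w) n) <= min_sol b c0 (ind1 w) w.
  apply: le_trans (Q_it hg deg0 i0 n) _.
  rewrite -/(l2dot _ (ind1 w)) l2dot_ind1.
  exact: (it_le_min_sol hg deg0 i0 itM).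
have hD : D0 b c0 o (min_sol b c0 (ind1 w)).
  apply: (D0_bounded_limit _ hg (it_fs b c0 (ind1 w)) QM).
  by move=> z; exact: (it_cvg hg deg0 i0 itM).
have hG : is_green b c0 o w (min_sol b c0 (ind1 w)).
  split => //; first exact: (min_sol_inF hg deg0 i0 itM).
  exact: (Lap_min_sol hg deg0 i0 itM).
apply: (eval_bound_transient _ hg hc).
exact: (eval_bound_all hg hc (green_eval_bound hg hG)).
Qed.

End recurrence.

(** * Exchanging sums over vertices with integrals *)

Section integral_esum.
Context {R : realType} {X : countType}.
Local Open Scope ereal_scope.

(** The enumeration of [X] may have gaps, filled here with 0; it turns the sum into a series, which
    integrates term by term. *)
Lemma esum_nneseries (f : X -> \bar R) : (forall y, 0 <= f y) ->
  \esum_(y in [set: X]) f y =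
  \sum_(n <oo) (if @pickle_inv X n is Some y then f y else 0).
Proof.
move=> f0; pose a n := if @pickle_inv X n is Some y then f y else 0.
have a0 n : 0 <= a n by rewrite /a; case: (pickle_inv _).
rewrite nneseries_esumT// -/a.
transitivity (\esum_(n in pickle @` [set: X]) a n).
  rewrite (esum_image [set: X] pickle a).
    by apply: eq_esum => y _; rewrite /a pickleK_inv.
  by move=> x y _ _; exact: (pcan_inj pickleK).
rewrite esum_mkcond; apply: eq_esum => n _; case: ifPn => //.
rewrite notin_setE /a => h; case e : (@pickle_inv X n) => [y|//].
by case: h; exists y => //; have := @pickle_invK X n; rewrite /oapp e.
Qed.

Lemma integral_esum d (T : measurableType d) (mu : {measure set T -> \bar R})
  (D : set T) (f : X -> T -> \bar R) : measurable D ->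
  (forall y, measurable_fun D (f y)) -> (forall y t, 0 <= f y t) ->
  \int[mu]_(t in D) (\esum_(y in [set: X]) f y t) =
  \esum_(y in [set: X]) \int[mu]_(t in D) f y t.
Proof.
move=> mD mf f0.
under eq_integral do rewrite esum_nneseries//.
rewrite integral_nneseries//; first last.
- by move=> n t _; case: (pickle_inv _).
- by move=> n; case: (@pickle_inv X n) => [y|]; [exact: mf|exact: measurable_cst].
rewrite esum_nneseries; last by move=> y; apply: integral_ge0 => t _.
apply: eq_eseriesr => n _; case: (pickle_inv _) => [//|].
by rewrite integral0.
Qed.

Lemma measurable_esum d (T : measurableType d) (D : set T) (f : X -> T -> \bar R) :
  (forall y, measurable_fun D (f y)) -> (forall y t, 0 <= f y t) ->
  measurable_fun D (fun t => \esum_(y in [set: X]) f y t).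
Proof.
move=> mf f0; under eq_fun do rewrite esum_nneseries//.
apply: ge0_emeasurable_sum => [n t _ _|n _]; first by case: (pickle_inv _).
by case: (@pickle_inv X n) => [y|]; [exact: mf|exact: measurable_cst].
Qed.

End integral_esum.

(** * Duhamel's formula *)

Section heat_flow.
Context {R : realType} {X : countType}.
Variables (b : X -> X -> R) (c : X -> R) (o : X).
Hypothesis hg : is_graph b c.
Hypothesis hc : connected_graph b.
Implicit Types (t T : R) (k s u : X -> R).
Local Notation G := (gfun b c).
Local Notation Pt := (Pt b c o).
Local Notation hk := (hk b c o).
Local Open Scope ereal_scope.

Lemma one_supersol : supersol b c c (fun=> 1%R).
Proof. by split=> [//||x]; [exact: (inF_const hg)|rewrite Lap_const mulr1]. Qed.

Lemma supersol0W k s : (forall x, (0 <= k x)%R) -> supersol b c k s -> supersol b c 0%R s.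
Proof. by move=> k0 [h1 h2 h3]; split => // x; exact: le_trans (h3 x). Qed.

Lemma Pt_le t (H K : X -> \bar R) x : (0 <= t)%R -> (forall y, H y <= K y) ->
  Pt t H x <= Pt t K x.
Proof.
by move=> t0 HK; apply: le_esum => y _; rewrite lee_wpmul2l// lee_fin hk_ge0.
Qed.

Lemma PtD t (H K : X -> \bar R) x : (0 <= t)%R ->
  (forall y, 0 <= H y) -> (forall y, 0 <= K y) ->
  Pt t (fun y => H y + K y) x = Pt t H x + Pt t K x.
Proof.
move=> t0 H0 K0; have h0 y : 0 <= (hk t x y)%:E by rewrite lee_fin hk_ge0.
apply: etrans (esumD _ _); [|by move=> y _; rewrite mule_ge0..].
by apply: eq_esum => y _; rewrite ge0_muleDr.
Qed.

Lemma Pt1_le1 t x : (0 <= t)%R -> Pt t (fun=> 1) x <= 1.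
Proof.
move=> t0; apply: (Pt_superharmonic o hg hc x _ t0).
exact: (supersol0W (graph_c_ge0 hg) one_supersol).
Qed.

(** The semigroup law combines with P 1 <= 1. Monotonicity in time upgrades a limit along integers
    to a limit along reals. *)
Lemma Pt1_noninc t T x : (0 <= t)%R -> (t <= T)%R ->
  Pt T (fun=> 1) x <= Pt t (fun=> 1) x.
Proof.
move=> t0 tT; have r0 : (0 <= T - t)%R by rewrite subr_ge0.
have E : Pt (t + (T - t)) (EFin \o (fun=> 1%R)) x =
         Pt t (Pt (T - t) (EFin \o (fun=> 1%R))) x.
  exact: (Pt_add o hg hc x t0 r0).
move: E; rewrite addrC subrK => ->; apply: Pt_le => // y.
exact: Pt1_le1.
Qed.

Section duhamel.
Hypothesis hE : forall x, eval_bound b c x.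
Variable k : X -> R.
Hypothesis k0 : forall x, (0 <= k x)%R.

Let flow x t y : \bar R := (hk (pos t) x y * k y)%:E.

Let flow_ge0 x t y : 0 <= flow x t y.
Proof. by rewrite lee_fin mulr_ge0// hk_ge0// pos_ge0. Qed.

Let flow_measurable x y (D : set R) : measurable_fun D (fun t => flow x t y).
Proof.
apply: (@continuous_measurable_EFin _ (fun t => hk (pos t) x y * k y)%R) => t.
by apply: cvgMl; exact: (hk_continuous hg hc).
Qed.

Let integral_flow x y (D : set R) : measurable D ->
  \int[lebesgue_measure]_(t in D) flow x t y =
  (k y)%:E * \int[lebesgue_measure]_(t in D) (hk (pos t) x y)%:E.
Proof.
move=> mD; rewrite -ge0_integralZl//.
- by apply: eq_integral => t _; rewrite /flow mulrC.
- apply: (@continuous_measurable_EFin _ (fun t => hk (pos t) x y)).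
  exact: (@hk_continuous _ _ _ _ _ hg hc x y).
- by move=> t _; rewrite lee_fin hk_ge0// pos_ge0.
- by rewrite lee_fin.
Qed.

Let heat_flowE x t : (0 <= t)%R ->
  heat_ext b c o t (fun y => (k y)%:E) x = \esum_(y in [set: X]) flow x t y.
Proof.
move=> t0; apply: (etrans (heat_extE o hg hc _ x t0)).
by apply: eq_esum => y _; rewrite /flow (posE t0) EFinM.
Qed.

Let integral_heat x (D : set R) : measurable D -> (forall t, D t -> (0 <= t)%R) ->
  \int[lebesgue_measure]_(t in D) heat_ext b c o t (fun y => (k y)%:E) x =
  \esum_(y in [set: X]) ((k y)%:E * \int[lebesgue_measure]_(t in D) (hk (pos t) x y)%:E).
Proof.
move=> mD D0.
transitivity (\int[lebesgue_measure]_(t in D) (\esum_(y in [set: X]) flow x t y)).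
  by apply: eq_integral => t /set_mem Dt; exact/heat_flowE/D0.
apply: etrans (@integral_esum _ _ _ _ lebesgue_measure D (fun y t => flow x t y) mD _ _) _ => //.
  by move=> y; exact: flow_measurable.
by apply: eq_esum => y _; exact: integral_flow.
Qed.

(** [integral_hk] is summed against [k]; all terms are non-negative, so sums commute with the
    integral and with P_T, infinite values included. *)
Lemma duhamel T x : (0 < T)%R ->
  \int[lebesgue_measure]_(t in `[0%R, T]) heat_ext b c o t (fun y => (k y)%:E) x
  + Pt T (fun z => \esum_(y in [set: X]) (G y z * k y)%:E) x
  = \esum_(y in [set: X]) (G y x * k y)%:E.
Proof.
move=> T0; have G0 y z : (0 <= G y z)%R by exact: gfun_ge0.
have h0 y : (0 <= hk T x y)%R by apply: hk_ge0 => //; exact: ltW.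
rewrite integral_heat//; last by move=> t /=; rewrite in_itv/= => /andP[].
have -> : Pt T (fun z => \esum_(y in [set: X]) (G y z * k y)%:E) x =
    \esum_(y in [set: X]) ((k y)%:E * Pt T (fun z => (G y z)%:E) x).
  transitivity (\esum_(z in [set: X]) \esum_(y in [set: X])
      (hk T x z * (G y z * k y))%:E).
    apply: eq_esum => z _; rewrite -esumZ//.
    by move=> y _; rewrite lee_fin mulr_ge0.
  rewrite (@esum_interchange _ _ _ (fun p => (hk T x p.1 * (G p.2 p.1 * k p.2))%:E));
    last by move=> p; rewrite lee_fin !mulr_ge0.
  apply: eq_esum => y _; rewrite -esumZ//; last first.
    by move=> z _; rewrite -EFinM lee_fin mulr_ge0.
  by apply: eq_esum => z _; rewrite -!EFinM; congr EFin; ring.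
rewrite -esumD; first last.
- move=> y _; rewrite mule_ge0 ?lee_fin//; apply: (Pt_ge0 o hg hc); first exact: ltW.
  by move=> z; rewrite lee_fin.
- move=> y _; rewrite mule_ge0 ?lee_fin//; apply: integral_ge0 => t _.
  by rewrite lee_fin hk_ge0// pos_ge0.
apply: eq_esum => y _; rewrite -ge0_muleDr; first last.
- apply: (Pt_ge0 o hg hc); first exact: ltW.
  by move=> z; rewrite lee_fin.
- apply: integral_ge0 => t _.
  by rewrite lee_fin hk_ge0// pos_ge0.
by rewrite integral_hk// -EFinM mulrC.
Qed.

Lemma integral_heat_cvg x :
  \int[lebesgue_measure]_(t in `[0%R, n.+1%:R]) heat_ext b c o t (fun y => (k y)%:E) x
    @[n --> \oo] --> \esum_(y in [set: X]) (G y x * k y)%:E.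
Proof.
have E : \bigcup_n [set` `[0%R, n.+1%:R]] = `[0%R, +oo[%classic :> set R.
  apply/seteqP; split => t /=.
    by move=> [n _] /=; rewrite !in_itv/= => /andP[-> _].
  rewrite in_itv/= andbT => t0; exists (Num.bound t) => //=.
  rewrite in_itv/= t0/=; apply: (le_trans (ltW (archi_boundP t0))).
  by rewrite ler_nat.
have -> : \esum_(y in [set: X]) (G y x * k y)%:E =
    \int[lebesgue_measure]_(t in \bigcup_n [set` `[0%R, n.+1%:R]])
      heat_ext b c o t (fun y => (k y)%:E) x.
  rewrite E integral_heat//; last by move=> t /=; rewrite in_itv/= => /andP[].
  by apply: eq_esum => y _; rewrite integral_hk_y// -EFinM mulrC.
apply: ge0_nondecreasing_set_cvg_integral => //.
- move=> m n mn; apply/subsetPset => t /=; rewrite !in_itv/= => /andP[-> h].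
  by rewrite (le_trans h)// ler_nat.
- move=> n; apply: (@eq_measurable_fun _ _ _ _ _ (fun t => \esum_(y in [set: X]) flow x t y)).
    by move=> t /set_mem /=; rewrite in_itv/= => /andP[t0 _]; rewrite heat_flowE.
  by apply: measurable_esum.
- move=> n t /=; rewrite in_itv/= => /andP[t0 _]; rewrite heat_flowE//.
  exact: esum_neqNy.
Qed.

End duhamel.
End heat_flow.

(** * The equivalences *)

Lemma Lap_kill {R : realType} {X : countType} (b : X -> X -> R) (c f : X -> R) x :
  Lap b c f x = Lap b (fun=> 0) f x + c x * f x.
Proof. by rewrite /Lap mul0r addr0. Qed.

Lemma is_graph_kill0 {R : realType} {X : countType} (b : X -> X -> R) (c : X -> R) :
  is_graph b c -> is_graph b (fun=> 0).
Proof. by case. Qed.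

Section green_potentials.
Context {R : realType} {X : countType}.
Variables (b : X -> X -> R) (c : X -> R) (o : X).
Hypothesis hg : is_graph b c.
Hypothesis hc : connected_graph b.
Hypothesis hE : forall x, eval_bound b c x.
Implicit Types (k s u : X -> R).
Local Notation G := (gfun b c).

(** Applying [green_sum_Lap] to the positive and negative parts of the density identifies it with L
    u. *)
Lemma potential_Lap u : potential b c o u -> forall x,
  summ (fun y => G y x * Lap b c u y) /\ u x = rsum (fun y => G y x * Lap b c u y).
Proof.
move=> [uF [k [hk uk]]].
have G0 y x : 0 <= G y x by exact: gfun_ge0.
have sk x : summ (fun y => G y x * k y).
  apply: (@summ_le _ _ _ (fun y => G y x * `|k y|)) => [y|].
    by rewrite normrM ger0_norm.
  by have := hk x; under eq_esum do rewrite greenE//.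
have main (f : X -> R) : (forall y, 0 <= f y) -> (forall y, f y <= `|k y|) ->
    [/\ forall x, summ (fun y => G y x * f y),
        inF b (fun x => rsum (fun y => G y x * f y)) &
        forall x, Lap b c (fun x => rsum (fun y => G y x * f y)) x = f x].
  move=> f0 fk.
  have p0 x y : 0 <= G y x * f y by exact: mulr_ge0.
  have sf x : summ (fun y => G y x * f y).
    apply: (@summ_le _ _ _ (fun y => G y x * `|k y|)) => [y|].
      by rewrite ger0_norm// ler_wpM2l.
    by have := hk x; under eq_esum do rewrite greenE//.
  have [|_ h2 h3] := green_sum_Lap hg hE (u := fun x => rsum (fun y => G y x * f y)) f0.
    by move=> x; rewrite rsum_EFin.
  by split.
have [|y|sp Fp Lp] := main (fun y => Num.max (k y) 0).
- by move=> y; rewrite le_max lexx orbT.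
- by rewrite ge_max ler_norm normr_ge0.
have [|y|sn Fn Ln] := main (fun y => Num.max (- k y) 0).
- by move=> y; rewrite le_max lexx orbT.
- by rewrite ge_max -normrN ler_norm normr_ge0.
set up := (fun x => rsum _) in Fp Lp; set un := (fun x => rsum _) in Fn Ln.
have kE y : k y = Num.max (k y) 0 - Num.max (- k y) 0.
  by case: (leP (k y) 0) => h; case: (leP (- k y) 0) => h'; lra.
have uE : u = up - un.
  apply/funext => x; rewrite uk -[RHS]/(up x - un x) /up /un -rsumB//.
  by apply: eq_rsum => y; rewrite greenE// {1}kE mulrBr.
have LE : Lap b c u = k.
  by apply/funext => x; rewrite uE (LapB hg)// Lp Ln -kE.
move=> x; rewrite LE; split => //; rewrite uk.
by apply: eq_rsum => y; rewrite greenE.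
Qed.

Lemma potential_greenE u x : (forall y, 0 <= Lap b c u y) -> potential b c o u ->
  (u x)%:E = (\esum_(y in [set: X]) (G y x * Lap b c u y)%:E)%E.
Proof.
move=> L0 /potential_Lap/(_ x)[s ->]; rewrite rsum_EFin// => y.
by rewrite mulr_ge0// gfun_ge0.
Qed.

Lemma potential_gfun y : potential b c o (G y).
Proof.
have e x : (fun z => green b c o x z * `|ind1 y z|) = fun z => green b c o x z * ind1 y z.
  by apply/funext => z; rewrite ger0_norm// ind1_ge0.
have G0 z x : 0 <= G z x by exact: gfun_ge0.
have S x : (\esum_(z in [set: X]) (green b c o x z * ind1 y z)%:E = (G y x)%:E)%E.
  rewrite (@esum_single _ _ _ y).
  - by rewrite ind1_eq mulr1 greenE.
  - by move=> z zy; rewrite ind1_ne// mulr0.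
  - by rewrite lee_fin greenE// mulr_ge0// ind1_ge0.
split; first exact: gfun_inF.
exists (ind1 y); split=> x.
  by under eq_esum do rewrite ger0_norm ?ind1_ge0//; rewrite S ltry.
rewrite rsum_ge0E ?S// => z; first by rewrite greenE// mulr_ge0// ind1_ge0.
Qed.

(* The part of the constant function 1 that is a potential; the remainder
   [1 - kill_prob] is the largest harmonic function bounded by 1. *)
Definition kill_prob x : R := fine (\esum_(y in [set: X]) (G y x * c y)%:E)%E.

Lemma kill_probE x : ((kill_prob x)%:E = \esum_(y in [set: X]) (G y x * c y)%:E)%E.
Proof.
rewrite /kill_prob fineK// ge0_fin_numE; last first.
  by apply: esum_neqNy => y; rewrite lee_fin mulr_ge0 ?gfun_ge0// (graph_c_ge0 hg).
apply: le_lt_trans (green_sum_min hg hE x (graph_c_ge0 hg) (one_supersol hg)) _.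
exact: ltry.
Qed.

Lemma GposE x : Gpos b c o c x = (kill_prob x)%:E.
Proof. by rewrite kill_probE; apply: eq_esum => y _; rewrite greenE. Qed.

Lemma kill_probP : [/\ forall x, 0 <= kill_prob x, forall x, kill_prob x <= 1, inF b kill_prob &
  forall x, Lap b c kill_prob x = c x].
Proof.
have [h1 h2 h3] := green_sum_Lap hg hE (graph_c_ge0 hg) kill_probE.
split => // x; rewrite -lee_fin kill_probE.
exact: (green_sum_min hg hE x (graph_c_ge0 hg) (one_supersol hg)).
Qed.

Lemma Lap_kill_prob x : Lap b (fun=> 0) kill_prob x = c x * (1 - kill_prob x).
Proof.
have [_ _ _ /(_ x)] := kill_probP; rewrite Lap_kill => e.
by rewrite mulrBr mulr1 -{1}e addrK.
Qed.

Lemma survival_harmonic : harmonic_fun b c (fun x => 1 - kill_prob x).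
Proof.
have [h0 h1 hF hL] := kill_probP; have F1 := inF_const hg 1.
split; first exact: (inFB hg F1 hF).
move=> x; have /= := LapB hg (f := fun=> 1) x F1 hF; rewrite hL Lap_const mulr1 subrr.
by apply.
Qed.

Lemma bounded_harmonic_eq0 u (M : R) : (forall x, kill_prob x = 1) ->
  harmonic_fun b c u -> (forall x, `|u x| <= M) -> forall x, u x = 0.
Proof.
move=> k1 hu uM x0.
have M0 : 0 <= M by apply: le_trans (uM x0).
have c0 := graph_c_ge0 hg.
have key (a : R) : `|a| = 1 -> 0 <= a * u x0.
  move=> a1.
  have hs : supersol b c (fun x => c x * M) (a *: u + (fun=> M)).
    have [uF uL] := hu; have FM := inF_const hg M.
    split=> [x||x].
    - rewrite -[_ x]/(a * u x + M) -lerBlDr sub0r lerNl.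
      apply: le_trans (ler_norm _) _; rewrite normrN normrM a1 mul1r; exact: uM.
    - exact: (inFL hg).
    - by rewrite (LapL hg)// uL mulr0 add0r Lap_const.
  have := green_sum_min hg hE x0 (fun y => mulr_ge0 (c0 y) M0) hs.
  under eq_esum do rewrite mulrA mulrC EFinM.
  rewrite esumZ//; last by move=> y _; rewrite lee_fin mulr_ge0 ?gfun_ge0.
  rewrite -kill_probE k1 mule1 lee_fin -[_ x0]/(a * u x0 + M); lra.
have := key 1 (normr1 _); have := key (-1) (normrN1 _).
by rewrite mul1r mulN1r oppr_ge0 => h1 h2; apply/eqP; rewrite eq_le h1.
Qed.

Lemma esum_Lap_potential u : (forall x, kill_prob x = 1) ->
  (forall y, 0 <= Lap b c u y) -> potential b c o u ->
  (\esum_(x in [set: X]) (Lap b c u x)%:E = \esum_(x in [set: X]) (c x * u x)%:E)%E.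
Proof.
move=> k1 L0 hu; have c0 := graph_c_ge0 hg.
have G0 y x : 0 <= G y x by exact: gfun_ge0.
transitivity (\esum_(x in [set: X]) \esum_(y in [set: X])
   (c x * (G y x * Lap b c u y))%:E)%E; last first.
  apply: eq_esum => x _; rewrite EFinM (potential_greenE x L0 hu) -esumZ//.
  by move=> y _; rewrite lee_fin mulr_ge0.
rewrite (@esum_interchange _ _ _
  (fun p => (c p.1 * (G p.2 p.1 * Lap b c u p.2))%:E)); last first.
  by move=> p; rewrite lee_fin !mulr_ge0.
apply: eq_esum => y _.
transitivity ((Lap b c u y)%:E * \esum_(x in [set: X]) (G x y * c x)%:E)%E.
  by rewrite -kill_probE k1 mule1.
rewrite -esumZ//; last by move=> x _; rewrite lee_fin mulr_ge0.
apply: eq_esum => x _; rewrite -EFinM (gfun_sym o hg hc y x hE); congr EFin; ring.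
Qed.

Lemma esum_kill_prob y : (\esum_(x in [set: X]) (c x * G y x)%:E = (kill_prob y)%:E)%E.
Proof.
by rewrite kill_probE; apply: eq_esum => x _; rewrite (gfun_sym o hg hc x y hE) mulrC.
Qed.

End green_potentials.

Lemma adde_EFinK {R : realType} (a : \bar R) (q v : R) :
  (a + q%:E = v%:E -> a = (v - q)%:E)%E.
Proof. by case: a => [r| |] //; rewrite -EFinD => -[<-]; rewrite addrK. Qed.

(** * Long-time behaviour and the survival function *)

Section heat_limits.
Context {R : realType} {X : countType}.
Variables (b : X -> X -> R) (c : X -> R) (o : X).
Hypothesis hg : is_graph b c.
Hypothesis hc : connected_graph b.
Hypothesis hE : forall x, eval_bound b c x.
Local Notation G := (gfun b c).
Local Notation Pt := (Pt b c o).
Local Notation hk := (hk b c o).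
Local Notation w := (kill_prob b c).
Local Open Scope ereal_scope.

Lemma duhamel_kill T x : (0 < T)%R ->
  \int[lebesgue_measure]_(t in `[0%R, T]) heat_ext b c o t (fun y => (c y)%:E) x
  + Pt T (fun z => (w z)%:E) x = (w x)%:E.
Proof.
move=> T0; have E := duhamel o hg hc hE (graph_c_ge0 hg) x T0.
rewrite (kill_probE hg hE x) -E; congr (_ + _).
by apply: eq_esum => z _; rewrite (kill_probE hg hE z).
Qed.

Lemma Mt1 T x : (forall y, w y = 1%R) -> (0 < T)%R -> Mt b c o T x = 1.
Proof.
move=> w1 T0; rewrite /Mt (heat_extE o hg hc _ x (ltW T0)) addrC.
have := duhamel_kill x T0; rewrite w1 => {2}<-; congr (_ + _).
by apply: eq_esum => z _; rewrite w1.
Qed.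

(** When G c = 1, Duhamel's formula reads: the integral up to t is 1 - P_t 1. The integrals tend to
    G c = 1, so P_t 1 tends to 0 along integers and, being non-increasing, along all times. *)
Lemma heat_ext1_cvg0 x : (forall y, w y = 1%R) ->
  heat_ext b c o t (fun=> 1) x @[t --> +oo%R] --> 0.
Proof.
move=> w1.
pose J n := \int[lebesgue_measure]_(t in `[0%R, n.+1%:R])
  heat_ext b c o t (fun y => (c y)%:E) x.
pose p t : R := fine (Pt t (fun=> 1) x).
have P0 t : (0 <= t)%R -> 0 <= Pt t (fun=> 1) x.
  by move=> t0; apply: (Pt_ge0 o hg hc).
have pE t : (0 <= t)%R -> Pt t (fun=> 1) x = (p t)%:E.
  move=> t0; rewrite fineK// ge0_fin_numE ?P0//.
  exact: le_lt_trans (Pt1_le1 o hg hc x t0) (ltry _).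
clearbody p.
have p0 t : (0 <= t)%R -> (0 <= p t)%R by move=> t0; rewrite -lee_fin -pE ?P0.
have JE n : J n = (1 - p n.+1%:R)%:E.
  have := @duhamel_kill n.+1%:R x (ltr0Sn _ _); rewrite w1 -/(J n).
  have -> : Pt n.+1%:R (fun z => (w z)%:E) x = (p n.+1%:R)%:E.
    by rewrite -pE//; apply: eq_esum => z _; rewrite w1.
  exact: adde_EFinK.
have J1 : (1 - p n.+1%:R)%R @[n --> \oo] --> (1 : R)%R.
  have E : 1%:E = \esum_(y in [set: X]) (G y x * c y)%:E by rewrite -(kill_probE hg hE x) w1.
  have H : J n @[n --> \oo] --> 1%:E.
    by have := @integral_heat_cvg R X b c o hg hc hE c (graph_c_ge0 hg) x; rewrite -E.
  have <- : fine \o J = (fun n => 1 - p n.+1%:R)%R.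
    by apply/funext => n; exact: (congr1 fine (JE n)).
  exact: (fine_cvg H).
apply/fine_cvgP; split.
  near=> t; rewrite heat_extE// ?pE//; near: t; exact: nbhs_pinfty_ge.
apply/cvgr0Pnorm_lt => e e0.
have /cvgrPdist_lt/(_ e e0)[N _ HN] := J1.
near=> t; have Nt : (N.+1%:R <= t)%R by near: t; exact: nbhs_pinfty_ge.
have t0 : (0 <= t)%R by apply: le_trans Nt.
rewrite /= heat_extE// pE//= ger0_norm ?p0//.
have := HN N (leqnn N); rewrite /= subKr ger0_norm ?p0//.
apply: le_lt_trans; rewrite -lee_fin -(pE t t0) -(pE N.+1%:R (ler0n _ _)).
exact: Pt1_noninc.
Unshelve. all: by end_near.
Qed.

(** Splitting 1 = (1 - w) + w inside P_T 1, Duhamel's formula turns P_T w plus the integral of the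
    killing into w x. *)
Lemma Pt_survival_eq T x : (0 < T)%R -> Mt b c o T x = 1 ->
  Pt T (fun z => (1 - w z)%:E) x = (1 - w x)%:E.
Proof.
move=> T0; rewrite /Mt (heat_extE o hg hc _ x (ltW T0)).
have [w0 w1 _ _] := kill_probP hg hE.
have E : Pt T (fun=> 1) x =
    Pt T (fun z => (1 - w z)%:E) x + Pt T (fun z => (w z)%:E) x.
  rewrite -PtD//; first last.
  - by move=> y; rewrite lee_fin subr_ge0.
  - exact: ltW.
  by apply: eq_esum => z _; rewrite -EFinD subrK.
rewrite E -addeA [X in _ + X]addeC duhamel_kill//.
exact: adde_EFinK.
Qed.

(** Two half-times let equality at one point spread: P_t h <= h and P_t (P_t h) = h at [x] give P_t
    (h - P_t h) = 0 at [x], and the kernel is strictly positive. *)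
Lemma Pt_fixed_point (h : X -> R) t x : supersol b c 0%R h -> (0 < t)%R ->
  Pt (t + t) (EFin \o h) x = (h x)%:E -> forall y, Pt t (EFin \o h) y = (h y)%:E.
Proof.
move=> hh t0 e y; have [h0 _ _] := hh; have t0' := ltW t0.
have P0 z : 0 <= Pt t (EFin \o h) z.
  by apply: (Pt_ge0 o hg hc) => // v; rewrite /= lee_fin.
have Ph z : Pt t (EFin \o h) z <= (h z)%:E by exact: (Pt_superharmonic o hg hc z hh t0').
pose p z := fine (Pt t (EFin \o h) z).
have pE z : Pt t (EFin \o h) z = (p z)%:E.
  by rewrite fineK// ge0_fin_numE//; exact: le_lt_trans (Ph z) (ltry _).
clearbody p.
have ph z : (p z <= h z)%R by rewrite -lee_fin -pE.
have p0 z : (0 <= p z)%R by rewrite -lee_fin -pE.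
have e1 : Pt t (fun z => (p z)%:E) x = (h x)%:E.
  move: e; rewrite (Pt_add o hg hc x t0' t0' h0) => <-.
  by apply: eq_esum => z _; rewrite pE.
have e2 : Pt t (fun z => (h z - p z)%:E) x + (h x)%:E <= (h x)%:E.
  rewrite -{1}e1 -PtD//; first last.
  - by move=> z; rewrite lee_fin subr_ge0.
  apply: le_trans (Ph x); apply: Pt_le => // z.
  by rewrite -EFinD subrK.
have d0 z : 0 <= (hk t x z)%:E * (h z - p z)%:E.
  by rewrite mule_ge0 ?lee_fin ?hk_ge0 ?subr_ge0.
have := le_trans (leeD2r (h x)%:E (esum_ge1 y d0)) e2.
rewrite -EFinM -EFinD lee_fin gerDr => H.
have : (h y - p y <= 0)%R by have := hk_gt0 o hg hc x y t0 => k0; rewrite pmulr_rle0 in H.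
by rewrite subr_le0 pE => hp; congr EFin; apply/eqP; rewrite eq_le ph.
Qed.

(** Iterating, h = P_(nt) h <= P_(nt) 1, which tends to 0. *)
Lemma survival_eq0 (h : X -> R) t : (forall x, 0 <= h x)%R -> (forall x, h x <= 1)%R ->
  (0 < t)%R -> (forall x, Pt t (EFin \o h) x = (h x)%:E) ->
  (forall x, heat_ext b c o r (fun=> 1) x @[r --> +oo%R] --> 0) ->
  forall x, h x = 0%R.
Proof.
move=> h0 h1 t0 ht lim0 x; have t0' := ltW t0.
have hn n : Pt (n.+1%:R * t) (EFin \o h) x = (h x)%:E.
  elim: n => [|n IH]; first by rewrite mul1r.
  have n0 : (0 <= n.+1%:R * t)%R by rewrite mulr_ge0.
  rewrite -natr1 mulrDl mul1r (Pt_add o hg hc x n0 t0' h0).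
  by rewrite -IH; apply: eq_esum => z _; rewrite ht.
apply/eqP; rewrite eq_le h0 andbT; apply/ler_addgt0Pl => e e0; rewrite addr0.
have /fine_cvgP[f1 /cvgr0Pnorm_lt/(_ e e0) f2] := lim0 x.
have [M [_ HM]] := filterI f1 f2.
pose n := Num.bound (`|M| / t).
have Mn : (M < n.+1%:R * t)%R.
  apply: le_lt_trans (ler_norm M) _; rewrite -ltr_pdivrMr//.
  apply: lt_le_trans (archi_boundP _) _; first by rewrite divr_ge0.
  by rewrite ler_nat.
have n0 : (0 <= n.+1%:R * t)%R by rewrite mulr_ge0.
have [/= f3 f4] := HM _ Mn.
rewrite -lee_fin -(hn n); apply: (@le_trans _ _ (Pt (n.+1%:R * t) (fun=> 1) x)).
  by apply: Pt_le => // z; rewrite /= lee_fin.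
rewrite -(heat_extE o hg hc _ _ n0) -(fineK f3) lee_fin.
exact: le_trans (ler_norm _) (ltW f4).
Qed.

End heat_limits.

(** * Thick sets and the Green function without killing *)

Section thick_sets.
Context {R : realType} {X : countType}.
Variables (b : X -> X -> R) (c : X -> R) (o : X).
Hypothesis hg : is_graph b c.
Hypothesis hc : connected_graph b.
Local Notation c0 := (fun _ : X => 0 : R).
Local Notation G0 := (gfun b c0).
Local Notation w := (kill_prob b c).

Let hg0 : is_graph b c0 := is_graph_kill0 hg.

Lemma Gb_transient x y : transient b c0 o -> Gb b o x y = (G0 y x)%:E.
Proof.
move=> ht; rewrite /Gb; case: asboolP => // _.
rewrite -(integral_hk_y o hg0 hc (transient_eval_bound hg0 ht) x y).
apply: eq_integral => t /set_mem/=; rewrite in_itv/= andbT => t0.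
by congr EFin; rewrite (posE t0); exact: (heat_hk o hg0 hc x y t0).
Qed.

Lemma Gb_recurrent x y : ~ transient b c0 o -> Gb b o x y = +oo%E.
Proof. by rewrite /Gb; case: asboolP. Qed.

Lemma Gb_ge0 x y : (0 <= Gb b o x y)%E.
Proof.
have [ht|ht] := pselect (transient b c0 o); last by rewrite Gb_recurrent// leey.
by rewrite Gb_transient// lee_fin gfun_ge0//; exact: (transient_eval_bound hg0 ht).
Qed.

Let kA (A : set X) y : R := if y \in ~` A then c y else 0.

Let kA_ge0 A y : 0 <= kA A y.
Proof. by rewrite /kA; case: ifP => // _; exact: (graph_c_ge0 hg). Qed.

Let Gb_sumE A x : transient b c0 o ->
  (\esum_(y in ~` A) (Gb b o x y * (c y)%:E) =
   \esum_(y in [set: X]) (G0 y x * kA A y)%:E)%E.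
Proof.
move=> ht; rewrite esum_mkcond; apply: eq_esum => y _.
by rewrite /kA; case: ifP => _; rewrite ?mulr0// Gb_transient.
Qed.

(** Harnack's inequality for the functions G_z, with a constant independent of the pole z, compares
    the sums term by term. In the recurrent case the terms do not depend on the starting point. *)
Lemma Gb_sum_all A x y :
  (\esum_(z in ~` A) (Gb b o x z * (c z)%:E) = +oo)%E ->
  (\esum_(z in ~` A) (Gb b o y z * (c z)%:E) = +oo)%E.
Proof.
have [ht|ht] := pselect (transient b c0 o); last first.
  by under eq_esum do rewrite Gb_recurrent//; under [in X in _ -> X]eq_esum do rewrite Gb_recurrent//.
have hE := transient_eval_bound hg0 ht; rewrite !Gb_sumE// => e.
have [C C0 HC] := harnack hg0 hc y x.
apply/eqP; rewrite -leye_eq leNgt; apply/negP => h.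
have : (\esum_(z in [set: X]) (G0 z x * kA A z)%:E <=
        C%:E * \esum_(z in [set: X]) (G0 z y * kA A z)%:E)%E.
  rewrite -esumZ//; last by move=> z _; rewrite lee_fin mulr_ge0// gfun_ge0.
  apply: le_esum => z _; rewrite -EFinM lee_fin mulrA ler_wpM2r//.
  exact: HC (gfun_supersol hg0 hE z).
rewrite e leye_eq => /eqP e2.
have : (C%:E * (\esum_(z in [set: X]) (G0 z y * kA A z)%:E) < +oo)%E.
  by rewrite lte_mul_pinfty.
by rewrite e2 ltxx.
Qed.

Lemma not_thick (A : set X) : ~ thick b A ->
  exists s x, [/\ supersol b c0 0 s, forall y, A y -> 1 <= s y & s x < 1].
Proof.
apply: contra_notP => H s [sF sL] s0 sA x; rewrite leNgt; apply/negP => sx.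
by apply: H; exists s, x.
Qed.

Hypothesis ht : transient b c o.
Let hE := transient_eval_bound hg ht.

(** With c = 0 the two graphs coincide, and [ht] would contradict recurrence. *)
Lemma recurrent_c_neq0 : ~ transient b c0 o -> exists y, 0 < c y.
Proof.
apply: contra_notP => H; suff <- : c = c0 by [].
apply/funext => y; apply/eqP; rewrite eq_le (graph_c_ge0 hg) andbT leNgt.
by apply/negP => cy; apply: H; exists y.
Qed.

Lemma Gb_sum_infinite (A : set X) x : (forall x, w x = 1) -> ~ thick b A ->
  (\esum_(y in ~` A) (Gb b o x y * (c y)%:E) = +oo)%E.
Proof.
move=> w1 /not_thick[s [x1 [hs sA sx1]]].
have [ht0|ht0] := pselect (transient b c0 o); last first.
  (* On a recurrent graph [s] is constant, and it is below 1 at [x1], so [A] is empty; a single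
     vertex with c > 0 then makes the sum infinite. *)
  have A0 y : ~ A y.
    move=> Ay; apply: ht0; apply: (nonconstant_transient o hg0 hc hs (x := y) (y := x1)).
    by apply/eqP => e; have := sA y Ay; rewrite e leNgt sx1.
  have [y cy] := recurrent_c_neq0 ht0.
  rewrite esum_mkcond; apply/eqP; rewrite -leye_eq.
  apply: le_trans (esum_ge1 y _).
    by rewrite mem_set; [rewrite Gb_recurrent// gt0_mulye ?lte_fin|exact: A0].
  move=> z; case: ifP => // _.
  by rewrite mule_ge0 ?Gb_ge0// lee_fin (graph_c_ge0 hg).
have hE0 := transient_eval_bound hg0 ht0.
apply/eqP; rewrite -leye_eq leNgt; apply/negP => fin.
have finA y : (\esum_(z in ~` A) (Gb b o y z * (c z)%:E) < +oo)%E.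
  rewrite ltNge leye_eq; apply/eqP => /(Gb_sum_all x) e; move: fin.
  by rewrite e ltxx.
pose v y := fine (\esum_(z in [set: X]) (G0 z y * kA A z)%:E)%E.
have vE y : ((v y)%:E = \esum_(z in [set: X]) (G0 z y * kA A z)%:E)%E.
  rewrite fineK// ge0_fin_numE -?Gb_sumE//.
  by rewrite Gb_sumE//; apply: esum_neqNy => z; rewrite lee_fin mulr_ge0 ?gfun_ge0.
have [v0 vF vL] := green_sum_Lap hg0 hE0 (kA_ge0 A) vE.
clearbody v; have [s0 sF sL] := hs.
have e1 : 1 *: s + v = (fun y => s y + v y).
  by apply/funext => y; rewrite -[LHS]/(1 * s y + v y) mul1r.
have LsvE y : Lap b c0 (fun y => s y + v y) y = Lap b c0 s y + kA A y.
  by rewrite -e1 (LapL hg0)// mul1r vL.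
have svF : inF b (fun y => s y + v y) by rewrite -e1; exact: (inFL hg0).
have hsv : supersol b c c (fun y => s y + v y).
  split=> [y||y]; [exact: addr_ge0|exact: svF|].
  (* Off [A] the Laplacian of [v] already supplies [c]; on [A] the killing term c (s + v) is at
     least [c] because s >= 1 there. *)
  rewrite Lap_kill LsvE; have /= sLy := sL y; have cy := graph_c_ge0 hg y.
  rewrite /kA; case: ifPn => [_|].
    by rewrite addrAC -[leLHS]add0r lerD2r addr_ge0// mulr_ge0// addr_ge0.
  rewrite in_setC negbK => /set_mem/sA sy.
  rewrite addr0; apply: ler_wpDl => //.
  by rewrite ler_peMr//; apply: le_trans sy _; rewrite lerDl.
have sv1 y : 1 <= s y + v y.
  by rewrite -lee_fin -[1](w1 y) (kill_probE hg hE); exact: (green_sum_min hg hE y (graph_c_ge0 hg) hsv).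
have hz : supersol b c0 (kA A) ((fun y => s y + v y) - (fun=> 1)).
  have F1 := inF_const hg0 1; split=> [y||y].
  - by rewrite -[_ y]/(s y + v y - 1) subr_ge0.
  - exact: (inFB hg0).
  - rewrite (LapB hg0)// Lap_const mul0r subr0 LsvE -[leLHS]add0r lerD2r.
    exact: sL.
have := green_sum_min hg0 hE0 x1 (kA_ge0 A) hz.
rewrite -vE lee_fin -[leRHS]/(s x1 + v x1 - 1) addrAC -[leLHS]add0r lerD2r subr_ge0.
by rewrite leNgt sx1.
Qed.

Lemma kill_prob1 : (forall A, ~ thick b A ->
    exists x, (\esum_(y in ~` A) (Gb b o x y * (c y)%:E) = +oo)%E) ->
  forall x, w x = 1.
Proof.
move=> H x0; have [w0 w1 wF wL] := kill_probP hg hE.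
have wL0 := Lap_kill_prob hg hE.
apply/eqP; rewrite eq_le w1/= leNgt; apply/negP => wx0.
have k0 y : 0 <= c y * (1 - w y).
  by rewrite mulr_ge0 ?subr_ge0// (graph_c_ge0 hg).
have hw : supersol b c0 (fun y => c y * (1 - w y)) w by split=> // y; rewrite wL0.
have hw0 := supersol0W k0 hw.
(* On a recurrent graph the superharmonic function [w] is constant, so 0 = c (1 - w); at a vertex
   with c > 0 this forces w = 1. *)
have [ht0|ht0] := pselect (transient b c0 o); last first.
  have [y cy] := recurrent_c_neq0 ht0.
  have wc z : w z = w x0.
    apply/eqP; apply/negPn/negP => e; apply: ht0.
    exact: (nonconstant_transient o hg0 hc hw0 e).
  have := wL0 y; have -> : w = (fun=> w x0) by apply/funext.
  rewrite Lap_const mul0r => /esym/eqP; rewrite mulf_eq0 (gt_eqF cy)/=.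
  by rewrite subr_eq0 => /eqP e; move: wx0; rewrite -e ltxx.
have hE0 := transient_eval_bound hg0 ht0.
(* Half of the gap at [x0]: the function w / (1 - d) is at least 1 on [A] and equals (1 - 2 d) / (1
   - d) < 1 at [x0], which shows that [A] is not thick. *)
pose d := (1 - w x0) / 2.
have dE : w x0 = 1 - 2 * d by rewrite /d; field.
have d0 : 0 < d by rewrite divr_gt0// subr_gt0.
have d1 : 0 < 1 - d by have := w0 x0; rewrite dE; move: (d) d0 => q; lra.
pose A : set X := [set x | 1 - w x <= d].
have nA : ~ thick b A.
  move=> /(_ ((1 - d)^-1 *: w)) hA.
  have F0 := inF0 hg0.
  have e : (1 - d)^-1 *: w + 0 = (1 - d)^-1 *: w by rewrite addr0.
  have : 1 <= ((1 - d)^-1 *: w) x0.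
    apply: hA => [|y|y].
    - split; first by rewrite -e; exact: (inFL hg0).
      move=> y; rewrite -e (LapL hg0)//.
      have -> : Lap b c0 (0 : X -> R) y = 0 by have := Lap_const b c0 0 y; rewrite mulr0.
      by rewrite addr0 mulr_ge0 ?invr_ge0 ?(ltW d1)// wL0.
    - by rewrite mulr_ge0 ?invr_ge0 ?(ltW d1).
    - rewrite /A/= => hy; rewrite -[leRHS]/((1 - d)^-1 * w y) ler_pdivlMl// mulr1.
      by move: (w y) (d) hy => p q; lra.
  rewrite -[leRHS]/((1 - d)^-1 * w x0) ler_pdivlMl// mulr1 dE.
  by move: (d) d0 => q; lra.
have [x] := H A nA; rewrite Gb_sumE// => e.
have dV : 0 <= d^-1 by rewrite invr_ge0 ltW.
(* Off [A] one has 1 < (1 - w) / d, so the sum in (v) is at most 1 / d times the potential of c (1 -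
   w), which is below [w]. *)
have : (\esum_(y in [set: X]) (G0 y x * kA A y)%:E <=
        (d^-1)%:E * \esum_(y in [set: X]) (G0 y x * (c y * (1 - w y)))%:E)%E.
  rewrite -esumZ//; last by move=> y _; rewrite lee_fin mulr_ge0// gfun_ge0.
  apply: le_esum => y _; rewrite -EFinM lee_fin mulrCA ler_wpM2l ?gfun_ge0//.
  rewrite /kA; case: ifPn => [|_]; last by rewrite mulr_ge0.
  move=> /set_mem; rewrite /A/= => /negP; rewrite -ltNge => dy.
  rewrite ler_pdivlMl// mulrC ler_wpM2l ?(graph_c_ge0 hg)//; exact: ltW.
rewrite e leye_eq => /eqP e2.
have : ((d^-1)%:E * (\esum_(y in [set: X]) (G0 y x * (c y * (1 - w y)))%:E) < +oo)%E.
  rewrite lte_mul_pinfty//.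
  exact: le_lt_trans (green_sum_min hg0 hE0 x k0 hw) (ltry _).
by rewrite e2 ltxx.
Qed.

End thick_sets.

Theorem theorem1 (R : realType) (X : countType) (b : X -> X -> R) (c : X -> R)
    (o : X) (hgraph : is_graph b c) (hconn : connected_graph b)
    (htrans : transient b c o) :
  [<->
    (* (i) *)
    forall u : X -> R, harmonic_fun b c u ->
      (exists M : R, forall x, `|u x| <= M) -> forall x, u x = 0 ;
    (* (ii) *)
    forall x, Gpos b c o c x = 1%E ;
    (* (ii), as a potential *)
    potential b c o (fun=> 1) ;
    (* (iii) *)
    stochastically_complete_at_infinity b c o /\
    (forall x, heat_ext b c o t (fun=> 1%E) x @[t --> +oo%R] --> 0%E) ;
    (* (iv) *)
    forall u : X -> R, superharmonic_fun b c u -> potential b c o u ->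
      (\esum_(x in [set: X]) (Lap b c u x)%:E
       = \esum_(x in [set: X]) (c x * u x)%:E)%E ;
    (* (v) *)
    forall A : set X, ~ thick b A ->
      exists x, (\esum_(y in ~` A) (Gb b o x y * (c y)%:E) = +oo)%E ]
  /\
  (* in (v), "some x" is equivalent to "all x" *)
  (forall A : set X, ~ thick b A ->
    (exists x, (\esum_(y in ~` A) (Gb b o x y * (c y)%:E) = +oo)%E) <->
    (forall x, (\esum_(y in ~` A) (Gb b o x y * (c y)%:E) = +oo)%E)).
Proof.
have hE := transient_eval_bound hgraph htrans.
have c0 := graph_c_ge0 hgraph; have [w0 w1 wF wL] := kill_probP hgraph hE.
have GE := GposE o hgraph hconn hE.
split; last first.
  by move=> A _; split=> [[x hx] y|h]; [exact: (Gb_sum_all hgraph hconn y hx)|exists o].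
tfae.
- move=> Hi x; rewrite GE; congr EFin; apply/eqP; rewrite -subr_eq0 -oppr_eq0 opprB.
  apply/eqP; apply: (Hi (fun x => 1 - kill_prob b c x)).
    exact: (survival_harmonic hgraph hE).
  by exists 1 => y; rewrite ger0_norm ?subr_ge0// gerBl.
- move=> Hii; split; first exact: (inF_const hgraph).
  exists c; split => x.
    by under eq_esum do rewrite ger0_norm//; rewrite [ltLHS]Hii ltry.
  have p0 y : 0 <= green b c o x y * c y by rewrite greenE// mulr_ge0// gfun_ge0.
  by rewrite rsum_ge0E// [X in fine X]Hii.
- move=> Hp.
  have LE y : Lap b c (fun=> 1) y = c y by rewrite Lap_const mulr1.
  have wE x : kill_prob b c x = 1.
    apply/EFin_inj; rewrite (kill_probE hgraph hE).
    rewrite (@potential_greenE _ _ _ _ o hgraph hconn hE (fun=> 1) x _ Hp); last first.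
      by move=> y; rewrite LE.
    by apply: eq_esum => y _; rewrite LE.
  split; last by move=> x; exact: heat_ext1_cvg0.
  by exists 1; split=> //; exists o; exact: Mt1.
- move=> [[t [t0 [x hx]]] lim0] u [uF uL] hu.
  have h0 y : 0 <= 1 - kill_prob b c y by rewrite subr_ge0.
  have hh : supersol b c 0 (fun y => 1 - kill_prob b c y).
    by have [F L] := survival_harmonic hgraph hE; split=> // y; rewrite L.
  (* The time at which completeness is known is halved, because [Pt_fixed_point] starts from an
     equality at a doubled time. *)
  have t20 : 0 < t / 2 by rewrite divr_gt0.
  have fixed := Pt_survival_eq hgraph hconn hE t0 hx.
  rewrite {1}[t]splitr in fixed.
  have fixed2 := Pt_fixed_point hgraph hconn hh t20 fixed.
  have h1 y : 1 - kill_prob b c y <= 1 by rewrite gerBl.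
  have z := survival_eq0 hgraph hconn h0 h1 t20 fixed2 lim0.
  apply: (esum_Lap_potential hgraph hconn hE _ uL hu) => y.
  by apply/eqP; rewrite eq_sym -subr_eq0 z.
- move=> Hiv A nA; exists o; apply: (Gb_sum_infinite hgraph hconn htrans) => // y.
  apply/EFin_inj; rewrite -(esum_kill_prob o hgraph hconn hE).
  have LG := Lap_gfun hgraph hE y.
  rewrite -Hiv.
  + rewrite (@esum_single _ _ _ y); first by rewrite LG ind1_eq.
    * by move=> z zy; rewrite LG ind1_ne.
    * by rewrite LG lee_fin ind1_ge0.
  + by split=> [|z]; [exact: gfun_inF|rewrite LG ind1_ge0].
  + exact: potential_gfun.
- move=> Hv u hu [M HM].
  apply: (bounded_harmonic_eq0 hgraph hE _ hu HM).
  exact: (kill_prob1 hgraph hconn htrans Hv).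
Qed.
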